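(* Let $d>4$ be an integer. Then there exists $\beta_0>0$ such that for all $\beta\in[0,1]$ with $\beta<\beta_0$, the $\beta$-weakly self-avoiding walk on $\mathbb{Z}^d$ satisfies $$G^{\mathrm{saw}}_{\lambda_c}(x)\le 2\,G^{\mathrm{rw}}(x)\qquad\text{for all } x\in\mathbb{Z}^d,$$ where $G^{\mathrm{saw}}_{\lambda}=G^{\beta,\mathrm{saw}}_{\lambda}$ is the weakly self-avoiding walk Green's function with parameter $\beta$, $\lambda_c=\lambda_c(\beta)$ is its critical value, and $G^{\mathrm{rw}}$ is the simple random walk Green's function.
   Context: For $n\ge 0$, a nearest-neighbour path of length $n$ in $\mathbb{Z}^d$ is a map $\gamma:\{0,\dots,n\}\to\mathbb{Z}^d$ such that $\gamma(i)$ and $\gamma(i+1)$ are neighbours (at Euclidean distance 1) for all $0\le i<n$; its length is $\mathrm{len}(\gamma)=n$ (the number of edges). Write $\gamma:0\to x$ if $\gamma$ is a nearest-neighbour path of any length starting at $0$ and ending at $x$. For $\beta\in[0,1]$ the weight of $\gamma$ is $$W^\beta(\gamma)=(1-\beta)^{|\{0\le s<t\le \mathrm{len}(\gamma)\,:\,\gamma(s)=\gamma(t)\}|}$$ (with $0^0=1$). The $\beta$-weakly self-avoiding walk Green's function is, for $\lambda\ge 0$, $$G^{\mathrm{saw}}_\lambda(x)=G^{\beta,\mathrm{saw}}_\lambda(x)=\sum_{\gamma:0\to x}\lambda^{\mathrm{len}(\gamma)}W^\beta(\gamma)\in[0,\infty],$$ and the critical value is $\lambda_c=\sup\{\lambda:\sum_{x\in\mathbb{Z}^d}G^{\mathrm{saw}}_\lambda(x)<\infty\}$.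 The simple random walk Green's function is $G^{\mathrm{rw}}(x)=\sum_{n=0}^\infty p_n(x)$, where $p_n(x)$ is the probability that simple random walk on $\mathbb{Z}^d$ started from $0$ is at $x$ at time $n$. *)

(* Defs.v *)
From HB Require Import structures.
From mathcomp Require Import all_boot all_order all_algebra.
From mathcomp Require Import all_classical all_reals.
From mathcomp Require Import ereal topology normedtype sequences esum.

Set Implicit Arguments.
Unset Strict Implicit.
Unset Printing Implicit Defensive.

Import Order.TTheory GRing.Theory Num.Theory.

Local Open Scope classical_set_scope.
Local Open Scope ring_scope.

Notation lattice d := 'rV[int]_d.

(* Euclidean distance 1, written as squared distance 1 to stay in [int]. *)
Definition neighbours (d : nat) (x y : lattice d) : bool :=
  \sum_(i < d) (x ord0 i - y ord0 i) ^+ 2 == 1.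

(* A path of length n has n edges, hence n + 1 vertices. *)
Definition trajectory (d n : nat) := {ffun 'I_n.+1 -> lattice d}.

Definition nn_path (d n : nat) (g : trajectory d n) : Prop :=
  forall i j : 'I_n.+1, j = i.+1 :> nat -> neighbours (g i) (g j).

(* Trajectories of arbitrary length: [tag w] is the length of [w]. *)
Notation walk d := {n : nat & {ffun 'I_n.+1 -> lattice d}}.

Definition paths_to (d : nat) (x : lattice d) : set (walk d) :=
  [set w | [/\ nn_path (tagged w),
               tagged w ord0 = 0 & tagged w ord_max = x]].

Definition self_intersections (d n : nat) (g : trajectory d n) : nat :=
  #|[set st : 'I_n.+1 * 'I_n.+1 | (st.1 < st.2)%N & g st.1 == g st.2]|.

Section Green.
Context {R : realType} {d : nat}.

(* [_ ^+ 0 = 1] in MathComp, including [0 ^+ 0]. *)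
Definition saw_weight (beta : R) (w : walk d) : R :=
  (1 - beta) ^+ self_intersections (tagged w).

Definition G_saw (beta lambda : R) (x : lattice d) : \bar R :=
  \esum_(w in paths_to x) (lambda ^+ tag w * saw_weight beta w)%:E.

(* [e_i] and [- e_i]. *)
Definition unit_step (s : 'I_d * bool) : lattice d :=
  (-1) ^+ s.2 *: delta_mx ord0 s.1.

(* The walk at time n is the sum of n independent steps, each uniform on the
   2d unit steps; the probability below is taken under the product law. *)
Definition srw_prob (n : nat) (x : lattice d) : R :=
  \sum_(s : {ffun 'I_n -> 'I_d * bool} | \sum_(i < n) unit_step (s i) == x)
    \prod_(i < n) (2 * d)%:R^-1.

Definition G_rw (x : lattice d) : \bar R :=
  (\sum_(0 <= n <oo) (srw_prob n x)%:E)%E.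

End Green.

(* A supremum in R. The set contains 0, and for d > 0 it is bounded above by 1:
   straight walks along a coordinate axis contribute lambda ^+ n for every n.
   So [sup] does not take its default value. *)
Definition lambda_c {R : realType} (d : nat) (beta : R) : R :=
  sup [set lambda : R | 0 <= lambda /\
         (\esum_(x in [set: lattice d]) G_saw beta lambda x < +oo)%E].

(* Main.v *)
(** In terms of z = 2 d lambda, the lace expansion reads
    (z + sigma) G = C - kappa V + G * H + (error), where C is the simple random
    walk Green function, V = G * C, kappa = 1 - z - (mass of P), and
    H = P * C - (mass of P) C + sigma delta for the lace kernel P with second
    moment sigma. Assume G <= 3 C. The diagrams then give |P| <= O(beta) C^3 off
    the origin, of order |x|^(6 - 3 d). Since P has the symmetries of the cube,
    the first moments vanish and the second moments of the Taylor expansion of C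
    combine into the Laplacian of C, which vanishes off the origin; so H decays
    like beta |x|^(-d-1). Such an H is summable and C * |H| <= O(beta) C. Since
    kappa >= 0, this improves the assumption to G <= 2 C. Starting from z <= 1,
    where G <= C, a continuity argument reaches the critical value: below it G
    decays exponentially, so convexity in z shows that the set of z with G <= 2
    C has no last point before the critical one.

    The walks are summed with a recursion on their first step that carries the
    list of the past positions as seen from the current one. In this form the
    lace expansion with all its coefficients is obtained from a single induction,
    and the estimates on C rest on explicit super- and subharmonic functions
    (|x|^2 + A)^(-k/2), without any Fourier analysis. *)

Require Import Defs.
From HB Require Import structures.
From mathcomp Require Import all_boot all_order all_algebra all_fingroup.
From mathcomp Require Import all_classical all_reals.
From mathcomp Require Import ereal topology normedtype sequences esum.
From mathcomp Require Import ring lra zify.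

Set Implicit Arguments.
Unset Strict Implicit.
Unset Printing Implicit Defensive.

Import Order.TTheory GRing.Theory Num.Theory.

Local Open Scope classical_set_scope.
Local Open Scope ring_scope.

(** * The lattice: sup norm, boxes and unit steps *)

Section Lattice.
Context {d : nat}.
Implicit Types (x y : lattice d) (n : nat).

(** Every series is cut at [N] steps, so the expansion is an identity between finite sums for each
    [N]. The price is a remainder made of increments of partial sums. It is small for large [N] once
    the susceptibility is bounded, which is why the bootstrap runs strictly below the critical value
    and the critical point itself is reached as a left limit. The dimension enters through
    exponents. C is of order |x|^(2 - d), and d > 4 amounts to 3 <= d - 2, which makes C^2 summable
    (the bubble), and also to d + 4 <= 3 (d - 2), which lets C^3 absorb a factor |x|^3 and remain of
    the summable order |x|^(-d-1). Laces with any number of loops are not estimated one by one: an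
    explicit two-term function is a supersolution of the recursion that generates them, and a single
    induction bounds them all. The gap between 3 and 2 comes from z + sigma >= 3/4 and from a
    contribution of H of at most C / 2, which give G <= (4/3) (3/2) C = 2 C. *)

Definition sup_norm x : nat := \max_(i < d) `|x ord0 i|%N.

Definition box n : seq (lattice d) :=
  [seq \row_i ((f i : nat)%:Z - n%:Z) | f : {ffun 'I_d -> 'I_(n.*2.+1)}].

Lemma sup_norm_leP x n :
  reflect (forall i, `|x ord0 i| <= n)%N (sup_norm x <= n)%N.
Proof.
apply: (iffP idP) => [h i|h]; last by apply/bigmax_leqP => i _; exact: h.
by move: h => /bigmax_leqP; apply.
Qed.

Lemma box_uniq n : uniq (box n).
Proof.
rewrite map_inj_uniq ?enum_uniq // => f g /rowP fg; apply/ffunP => i.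
by have := fg i; rewrite !mxE => h; apply: val_inj => /=; lia.
Qed.

Lemma mem_box n x : (x \in box n) = (sup_norm x <= n)%N.
Proof.
apply/mapP/sup_norm_leP => [[f _ ->] i|h].
  rewrite mxE; move: (ltn_ord (f i)); move: (nat_of_ord (f i)) => m; lia.
have hi i : (`|(x ord0 i + n%:Z)%R| < n.*2.+1)%N by have := h i; lia.
exists [ffun i => Ordinal (hi i)]; rewrite ?mem_enum //.
apply/rowP => i; rewrite mxE ffunE /=; have := h i; rewrite (_ : x 0 i = x ord0 i) //.
move: (x ord0 i) => u hu; rewrite gez0_abs ?addrK //.
move: hu; clear. lia.
Qed.

Lemma sup_norm0 : sup_norm 0 = 0%N.
Proof. by apply/eqP; rewrite -leqn0; apply/sup_norm_leP => i; rewrite mxE. Qed.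

Lemma sup_normN x : sup_norm (- x) = sup_norm x.
Proof. by apply: eq_bigr => i _; rewrite mxE abszN. Qed.

Lemma sup_normD x y : (sup_norm (x + y)%R <= sup_norm x + sup_norm y)%N.
Proof.
apply/sup_norm_leP => i; rewrite mxE.
have /sup_norm_leP/(_ i) := leqnn (sup_norm x).
have /sup_norm_leP/(_ i) := leqnn (sup_norm y).
by move: (x _ _) (y _ _) (sup_norm x) (sup_norm y) => *; lia.
Qed.

Lemma sup_norm_eq0 x : (sup_norm x == 0%N) = (x == 0).
Proof.
apply/eqP/eqP => [h|->]; last exact: sup_norm0.
apply/rowP => i; have /sup_norm_leP/(_ i) : (sup_norm x <= 0)%N by rewrite h.
by rewrite mxE leqn0 absz_eq0 => /eqP.
Qed.

Lemma unit_stepE (s : 'I_d * bool) j :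
  unit_step s ord0 j = (-1) ^+ s.2 * (s.1 == j)%:R.
Proof. by rewrite !mxE eqxx /= eq_sym. Qed.

Lemma sup_norm_unit_step (s : 'I_d * bool) : (sup_norm (unit_step s) <= 1)%N.
Proof.
apply/sup_norm_leP => i; rewrite unit_stepE.
by case: s => j [] /=; case: (j == i); rewrite ?mulr0 ?mulr1.
Qed.

Lemma unit_stepN (i : 'I_d) b : - unit_step (i, b) = unit_step (i, ~~ b).
Proof.
by apply/rowP => j; rewrite mxE !unit_stepE /=; case: b; rewrite !expr0 !expr1 ?mulN1r ?opprK ?mul1r.
Qed.

Lemma unit_step_neq0 (s : 'I_d * bool) : unit_step s != 0.
Proof.
apply/eqP => /rowP/(_ s.1); rewrite unit_stepE eqxx mulr1 mxE.
by case: s.2.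
Qed.

Lemma unit_step_inj : injective (@unit_step d).
Proof.
move=> [i a] [j b] /rowP h; have := h i; rewrite !unit_stepE /= eqxx.
case: (eqVneq j i) => [->|ij]; last by case: a {h}; case: b.
by case: a {h}; case: b.
Qed.

Lemma sum_steps (V : nmodType) (F : lattice d -> V) :
  \sum_(s : 'I_d * bool) F (unit_step s) =
  \sum_i (F (unit_step (i, false)) + F (unit_step (i, true))).
Proof.
rewrite (eq_bigl (fun p => xpredT p.1 && xpredT p.2)) //.
rewrite (eq_bigr (fun p => (fun i b => F (unit_step (i, b))) p.1 p.2)); last by case.
rewrite -(pair_big xpredT xpredT (fun i b => F (unit_step (i, b)))) /=.
by apply: eq_bigr => i _; rewrite big_bool addrC.
Qed.

Lemma sum_stepsN (V : nmodType) (F : lattice d -> V) :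
  \sum_(s : 'I_d * bool) F (- unit_step s) = \sum_s F (unit_step s).
Proof.
rewrite !(sum_steps F) (sum_steps (fun x => F (- x))).
by apply: eq_bigr => i _; rewrite !unit_stepN addrC.
Qed.

End Lattice.

(** * Random walk averages *)

Section Average.
Context {R : realType} {d : nat}.
Implicit Types (x y : lattice d) (f g : lattice d -> R).

Definition avg f x : R := (2 * d)%:R^-1 * \sum_(s : 'I_d * bool) f (x + unit_step s).

Definition dirac_at y x : R := (x == y)%:R.

Lemma avg_ext f g x : f =1 g -> avg f x = avg g x.
Proof. by move=> fg; congr (_ * _); apply: eq_bigr => s _. Qed.

Lemma avgD f g x : avg (fun y => f y + g y) x = avg f x + avg g x.
Proof. by rewrite /avg big_split mulrDr. Qed.

Lemma avgZ (c : R) f x : avg (fun y => c * f y) x = c * avg f x.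
Proof. by rewrite /avg -mulr_sumr mulrCA. Qed.

Lemma avgB f g x : avg (fun y => f y - g y) x = avg f x - avg g x.
Proof.
rewrite avgD; congr (_ + _).
by rewrite (@avg_ext _ (fun y => -1 * g y)) ?avgZ ?mulN1r // => y; rewrite mulN1r.
Qed.

Lemma avg_sum (I : Type) (r : seq I) (P : pred I) (F : I -> lattice d -> R) x :
  avg (fun y => \sum_(i <- r | P i) F i y) x = \sum_(i <- r | P i) avg (F i) x.
Proof. by rewrite /avg exchange_big mulr_sumr. Qed.

Lemma ler_avg f g x : (forall s, f (x + unit_step s) <= g (x + unit_step s)) ->
  avg f x <= avg g x.
Proof. by move=> fg; rewrite ler_wpM2l ?invr_ge0 // ler_sum. Qed.

Lemma avg_ge0 f x : (forall s, 0 <= f (x + unit_step s)) -> 0 <= avg f x.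
Proof. by move=> f0; rewrite mulr_ge0 ?invr_ge0 // sumr_ge0. Qed.

Lemma avg_cst (c : R) x : (0 < d)%N -> avg (fun=> c) x = c.
Proof.
move=> d0; rewrite /avg sumr_const card_prod card_ord card_bool.
rewrite -[c *+ _]mulr_natr mulrCA mulnC mulVf ?mulr1 // pnatr_eq0; lia.
Qed.

Lemma avg_shift f x y : avg (fun z => f (y + z)) x = avg f (y + x).
Proof. by congr (_ * _); apply: eq_bigr => s _; rewrite addrA. Qed.

Lemma avg_opp f x : avg (fun z => f (- z)) x = avg f (- x).
Proof.
rewrite /avg; congr (_ * _); rewrite -(sum_stepsN (fun e => f (- x + e))).
by apply: eq_bigr => s _; rewrite opprD.
Qed.

Lemma avg_le_max f x (b : R) : (0 < d)%N ->
  (forall s, f (x + unit_step s) <= b) -> avg f x <= b.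
Proof. by move=> d0 fb; rewrite -[leRHS](avg_cst b x) // ler_avg. Qed.

Lemma avg_step_le f (s : 'I_d * bool) x : (forall y, 0 <= f y) -> (0 < d)%N ->
  f (x + unit_step s) <= (2 * d)%:R * avg f x.
Proof.
move=> f0 d0; rewrite mulrA divff ?mul1r ?pnatr_eq0; last lia.
by rewrite (bigD1 s) //= lerDl sumr_ge0.
Qed.

Lemma iter_avg_ge0 f : (forall y, 0 <= f y) -> forall n x, 0 <= iter n avg f x.
Proof. by move=> f0; elim=> [|n IH] x //=; apply: avg_ge0. Qed.

Lemma ler_iter_avg f g : (forall y, f y <= g y) ->
  forall n x, iter n avg f x <= iter n avg g x.
Proof. by move=> fg; elim=> [|n IH] x //=; apply: ler_avg. Qed.

Lemma iter_avg_sum (I : Type) (r : seq I) (F : I -> lattice d -> R) n x :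
  iter n avg (fun y => \sum_(i <- r) F i y) x = \sum_(i <- r) iter n avg (F i) x.
Proof.
elim: n x => [|n IH] x //=; rewrite -avg_sum.
by apply: avg_ext.
Qed.

Lemma iter_avgZ (c : R) f n x : iter n avg (fun y => c * f y) x = c * iter n avg f x.
Proof. by elim: n x => [|n IH] x //=; rewrite -avgZ; apply: avg_ext. Qed.

Lemma iter_avg_shift f n x y :
  iter n avg (fun z => f (y + z)) x = iter n avg f (y + x).
Proof. by elim: n x => [|n IH] x //=; rewrite -avg_shift; apply: avg_ext. Qed.

Lemma iter_avg_opp f n x : iter n avg (fun z => f (- z)) x = iter n avg f (- x).
Proof. by elim: n x => [|n IH] x //=; rewrite -avg_opp; apply: avg_ext. Qed.

Lemma iter_avg_ext f g n x : f =1 g -> iter n avg f x = iter n avg g x.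
Proof. by move=> fg; elim: n x => [|n IH] x //=; apply: avg_ext. Qed.

(** Summed maximum principle: iterating the hypothesis gives the bound with the extra term
    [iter K avg s x] on the left, which is nonnegative. All upper bounds on C and on convolutions
    with C come from an explicit supersolution [s]. *)
Lemma potential_le (s g : lattice d -> R) : (forall x, 0 <= s x) ->
  (forall x, g x + avg s x <= s x) ->
  forall K x, \sum_(n < K) iter n avg g x <= s x.
Proof.
move=> s0 sg K; have -> : s = fun x => s x by [].
suff h x : \sum_(n < K) iter n avg g x + iter K avg s x <= s x.
  by move=> x; apply: le_trans (h x); rewrite lerDl iter_avg_ge0.
elim: K x => [|K IH] x; first by rewrite big_ord0 add0r.
rewrite big_ord_recr /=; apply: le_trans (IH x); rewrite -addrA lerD2l.
rewrite -iterS -[X in _ + X]/(iter K.+1 avg s x) iterSr.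
elim: K {IH} x => [|K IH] x //=.
by rewrite -avgD; apply: ler_avg.
Qed.

Definition srw n x : R := iter n avg (dirac_at 0) x.

Lemma srw_ge0 n x : 0 <= srw n x.
Proof. by apply: iter_avg_ge0 => y; rewrite /dirac_at. Qed.

Lemma srwN n x : srw n (- x) = srw n x.
Proof.
rewrite /srw -iter_avg_opp; apply: iter_avg_ext => y.
by rewrite /dirac_at oppr_eq0.
Qed.

Lemma iter_avg_dirac n x y : iter n avg (dirac_at y) x = srw n (x - y).
Proof.
rewrite /srw [x - y]addrC -iter_avg_shift; apply: iter_avg_ext => z.
by rewrite /dirac_at addrC subr_eq0.
Qed.

(** The left-hand side is [iter n avg] applied to [g] cut off outside [l], and averaging is
    monotone. *)
Lemma srw_sum_le (l : seq (lattice d)) n g x : uniq l -> (forall y, 0 <= g y) ->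
  \sum_(y <- l) srw n (x - y) * g y <= iter n avg g x.
Proof.
move=> ul g0.
have -> : \sum_(y <- l) srw n (x - y) * g y =
    iter n avg (fun z => \sum_(y <- l) g y * dirac_at y z) x.
  by rewrite iter_avg_sum; apply: eq_bigr => y _; rewrite iter_avgZ iter_avg_dirac mulrC.
apply: ler_iter_avg => z; case: (boolP (z \in l)) => zl.
  rewrite (bigD1_seq z) //= {1}/dirac_at eqxx mulr1 big1 ?addr0 // => y yz.
  by rewrite /dirac_at eq_sym (negPf yz) mulr0.
rewrite big1_seq // => y /= yl; rewrite /dirac_at.
by case: eqP => [zy|_]; rewrite ?mulr0 //; move: zl; rewrite zy yl.
Qed.

End Average.

(** * Discrete Laplacian of (|x|^2 + A)^(-k/2) *)

Section InvSqrtTaylor.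
Context {R : realType}.
Implicit Types (h : R) (k : nat).

Definition inv_sqrt1D h : R := (Num.sqrt (1 + h))^-1.

Lemma inv_sqrt1D_sqr h : `|h| <= 4^-1 -> inv_sqrt1D h ^+ 2 * (1 + h) = 1.
Proof.
rewrite ler_norml => /andP[h1 h2]; rewrite exprVn sqr_sqrtr; last lra.
by rewrite mulVf //; lra.
Qed.

Lemma inv_sqrt1D_bounds h : `|h| <= 4^-1 -> 0 < inv_sqrt1D h <= 2.
Proof.
move=> hh; have := inv_sqrt1D_sqr hh; move: hh; rewrite ler_norml => /andP[h1 h2].
have t0 : 0 < inv_sqrt1D h by rewrite invr_gt0 sqrtr_gt0; lra.
by rewrite t0 /=; move: (inv_sqrt1D h) t0 => t t0; nra.
Qed.

(** No derivative is taken: [t] solves [t ^+ 2 * (1 + h) = 1] and the cubic [P] solves it up to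
    O(h^4). The difference of the two equations factors as (t - P) (t + P) (1 + h), where the last
    two factors have product at least 1/3. *)
Lemma inv_sqrt1D_taylor h : `|h| <= 4^-1 ->
  `|inv_sqrt1D h - (1 - 1 / 2 * h + 3 / 8 * h ^+ 2 - 5 / 16 * h ^+ 3)| <= 3 * h ^+ 4.
Proof.
move=> hh; have := inv_sqrt1D_sqr hh; have /andP[t0 t2] := inv_sqrt1D_bounds hh.
have h3b : - 64^-1 <= h ^+ 3 <= 64^-1.
  rewrite -ler_norml normrX (_ : 64^-1 = 4^-1 ^+ 3); last by field.
  by rewrite lerXn2r ?nnegrE //.
move: hh; rewrite ler_norml => /andP[h1 h2].
move: (inv_sqrt1D h) t0 t2 => t t0 t2 tE.
set P := (1 - _ + _ - _).
have h2b : h ^+ 2 <= 16^-1 by nra.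
have P2 : 2^-1 <= P by rewrite /P; have := sqr_ge0 h; lra.
have PE : P ^+ 2 * (1 + h) - 1 = h ^+ 4 *
   (- (35 / 64) + 14 / 64 * h - 35 / 256 * h ^+ 2 + 25 / 256 * h ^+ 3).
  by rewrite /P; field.
have hP : `|P ^+ 2 * (1 + h) - 1| <= h ^+ 4.
  rewrite PE normrM (ger0_norm (exprn_even_ge0 _ _)) // ler_piMr ?exprn_even_ge0 //.
  by rewrite ler_norml; have := sqr_ge0 h; move=> ?; apply/andP; split; lra.
have key : (t - P) * ((t + P) * (1 + h)) = - (P ^+ 2 * (1 + h) - 1).
  by transitivity (t ^+ 2 * (1 + h) - P ^+ 2 * (1 + h)); [ring | rewrite tE; ring].
have D0 : 3^-1 <= (t + P) * (1 + h) by nra.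
have : `|t - P| * ((t + P) * (1 + h)) <= h ^+ 4.
  rewrite -[X in _ * X <= _]ger0_norm; last lra.
  by rewrite -normrM key normrN.
have := normr_ge0 (t - P); move: D0; move: (`|t - P|) ((t + P) * (1 + h)) => u v.
by nra.
Qed.

(** The cubic coefficient is left unspecified: it cancels between opposite steps, and at the centre
    point it is of the order of the error. *)
Lemma inv_sqrt1D_expn_taylor k : exists c K : R, 0 <= K /\
  forall h, `|h| <= 4^-1 ->
    `|inv_sqrt1D h ^+ k -
      (1 - k%:R / 2 * h + k%:R * (k%:R + 2) / 8 * h ^+ 2 + c * h ^+ 3)| <= K * h ^+ 4.
Proof.
elim: k => [|k [c [K [K0 IH]]]].
  exists 0, 0; split => // h _; rewrite expr0.
  by rewrite !mul0r subr0 !addr0 subrr normr0.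
set a1 : R := - (k%:R / 2); set a2 : R := k%:R * (k%:R + 2) / 8.
pose S : R := 1 + `|a1| + `|a2| + `|c|.
pose S' : R := `|a1| * (5/16) + `|a2| * (3/8) + `|c| * (1/2) + (`|a2| * (5/16) + `|c| * (3/8))
   + `|c| * (5/16).
(* The first witness is the h^3 coefficient of the product of the cubics for the exponents [k] and
   1; in the second, [S'] collects the coefficients of order 4 and higher of that product. *)
exists (c - a2 / 2 + a1 * (3/8) - 5 / 16), (K * 2 + S * 3 + S').
split; first by rewrite !addr_ge0 // ?mulr_ge0 // ?addr_ge0 // ?mulr_ge0 //.
move=> h hh; have := IH h hh; have := inv_sqrt1D_taylor hh.
have /andP[t0 t2] := inv_sqrt1D_bounds hh.
have h1 : `|h| <= 1 by apply: le_trans hh _; lra.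
rewrite (exprSr (inv_sqrt1D h)); move: (inv_sqrt1D h ^+ k) => u; move: (inv_sqrt1D h) t0 t2 => t t0 t2.
set P := (1 - _ + _ - _); move=> tP.
set Pk := (1 - _ + _ + _); move=> uP.
have PkE : Pk = 1 + a1 * h + a2 * h ^+ 2 + c * h ^+ 3 by rewrite /Pk /a1 /a2; ring.
set Q := (X in `|_ - X| <= _).
have QE : Pk * P - Q = h ^+ 4 * ((a1 * - (5/16) + a2 * (3/8) + c * - (1/2))
   + (a2 * - (5/16) + c * (3/8)) * h + c * - (5/16) * h ^+ 2).
  by rewrite PkE /P /Q /a1 /a2 -(natr1 k); field.
have -> : u * t - Q = (u - Pk) * t + Pk * (t - P) + (Pk * P - Q) by ring.
have h4 : 0 <= h ^+ 4 by rewrite exprn_even_ge0.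
have hn n : `|h ^+ n| <= 1 by rewrite normrX exprn_ile1.
rewrite [leRHS]mulrDl [X in _ <= X + _]mulrDl; apply: le_trans (ler_normD _ _) _; apply: lerD.
  apply: le_trans (ler_normD _ _) _; apply: lerD.
    by rewrite normrM mulrAC ler_pM // ger0_norm // ltW.
  rewrite normrM -mulrA ler_pM // PkE /S.
  by do 3?[apply: le_trans (ler_normD _ _) _; apply: lerD];
    rewrite ?normr1 // normrM ler_piMr // ?hn.
rewrite QE normrM (ger0_norm h4) mulrC ler_wpM2r // /S'.
have nn (a b : R) : 0 <= b -> `|a * b| = `|a| * b by move=> b0; rewrite normrM (ger0_norm b0).
have nN (a b : R) : 0 <= b -> `|a * - b| = `|a| * b by move=> b0; rewrite mulrN normrN nn.
apply: le_trans (ler_normD _ _) _; apply: lerD; [apply: le_trans (ler_normD _ _) _; apply: lerD|].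
- by do 2?[apply: le_trans (ler_normD _ _) _; apply: lerD]; rewrite ?nN ?nn // ?divr_ge0 // .
- rewrite normrM; apply: (@le_trans _ _ (`|a2 * - (5 / 16) + c * (3 / 8)|)); first by rewrite ler_piMr.
  by apply: le_trans (ler_normD _ _) _; apply: lerD; rewrite ?nN ?nn // ?divr_ge0 // .
- by rewrite normrM; apply: (@le_trans _ _ (`|c * - (5 / 16)|)); [rewrite ler_piMr|rewrite nN //; lra].
Qed.

End InvSqrtTaylor.

Section PowerFunctions.
Context {R : realType} {d : nat}.
Implicit Types (x y : lattice d) (A : R) (k : nat).

Definition norm2 x : R := \sum_i (x ord0 i)%:~R ^+ 2.

Definition phi A k x : R := (Num.sqrt (norm2 x + A))^-1 ^+ k.

Lemma norm2_ge0 x : 0 <= norm2 x.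
Proof. by apply: sumr_ge0 => i _; apply: sqr_ge0. Qed.

Lemma norm2N x : norm2 (- x) = norm2 x.
Proof. by apply: eq_bigr => i _; rewrite mxE mulrNz sqrrN. Qed.

Lemma norm2_step x (s : 'I_d * bool) :
  norm2 (x + unit_step s) = norm2 x + 1 + 2 * (-1) ^+ s.2 * (x ord0 s.1)%:~R.
Proof.
rewrite /norm2 (bigD1 s.1) //= [in RHS](bigD1 s.1) //=.
rewrite (eq_bigr (fun i => (x ord0 i)%:~R ^+ 2)); last first.
  by move=> i /negPf h; rewrite mxE unit_stepE eq_sym h mulr0 addr0.
rewrite mxE unit_stepE eqxx mulr1 intrD; set S := \sum_(_ | _) _.
by case: s.2; rewrite /= ?expr1 ?expr0; [rewrite mulrN1z|rewrite mulr1z]; ring.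
Qed.

Lemma coord_sqr_le_norm2 x i : (x ord0 i)%:~R ^+ 2 <= norm2 x.
Proof. by rewrite /norm2 (bigD1 i) //= lerDl sumr_ge0 // => j _; apply: sqr_ge0. Qed.

Lemma phi_gt0 A k x : 0 < A -> 0 < phi A k x.
Proof.
move=> A0; rewrite /phi exprn_gt0 // invr_gt0 sqrtr_gt0.
by have := norm2_ge0 x; lra.
Qed.

Lemma phi_ge0 A k x : 0 <= phi A k x.
Proof. by rewrite /phi exprn_ge0 // invr_ge0 sqrtr_ge0. Qed.

Lemma phiN A k x : phi A k (- x) = phi A k x.
Proof. by rewrite /phi norm2N. Qed.

Lemma phiD A j k x : phi A (j + k) x = phi A j x * phi A k x.
Proof. by rewrite /phi exprD. Qed.

Lemma phi_expn A j k x : phi A (j * k) x = phi A j x ^+ k.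
Proof. by rewrite /phi exprM. Qed.

Lemma phi2 A x : 0 < A -> phi A 2 x = (norm2 x + A)^-1.
Proof. by move=> A0; rewrite /phi exprVn sqr_sqrtr //; have := norm2_ge0 x; lra. Qed.

Lemma phi_le1 A k x : 1 <= A -> phi A k x <= 1.
Proof.
move=> A1; rewrite /phi exprn_ile1 ?invr_ge0 ?sqrtr_ge0 // invf_le1.
  by rewrite -[leLHS]sqrtr1 ler_wsqrtr //; have := norm2_ge0 x; lra.
by rewrite sqrtr_gt0; have := norm2_ge0 x; lra.
Qed.

Lemma phi_decr A j k x : 1 <= A -> (j <= k)%N -> phi A k x <= phi A j x.
Proof.
by move=> A1 jk; rewrite -(subnKC jk) phiD ler_piMr ?phi_ge0 // phi_le1.
Qed.

Lemma phi_scale A B k x y (c : R) : 0 < A -> 0 < B -> 0 <= c ->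
  norm2 y + B <= c ^+ 2 * (norm2 x + A) -> phi A k x <= c ^+ k * phi B k y.
Proof.
move=> A0 B0 c0 h; rewrite /phi -exprMn.
have a0 : 0 < norm2 x + A by have := norm2_ge0 x; lra.
have b0 : 0 < norm2 y + B by have := norm2_ge0 y; lra.
have cc : Num.sqrt (norm2 y + B) <= c * Num.sqrt (norm2 x + A).
  by rewrite -[c]ger0_norm // -sqrtr_sqr -sqrtrM ?sqr_ge0 // ler_wsqrtr.
rewrite lerXn2r ?nnegrE ?mulr_ge0 ?invr_ge0 ?sqrtr_ge0 //.
by rewrite ler_pdivlMr ?sqrtr_gt0 // mulrC ler_pdivrMr ?sqrtr_gt0 .
Qed.

Lemma phi_shift_le A k x : 0 < A -> phi (A + 1) k x <= phi A k x.
Proof.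
move=> A0; rewrite -[leRHS]mul1r -[X in X * _](expr1n R k).
by apply: phi_scale; rewrite ?expr1n //; lra.
Qed.

Lemma phi_shift_ge A k x : 1 <= A -> phi A k x <= 2 ^+ k * phi (A + 1) k x.
Proof.
move=> A1; apply: phi_scale; rewrite // ?expr2; try lra.
by have := norm2_ge0 x; lra.
Qed.

Lemma phi_inv_sqrt1D A k x (h : R) : 0 < A -> `|h| <= 4^-1 ->
  (Num.sqrt ((norm2 x + A) * (1 + h)))^-1 ^+ k = phi A k x * inv_sqrt1D h ^+ k.
Proof.
move=> A0 hh; rewrite sqrtrM ?invfM ?exprMn //.
by have := norm2_ge0 x; lra.
Qed.

(** With u the coordinate, the denominator is at least u^2 + 16 >= 8 |u|. This is the origin of the
    constant 15: the expansions above hold for [|h| <= 4^-1] only. *)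
Lemma step_ratio_small A x i : 15 <= A -> `|2 * (x ord0 i)%:~R / (norm2 x + (A + 1))| <= 4^-1.
Proof.
move=> A15; have := coord_sqr_le_norm2 x i; move: (_%:~R) => u hu.
have q0 : 0 < norm2 x + (A + 1) by have := norm2_ge0 x; lra.
rewrite normrM [`|_^-1|]gtr0_norm ?invr_gt0 // ler_pdivrMr // ler_norml.
have := sqr_ge0 (u + 4); have := sqr_ge0 (u - 4); rewrite sqrrB sqrrD => ? ?.
by apply/andP; split; lra.
Qed.

(** The shift to [A + 1] centres the expansion: with q = |x|^2 + A + 1, the two neighbours in
    direction i give q (1 + h_i) and q (1 - h_i), and the point itself gives q (1 - 1 / q). That [K]
    is independent of [A] is what allows a large [A] to make the (A + 1) term dominate. *)
Lemma phi_laplacian k : (0 < d)%N -> exists2 K : R, 0 <= K &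
  forall A x, 15 <= A ->
  `|phi A k x - avg (phi A k) x
    - (k%:R * (d%:R - 2 - k%:R) / (2 * d%:R)) * phi (A + 1) (k + 2) x
    - (k%:R * (k%:R + 2) / (2 * d%:R)) * (A + 1) * phi (A + 1) (k + 4) x|
  <= K * phi (A + 1) (k + 4) x.
Proof.
move=> d0; have [c [K [K0 T]]] := @inv_sqrt1D_expn_taylor R k.
have d0' : (d%:R : R) != 0 by rewrite pnatr_eq0; lia.
pose a : R := k%:R * (k%:R + 2) / 8.
exists (32 * K + (`|a| + `|c| + K)); first by rewrite !addr_ge0 ?mulr_ge0.
move=> A x A15; have n0 := norm2_ge0 x.
have A10 : 0 < A + 1 by lra.
set q := norm2 x + (A + 1); have q1 : 16 <= q by rewrite /q; lra.
have q0 : q != 0 by rewrite gt_eqF //; lra.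
have q2 : phi (A + 1) 2 x = q^-1 by rewrite phi2.
have q4 : phi (A + 1) 4 x = q^-1 ^+ 2 by rewrite (phi_expn _ 2 2) q2.
rewrite !phiD q2 q4; set p := phi (A + 1) k x.
have p0 : 0 <= p by apply: phi_ge0.
have qi0 : 0 < q^-1 by rewrite invr_gt0; lra.
have qi1 : q^-1 <= 16^-1 by rewrite lef_pV2 // posrE; lra.
have e1 : phi A k x = p * inv_sqrt1D (- q^-1) ^+ k.
  rewrite -phi_inv_sqrt1D //; last by rewrite normrN gtr0_norm //; lra.
  by rewrite -/q mulrDr mulr1 mulrN divff // /phi /q; congr ((Num.sqrt _)^-1 ^+ _); ring.
pose h i := 2 * (x ord0 i)%:~R / q.
have hs i : `|h i| <= 4^-1 by apply: step_ratio_small.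
have e2 : avg (phi A k) x = p * ((2 * d%:R)^-1 *
    \sum_i (inv_sqrt1D (h i) ^+ k + inv_sqrt1D (- h i) ^+ k)).
  rewrite /avg natrM mulrCA; congr (_ * _).
  rewrite (sum_steps (fun e => phi A k (x + e))) mulr_sumr.
  apply: eq_bigr => i _; rewrite mulrDr -!phi_inv_sqrt1D // ?normrN //.
  rewrite -/q /phi !norm2_step /= expr0 expr1.
  have hq : q * h i = 2 * (x ord0 i)%:~R by rewrite /h; field.
  by congr ((Num.sqrt _)^-1 ^+ _ + (Num.sqrt _)^-1 ^+ _);
    rewrite mulrDr mulr1 ?mulrN hq /q; ring.
pose S := \sum_i (inv_sqrt1D (h i) ^+ k + inv_sqrt1D (- h i) ^+ k
             - 2 - 2 * a * h i ^+ 2).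
have Sh : \sum_i h i ^+ 2 = 4 * norm2 x / q ^+ 2.
  rewrite /norm2 mulr_sumr mulr_suml; apply: eq_bigr => i _.
  by rewrite /h; field.
have e3 : \sum_i (inv_sqrt1D (h i) ^+ k + inv_sqrt1D (- h i) ^+ k) =
    2 * d%:R + 2 * a * (4 * norm2 x / q ^+ 2) + S.
  rewrite -Sh mulr_sumr /S !sumrB sumr_const card_ord -mulr_natr -addrA.
  by ring.
have SB : `|S| <= d%:R * (2 * K * (16 * q^-1 ^+ 2)).
  apply: le_trans (ler_norm_sum _ _ _) _.
  have -> : d%:R * (2 * K * (16 * q^-1 ^+ 2)) = \sum_(i < d) (2 * K * (16 * q^-1 ^+ 2)).
    by rewrite sumr_const card_ord mulr_natl.
  apply: ler_sum => i _.
  have T1 := T _ (hs i); have T2 : `|- h i| <= 4^-1 by rewrite normrN.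
  move/T: T2 => T2.
  have h4 : h i ^+ 4 <= 16 * q^-1 ^+ 2.
    rewrite /h; have := coord_sqr_le_norm2 x i; move: (_%:~R) => u hu.
    have u4 : u ^+ 4 <= q ^+ 2.
      rewrite (exprM u 2 2) lerXn2r ?nnegrE ?sqr_ge0 //; rewrite /q; lra.
    rewrite !exprMn (_ : q^-1 ^+ 4 = q^-1 ^+ 2 * q^-1 ^+ 2); last by rewrite -exprD.
    have -> : 2 ^+ 4 * u ^+ 4 * (q^-1 ^+ 2 * q^-1 ^+ 2) = 16 * q^-1 ^+ 2 * (u ^+ 4 * q^-1 ^+ 2) by ring.
    apply: ler_piMr; first by rewrite mulr_ge0 ?exprn_ge0 ?ltW.
    by rewrite exprVn ler_pdivrMr ?mul1r // exprn_gt0 //; lra.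
  have -> : inv_sqrt1D (h i) ^+ k + inv_sqrt1D (- h i) ^+ k - 2 - 2 * a * h i ^+ 2 =
    (inv_sqrt1D (h i) ^+ k - (1 - k%:R / 2 * h i + k%:R * (k%:R + 2) / 8 * h i ^+ 2 + c * h i ^+ 3))
    + (inv_sqrt1D (- h i) ^+ k -
       (1 - k%:R / 2 * - h i + k%:R * (k%:R + 2) / 8 * (- h i) ^+ 2 + c * (- h i) ^+ 3)).
    by rewrite /a; ring.
  apply: le_trans (ler_normD _ _) _.
  apply: le_trans (lerD T1 T2) _.
  have -> : (- h i) ^+ 4 = h i ^+ 4 by ring.
  by rewrite -mulrA mulr_natl mulr2n lerD // ler_wpM2l.
have qn : `|- q^-1| <= 4^-1 by rewrite normrN gtr0_norm //; lra.
have := T _ qn.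
set t := inv_sqrt1D (- q^-1) ^+ k; move=> TB.
rewrite e1 e2 e3 -/t.
set E2 := t - _ in TB.
have -> : p * t - p * ((2 * d%:R)^-1 * (2 * d%:R + 2 * a * (4 * norm2 x / q ^+ 2) + S)) -
   k%:R * (d%:R - 2 - k%:R) / (2 * d%:R) * (p / q) -
   k%:R * (k%:R + 2) / (2 * d%:R) * (A + 1) * (p * q^-1 ^+ 2)
   = p * (E2 + a * q^-1 ^+ 2 - c * q^-1 ^+ 3 - (2 * d%:R)^-1 * S).
  (* This splits the second-order term into a multiple of 1 / q, which joins the term of the centre
     point, and a multiple of (A + 1) / q^2. *)
  have -> : norm2 x = q - (A + 1) by rewrite /q; ring.
  by rewrite /E2 /a; field; rewrite d0' q0.
rewrite normrM (ger0_norm p0) [leRHS]mulrCA ler_wpM2l //.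
have -> : (32 * K + (`|a| + `|c| + K)) * q^-1 ^+ 2 =
  K * q^-1 ^+ 2 + `|a| * q^-1 ^+ 2 + `|c| * q^-1 ^+ 2 + 32 * K * q^-1 ^+ 2 by ring.
have qq : q^-1 ^+ 3 <= q^-1 ^+ 2.
  by rewrite exprS ler_piMl ?exprn_ge0 ?ltW //; lra.
have qq4 : q^-1 ^+ 4 <= q^-1 ^+ 2.
  by rewrite (exprD _ 2 2) ler_piMl ?exprn_ge0 ?exprn_ile1 ?ltW //; lra.
apply: le_trans (ler_normB _ _) _; apply: lerD.
  apply: le_trans (ler_normB _ _) _; apply: lerD.
    apply: le_trans (ler_normD _ _) _; apply: lerD.
      apply: le_trans TB _; rewrite ler_wpM2l //.
      by have -> : (- q^-1) ^+ 4 = q^-1 ^+ 4 by ring.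
    by rewrite normrM [`|q^-1 ^+ 2|]ger0_norm // exprn_ge0 // ltW.
  by rewrite normrM [`|q^-1 ^+ 3|]ger0_norm ?exprn_ge0 ?(ltW qi0) // ler_wpM2l.
rewrite normrM ger0_norm ?invr_ge0 ?mulr_ge0 //.
apply: le_trans (ler_wpM2l _ SB) _; first by rewrite invr_ge0 mulr_ge0.
have -> : (2 * d%:R)^-1 * (d%:R * (2 * K * (16 * q^-1 ^+ 2))) = 16 * K * q^-1 ^+ 2.
  by field; rewrite d0' q0.
by rewrite ler_wpM2r ?exprn_ge0 ?(ltW qi0) //; lra.
Qed.

End PowerFunctions.

Section GreenFunction.
Context {R : realType} {d : nat}.
Implicit Types (x y : lattice d).

(* For A large: the error of the continuous computation of the Laplacian is of
   order phi_(d+2), uniformly in A, while its main term gains a factor A. *)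
Lemma phi_barriers : (4 < d)%N -> exists A c K : R, [/\ 15 <= A, 0 < c, 0 < K &
  forall x : lattice d,
  [/\ c * phi A (d + 2) x + avg (phi A (d - 2)) x <= phi A (d - 2) x,
      phi A (d - 2) x <= K * phi A (d + 2) x + avg (phi A (d - 2)) x,
      c * phi A 3 x + avg (phi A 1) x <= phi A 1 x,
      phi A (d - 1) x + c * phi A (d + 1) x
         <= avg (phi A (d - 1)) x + K * phi A (d + 3) x &
      phi A d x + c * phi A (d + 2) x <= avg (phi A d) x + K * phi A (d + 4) x]].
Proof.
move=> hd; have d0 : (0 < d)%N by apply: leq_trans hd.
have [n1 [n2 [n3 [n4 n5]]]] : (d - 2 + 4 = d + 2)%N /\ (d - 1 + 4 = d + 3)%N /\
  (d - 1 + 2 = d + 1)%N /\ (2 <= d)%N /\ (1 <= d)%N by lia.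
have [n6 [n7 [n8 n9]]] : (d + 2 <= d + 3)%N /\ (3 <= d + 3)%N /\
  (d + 1 <= d + 3)%N /\ (1 <= d - 2)%N by lia.
have d5 : 5 <= d%:R :> R by rewrite ler_nat.
have [Ka Ka0 La] := @phi_laplacian R d (d - 2) d0.
have [Kb Kb0 Lb] := @phi_laplacian R d 1 d0.
have [Kc Kc0 Lc] := @phi_laplacian R d (d - 1) d0.
have [Kd Kd0 Ld] := @phi_laplacian R d d d0.
have D0 : (d%:R : R) != 0 by rewrite gt_eqF //; lra.
(* For the exponents d - 2 and 1, the (A + 1) term then exceeds the Taylor error by at least 15 / (2
   d), see [Mge]. *)
pose A : R := 15 + 2 * (Ka + Kb) * d%:R.
have A15 : 15 <= A by rewrite /A lerDl !mulr_ge0 ?addr_ge0.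
have A1 : 1 <= A by lra.
have A0 : 0 < A by lra.
have s2 (j : nat) : 0 < (2 ^+ j)^-1 :> R by rewrite invr_gt0 exprn_gt0.
have low j x : (2 ^+ j)^-1 * phi A j x <= phi (A + 1) j x.
  by rewrite ler_pdivrMl ?exprn_gt0 // phi_shift_ge.
have upp j x : phi (A + 1) j x <= phi A j x by apply: phi_shift_le.
(* (10 d)^-1 is a common lower bound of the main coefficients; the power of 2 pays for passing from
   [A + 1] to [A] in exponents up to d + 3. *)
pose c : R := (10 * d%:R)^-1 * (2 ^+ (d + 3))^-1.
have cle j (b : R) : (j <= d + 3)%N -> (10 * d%:R)^-1 <= b -> forall x, c * phi A j x <= b * phi (A + 1) j x.
  move=> jd hb x; apply: le_trans (ler_wpM2r (phi_ge0 _ _ _) hb).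
  rewrite /c -mulrA ler_wpM2l ?invr_ge0 ?mulr_ge0 //.
  apply: le_trans (low j x); rewrite ler_wpM2r ?phi_ge0 // lef_pV2 ?posrE ?exprn_gt0 //.
  by rewrite ler_weXn2l // ler1n.
pose M (k : nat) : R := k%:R * (k%:R + 2) / (2 * d%:R) * (A + 1).
have M0 k : 0 <= M k by rewrite /M !mulr_ge0 ?invr_ge0 ?addr_ge0 ?mulr_ge0 //; lra.
have Mge k (K : R) : (1 <= k)%N -> K <= Ka + Kb -> 0 <= K -> 15 / (2 * d%:R) <= M k - K.
  move=> k1 hK K0; rewrite lerBrDr /M.
  have k3 : 3 <= k%:R * (k%:R + 2) :> R.
    have : 1 <= k%:R :> R by rewrite ler1n.
    by move: (k%:R) => u hu; nra.
  rewrite mulrAC ler_pdivlMr ?mulr_gt0 //; last lra.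
  rewrite mulrDl divfK ?mulf_neq0 // ?pnatr_eq0 //.
  have : 15 + K * (2 * d%:R) <= A by rewrite /A lerD2l mulrCA -mulrA ler_wpM2l // ler_wpM2r.
  have : A + 1 <= k%:R * (k%:R + 2) * (A + 1) by nra.
  lra.
have d15 : (10 * d%:R)^-1 <= 15 / (2 * d%:R) :> R.
  rewrite ler_pdivlMr ?mulr_gt0 ?ltr0n // mulrC ler_pdivrMr ?mulr_gt0 ?ltr0n //.
  by move: d5; clear; lra.
have d2E : (d - 2)%:R = d%:R - 2 :> R by rewrite natrB.
have d1E : (d - 1)%:R = d%:R - 1 :> R by rewrite natrB.
pose K : R := 1 + (M (d - 2)%N + Ka) + (M (d - 1)%N + Kc) + (M d + Kd).
have Ma := M0 (d - 2)%N; have Mc := M0 (d - 1)%N; have Md := M0 d.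
exists A, c, K; split; first exact: A15.
- by apply: mulr_gt0; [rewrite invr_gt0 mulr_gt0 // ltr0n | exact: s2].
- by rewrite /K; move: Ka0 Kc0 Kd0 Ma Mc Md; clear; lra.
move=> x.
have Kle (b : R) j : b <= K -> b * phi (A + 1) j x <= K * phi A j x.
  move=> bK; apply: le_trans (ler_wpM2r (phi_ge0 _ _ _) bK) _.
  rewrite ler_wpM2l //.
  by rewrite /K; move: Ka0 Kc0 Kd0 Ma Mc Md; clear; lra.
have {La} := La A x A15; rewrite d2E subrr mulr0 mul0r mul0r subr0.
rewrite -d2E -/(M (d - 2)%N) n1.
rewrite ler_norml => /andP[La1 La2].
have {Lb} := Lb A x A15; rewrite -/(M 1%N).
rewrite ler_norml => /andP[Lb1 Lb2].
have {Lc} := Lc A x A15; rewrite -/(M (d - 1)%N).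
rewrite n2 n3.
rewrite d1E ler_norml => /andP[_ Lc2].
have {Ld} := Ld A x A15; rewrite -/(M d).
rewrite ler_norml => /andP[_ Ld2].
have b1 : (10 * d%:R)^-1 <= M (d - 2)%N - Ka.
  by apply: le_trans d15 _; apply: Mge; rewrite // lerDl.
have c3 : (10 * d%:R)^-1 <= 1%:R * (d%:R - 2 - 1%:R) / (2 * d%:R) :> R.
  rewrite ler_pdivlMr ?mulr_gt0 // ?ltr0n // mulrC ler_pdivrMr ?mulr_gt0 // ?ltr0n //.
  by move: d5; move: (d%:R) => D; clear => ?; nra.
(* For k = d - 1 and k = d the factor d - 2 - k is negative, so these powers are subharmonic up to
   the phi_(k+4) term. *)
have c4 : (10 * d%:R)^-1 <= - ((d%:R - 1) * (d%:R - 2 - (d%:R - 1)) / (2 * d%:R)) :> R.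
  rewrite -mulNr ler_pdivlMr ?mulr_gt0 // ?ltr0n // mulrC ler_pdivrMr ?mulr_gt0 // ?ltr0n //.
  by move: d5; move: (d%:R) => D; clear => ?; nra.
have c5 : (10 * d%:R)^-1 <= - (d%:R * (d%:R - 2 - d%:R) / (2 * d%:R)) :> R.
  rewrite -mulNr ler_pdivlMr ?mulr_gt0 // ?ltr0n // mulrC ler_pdivrMr ?mulr_gt0 // ?ltr0n //.
  by move: d5; move: (d%:R) => D; clear => ?; nra.
have e1 := cle _ _ n6 b1 x.
have e3 := cle _ _ n7 c3 x.
have e4 := cle _ _ n8 c4 x.
have e5 := cle _ _ n6 c5 x.
have K1 : M (d - 2)%N + Ka <= K.
  by rewrite /K; move: Ka0 Kc0 Kd0 Ma Mc Md; clear; lra.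
have K2 : M (d - 1)%N + Kc <= K.
  by rewrite /K; move: Ka0 Kc0 Kd0 Ma Mc Md; clear; lra.
have K3 : M d + Kd <= K.
  by rewrite /K; move: Ka0 Kc0 Kd0 Ma Mc Md; clear; lra.
have {K1} k1 := Kle _ (d + 2)%N K1; have {K2} k2 := Kle _ (d + 3)%N K2.
have {K3} k3 := Kle _ (d + 4)%N K3.
have m1 : 0 <= (M 1%N - Kb) * phi (A + 1) 5 x.
  apply: mulr_ge0; last exact: phi_ge0.
  have hKb : Kb <= Ka + Kb by rewrite lerDr.
  apply: le_trans (Mge 1%N Kb isT hKb Kb0).
  by rewrite divr_ge0 // mulr_ge0.
split.
- by move: La1 e1; clear; lra.
- by move: La2 k1; clear; lra.
- by move: Lb1 e3 m1; clear; lra.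
- by move: Lc2 e4 k2; clear; lra.
- by move: Ld2 e5 k3; clear; lra.
Qed.

End GreenFunction.

(** * The Green function of simple random walk *)

Section Green.
Context {R : realType} {d : nat}.
Implicit Types (x y : lattice d) (l : seq (lattice d)).

Definition green_part K x : R := \sum_(n < K) srw n x.

(** A supremum of reals: it is the Green function once the partial sums are known to be bounded,
    hence the hypothesis [bounded] below, which [green_bounds] supplies for d > 4. *)
Definition green x : R := sup (range (fun K => green_part K x)).

Lemma green_part_ge0 K x : 0 <= green_part K x.
Proof. by apply: sumr_ge0 => n _; apply: srw_ge0. Qed.

Lemma green_part_nondecr J K x : (J <= K)%N -> green_part J x <= green_part K x.
Proof.
move=> JK; rewrite /green_part -(subnKC JK) big_split_ord /= lerDl.
by apply: sumr_ge0 => n _; apply: srw_ge0.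
Qed.

Lemma green_partS K x : green_part K.+1 x = dirac_at 0 x + avg (green_part K) x.
Proof. by rewrite /green_part big_ord_recl /= avg_sum. Qed.

Lemma green_partN K x : green_part K (- x) = green_part K x.
Proof. by apply: eq_bigr => n _; apply: srwN. Qed.

Lemma greenN x : green (- x) = green x.
Proof.
rewrite /green (_ : (fun K => green_part K (- x)) = (fun K => green_part K x)) //.
by apply/funext => K; apply: green_partN.
Qed.

(** Exchanging the sums turns the left-hand side into a potential of [g] cut off to a finite list,
    to which [potential_le] applies. *)
Lemma green_part_conv_le K l (s g : lattice d -> R) y : uniq l ->
  (forall x, 0 <= g x) -> (forall x, 0 <= s x) ->
  (forall x, g x + avg s x <= s x) ->
  \sum_(x <- l) green_part K x * g (y - x) <= s y.
Proof.
move=> ul g0 s0 gs; apply: le_trans (potential_le s0 gs K y).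
rewrite (eq_bigr (fun x => \sum_(n < K) srw n x * g (y - x))); last first.
  by move=> x _; rewrite mulr_suml.
rewrite exchange_big; apply: ler_sum => n _ /=.
pose l' := [seq y - x | x <- l].
have ul' : uniq l' by rewrite map_inj_uniq // => a b /addrI /oppr_inj.
apply: le_trans (srw_sum_le n y ul' g0).
by rewrite big_map le_eqVlt; apply/orP; left; apply/eqP; apply: eq_bigr => x _; rewrite subKr.
Qed.

Section Finite.
Hypothesis bounded : exists b, forall K x, green_part K x <= b.

Let has_sup_green x : has_sup (range (fun K => green_part K x)).
Proof.
split; first by exists (green_part 0 x); exists 0%N.
by have [b hb] := bounded; exists b => _ [K _ <-].
Qed.

Lemma green_ge K x : green_part K x <= green x.
Proof. by apply: sup_upper_bound => //; exists K. Qed.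

Lemma green_ge0 x : 0 <= green x.
Proof. exact: le_trans (green_part_ge0 0 x) (green_ge 0 x). Qed.

Lemma green_le x b : (forall K, green_part K x <= b) -> green x <= b.
Proof.
by move=> h; apply: ge_sup => [|_ [K _ <-]//]; exists (green_part 0 x); exists 0%N.
Qed.

Lemma green_approx l (e : R) : 0 < e ->
  exists K, forall x, x \in l -> green x <= green_part K x + e.
Proof.
move=> e0; elim: l => [|y l [K IH]]; first by exists 0%N.
have [_ [J _ <-] /ltW hJ] := sup_adherent e0 (has_sup_green y).
exists (maxn J K) => x; rewrite inE => /predU1P[->|/IH h].
  by rewrite -lerBlDr; apply: le_trans hJ _; rewrite green_part_nondecr ?leq_maxl.
by apply: le_trans h _; rewrite lerD2r green_part_nondecr ?leq_maxr.
Qed.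

Lemma green_sum_le l (w : lattice d -> R) b : (forall x, 0 <= w x) ->
  (forall K, \sum_(x <- l) green_part K x * w x <= b) ->
  \sum_(x <- l) green x * w x <= b.
Proof.
move=> w0 hb; apply/ler_addgt0Pr => e e0.
set W := \sum_(x <- l) w x; have W0 : 0 <= W by apply: sumr_ge0.
have W1 : 0 < W + 1 by apply: ltr_wpDl.
have [K hK] := green_approx l (divr_gt0 e0 W1).
apply: (@le_trans _ _ (\sum_(x <- l) (green_part K x + e / (W + 1)) * w x)).
  by rewrite !big_seq; apply: ler_sum => x /hK h; rewrite ler_wpM2r.
rewrite (eq_bigr (fun x => green_part K x * w x + e / (W + 1) * w x)); last first.
  by move=> x _; rewrite mulrDl.
rewrite big_split /= lerD // -mulr_sumr -/W mulrAC ler_pdivrMr //.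
by rewrite ler_wpM2l ?lerDl // ltW.
Qed.

Lemma green_conv_le l (s g : lattice d -> R) y : uniq l ->
  (forall x, 0 <= g x) -> (forall x, 0 <= s x) ->
  (forall x, g x + avg s x <= s x) ->
  \sum_(x <- l) green x * g (y - x) <= s y.
Proof. by move=> *; apply: green_sum_le => // K; apply: green_part_conv_le. Qed.

Lemma green_harmonic x : green x = dirac_at 0 x + avg green x.
Proof.
apply/le_anti/andP; split.
  apply: green_le => -[|K].
    rewrite /green_part big_ord0 addr_ge0 ?avg_ge0 // => s.
    exact: green_ge0.
  by rewrite green_partS lerD2l ler_avg // => s; apply: green_ge.
apply/ler_addgt0Pr => e e0.
have [d0|d0] := posnP d.
  rewrite /avg big1 ?mulr0 => [|s _]; last by case: s => -[i hi]; exfalso; move: hi; rewrite d0.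
  rewrite addr0; apply: (@le_trans _ _ (green x)); last by rewrite lerDl ltW.
  apply: le_trans (green_ge 1 x); rewrite green_partS lerDl avg_ge0 // => s.
  exact: green_part_ge0.
have [K hK] := green_approx [seq x + unit_step s | s : 'I_d * bool] e0.
apply: (@le_trans _ _ (green_part K.+1 x + e)); last by rewrite lerD2r green_ge.
rewrite green_partS -addrA lerD2l.
rewrite -[X in _ + X](@avg_cst R d e x) // -avgD; apply: ler_avg => s.
by apply: hK; apply: map_f; rewrite mem_enum.
Qed.

Lemma green_step_le x (s : 'I_d * bool) : (0 < d)%N ->
  green (x + unit_step s) <= (2 * d)%:R * green x.
Proof.
move=> d0; apply: le_trans (avg_step_le s x _ d0) _; first exact: green_ge0.
by rewrite ler_wpM2l // (green_harmonic x) lerDr /dirac_at.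
Qed.

End Finite.

End Green.

(** * Two-sided bounds on the Green function *)

Section GreenBounds.
Context {R : realType} {d : nat}.
Implicit Types (x y : lattice d) (l : seq (lattice d)).

Lemma lattice_ind (P : lattice d -> Prop) : P 0 ->
  (forall x y, P x -> P y -> P (x + y)) ->
  (forall s : 'I_d * bool, P (unit_step s)) -> forall x, P x.
Proof.
move=> P0 PD Ps x; have -> : x = \sum_i x ord0 i *: delta_mx ord0 i.
  by rewrite [LHS]matrix_sum_delta big_ord1.
apply: big_ind => // i _; have Pn b n : P (unit_step (i, b) *+ n).
  elim: n => [|n IH]; first by rewrite mulr0n.
  by rewrite mulrS; apply: PD.
case: (x ord0 i) => n.
  have -> : Posz n *: delta_mx ord0 i = unit_step (i, false) *+ n :> lattice d.
    by rewrite /unit_step expr0 scale1r -scaler_nat natz.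
  exact: Pn.
have -> : Negz n *: delta_mx ord0 i = unit_step (i, true) *+ n.+1 :> lattice d.
  by rewrite /unit_step expr1 -scaler_nat scalerA mulrN1 NegzE natz.
exact: Pn.
Qed.

Section Harnack.
Hypothesis bounded : exists b : R, forall K x, green_part K x <= b.
Hypothesis d0 : (0 < d)%N.

(** Harnack inequality: C dominates its average over the neighbours, so one step costs a factor 2 d,
    and a translation by [u] costs a constant depending on [u] only. *)
Lemma green_translate_le u :
  exists2 M : R, 0 <= M & forall x, green (x + u) <= M * green x.
Proof.
elim/lattice_ind: u => [|u v [M M0 hM] [N N0 hN]|s].
- by exists 1 => // x; rewrite addr0 mul1r.
- exists (N * M) => [|x]; first exact: mulr_ge0.
  by rewrite addrA; apply: le_trans (hN _) _; rewrite -mulrA ler_wpM2l.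
- by exists (2 * d)%:R => // x; apply: green_step_le.
Qed.

Lemma green_translate_sum_le l :
  exists2 M : R, 0 <= M & forall x, \sum_(y <- l) green (x - y) <= M * green x.
Proof.
elim: l => [|y l [M M0 hM]].
  by exists 0 => // x; rewrite big_nil mul0r.
have [N N0 hN] := green_translate_le (- y).
exists (N + M) => [|x]; first exact: addr_ge0.
by rewrite big_cons mulrDl lerD.
Qed.

End Harnack.

Lemma norm2_ge_sqr_sup_norm x : (sup_norm x)%:R ^+ 2 <= norm2 x :> R.
Proof.
have [d0|d0] := posnP d.
  have -> : sup_norm x = 0%N.
    by apply/eqP; rewrite -leqn0; apply/sup_norm_leP => -[i hi]; exfalso; move: hi; rewrite d0.
  by rewrite expr0n norm2_ge0.
have [i _ ->] : exists2 i : 'I_d, true & sup_norm x = `|x ord0 i|%N.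
  have := @bigop.eq_bigmax 'I_d (fun i => `|x ord0 i|%N); rewrite card_ord => /(_ d0)[i h].
  by exists i.
apply: le_trans (coord_sqr_le_norm2 x i).
by rewrite natr_absz intr_norm real_normK ?num_real.
Qed.

Lemma norm2_le_sup_norm x : norm2 x <= d%:R * (sup_norm x)%:R ^+ 2 :> R.
Proof.
have -> : d%:R * (sup_norm x)%:R ^+ 2 = \sum_(i < d) (sup_norm x)%:R ^+ 2 :> R.
  by rewrite sumr_const card_ord mulr_natl.
apply: ler_sum => i _.
have /sup_norm_leP/(_ i) := leqnn (sup_norm x); rewrite -(ler_nat R) => h.
by rewrite -[leLHS]real_normK ?num_real // -intr_norm -natr_absz lerXn2r ?nnegrE.
Qed.

Lemma iter_avg_avg f n x : iter n (@avg R d) (avg f) x = avg (iter n avg f) x.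
Proof. by rewrite -iterSr. Qed.

(** Counterpart of [potential_le] for lower bounds. The boundary term at time [N] now stands on the
    unfavourable side and has to be shown to be small. *)
Lemma potential_decomposition (v g : lattice d -> R) :
  (forall x, v x <= g x + avg v x) ->
  forall N x, v x <= \sum_(n < N) iter n avg g x + iter N avg v x.
Proof.
move=> vg; elim=> [|N IH] x; first by rewrite big_ord0 add0r.
apply: le_trans (IH x) _; rewrite big_ord_recr /= -addrA lerD2l.
rewrite -iter_avg_avg; elim: N {IH} x => [|N IH] x //=.
by rewrite -avgD; apply: ler_avg.
Qed.

(** The convolution bounds range over finite lists without repetition, with constants independent of
    the list; this replaces summability over the lattice. *)
Record green_estimates (A k K : R) : Prop := GreenEstimates {
  radius_ge15 : 15 <= A;
  green_lower_gt0 : 0 < k;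
  green_upper_gt0 : 0 < K;
  green_part_bounded : exists b : R, forall n x, @green_part R d n x <= b;
  green_lower : forall x, k * phi A (d - 2) x <= green x;
  green_upper : forall x, green x <= K * phi A (d - 2) x;
  green_conv_phi3 : forall l y, uniq l -> \sum_(x <- l) green x * phi A 3 (y - x) <= K;
  green_conv_tail : forall l y, uniq l ->
    \sum_(x <- l) green x * phi A (d + 1) (y - x) <= K * green y }.

Lemma green_bounds : (4 < d)%N -> exists A k K : R, green_estimates A k K.
Proof.
move=> hd; have d0 : (0 < d)%N by apply: leq_trans hd.
have [n1 [n2 [n3 n4]]] : (d + 2 + 2 = d + 4)%N /\ (d - 2 <= d)%N /\ (3 <= d - 2)%N /\
  (d - 2 <= d - 1)%N by lia.
have n5 : (d + 2 <= d + 3)%N by lia.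
have [A [c [K [A15 c0 K0 B]]]] := @phi_barriers R d hd.
have A1 : 1 <= A by apply: le_trans A15; rewrite ler1n.
have A0 : 0 < A by apply: lt_le_trans A1.
have p0 j x : 0 <= phi A j x by apply: phi_ge0.
(* phi_(d-2) loses at least c phi_(d+2) under averaging, which is [m] at the origin, so phi_(d-2) /
   m is a supersolution for the Dirac mass. *)
pose m := c * phi A (d + 2) (0 : lattice d); have m0 : 0 < m by rewrite mulr_gt0 // phi_gt0.
have gpart n x : green_part n x <= m^-1 * phi A (d - 2) x.
  apply: (potential_le (s := fun x => m^-1 * phi A (d - 2) x)) => y.
    by rewrite mulr_ge0 // invr_ge0 ltW.
  rewrite avgZ -[dirac_at 0 y](mulKf (lt0r_neq0 m0)) -mulrDr ler_wpM2l ?invr_ge0 ?(ltW m0) //.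
  have [h _ _ _ _] := B y; apply: le_trans h; rewrite lerD2r /dirac_at.
  by case: eqP => [->|_]; rewrite ?mulr1 ?mulr0 // mulr_ge0 // ltW.
have bdd : exists b : R, forall n x, @green_part R d n x <= b.
  exists m^-1 => n x; apply: le_trans (gpart n x) _.
  by rewrite ler_piMr ?invr_ge0 ?phi_le1 // ltW.
have barrier3 x : phi A 3 x + avg (fun y => c^-1 * phi A 1 y) x <= c^-1 * phi A 1 x.
  rewrite avgZ -[phi A 3 x](mulKf (lt0r_neq0 c0)) -mulrDr ler_wpM2l ?invr_ge0 ?(ltW c0) //.
  by have [_ _ h _ _] := B x.
have phi1 x : 0 <= c^-1 * phi A 1 x <= c^-1.
  by rewrite mulr_ge0 ?invr_ge0 ?(ltW c0) //= ler_piMr ?invr_ge0 ?(ltW c0) ?phi_le1.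
(* The partial sums of the iterated averages of phi_3 are bounded by phi_1 / c, so the terms cannot
   all exceed [e]; the comparison phi_(d-2) <= phi_3 is where d >= 5 is used. *)
have decay x e : 0 < e -> exists N, iter N avg (phi A (d - 2)) x <= e.
  move=> e0; apply: contrapT => /forallNP h.
  have e1 : 0 <= c^-1 / e by apply: divr_ge0; rewrite ?invr_ge0 ltW.
  pose N := Num.bound (c^-1 / e); have /archi_boundP := e1; rewrite -/N => hN.
  have := potential_le (s := fun y => c^-1 * phi A 1 y) (g := phi A 3) _ barrier3 N x.
  move=> /(_ (fun y => proj1 (andP (phi1 y)))); apply/negP; rewrite -ltNge.
  have /andP[_ hc] := phi1 x; apply: le_lt_trans hc _.
  rewrite ltr_pdivrMr // mulrC -[X in X < _]mulr1 in hN.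
  have {hN} : c^-1 < \sum_(n < N) e by rewrite sumr_const card_ord -mulr_natr -[c^-1]mulr1.
  move=> /lt_le_trans; apply; apply: ler_sum => n _.
  apply/ltW/(@lt_le_trans _ _ (iter n avg (phi A (d - 2)) x)).
    by rewrite ltNge; apply/negP; apply: h.
  by apply: ler_iter_avg => y; apply: phi_decr.
have c'0 : 0 <= c by apply: ltW.
have K'0 : 0 <= K by apply: ltW.
(* phi_(d-2) is slightly superharmonic, with defect at most K phi_(d+2). Adding b phi_d with b c = 2
   K gains 2 K phi_(d+2) and costs b K phi_(d+4), so [v] is subharmonic where b phi_2 <= 1, that is
   outside a box; [g] pays for the box. *)
have [b bE] : exists b : R, b = 2 * K / c by exists (2 * K / c).
have b0 : 0 <= b by rewrite bE divr_ge0 // mulr_ge0.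
pose v x := phi A (d - 2) x + b * phi A d x.
pose N0 := Num.bound b.
pose g x := b * K * \sum_(y <- box N0) dirac_at y x.
have vg x : v x <= g x + avg v x.
  have [_ h1 _ _ h2] := B x.
  rewrite avgD avgZ; apply: (@le_trans _ _
    (K * phi A (d + 2) x * (b * phi A 2 x - 1) + (avg (phi A (d - 2)) x + b * avg (phi A d) x))).
    have -> : K * phi A (d + 2) x * (b * phi A 2 x - 1) =
       K * phi A (d + 2) x - b * (c * phi A (d + 2) x) + b * (K * (phi A (d + 2) x * phi A 2 x)).
      by rewrite bE; field; rewrite gt_eqF.
    rewrite -phiD n1.
    have := ler_wpM2l b0 h2; move: h1; rewrite /v !mulrDr; clear; lra.
  rewrite lerD2r; have [bp|bp] := leP (b * phi A 2 x) 1.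
    apply: (@le_trans _ _ 0); first by rewrite mulr_ge0_le0 ?mulr_ge0 // subr_le0.
    by rewrite /g !mulr_ge0 ?sumr_ge0 // => y _; rewrite /dirac_at.
  have xN : x \in box N0.
    rewrite mem_box -(ler_nat R); have := archi_boundP b0; rewrite -/N0 => bN.
    move: bp; rewrite phi2 // ltr_pdivlMr; last first.
      by have := norm2_ge0 (R := R) x; move: A1; clear; lra.
    rewrite mul1r => bp; have := norm2_ge_sqr_sup_norm x.
    have [/ltW //|s1] := ltP (sup_norm x)%:R (N0%:R : R).
    have [s0|s0] := posnP (sup_norm x); first by rewrite s0.
    have : 1 <= (sup_norm x)%:R :> R by rewrite ler1n.
    by move: s1 bp bN A1; clear; move: (_%:R) (norm2 x) => u w; nra.
  apply: (@le_trans _ _ (b * K)).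
    apply: (@le_trans _ _ (K * phi A (d + 2) x * (b * phi A 2 x))).
      by rewrite ler_wpM2l ?mulr_ge0 // gerBl.
    rewrite mulrACA [K * b]mulrC ler_piMr ?mulr_ge0 //.
    by rewrite mulr_ile1 ?phi_le1.
  rewrite /g ler_peMr ?mulr_ge0 // (bigD1_seq x) ?box_uniq //= {1}/dirac_at eqxx.
  by rewrite lerDl sumr_ge0 // => y _; rewrite /dirac_at.
have [M M0 hM] := green_translate_sum_le bdd d0 (box N0).
have low x : phi A (d - 2) x <= b * K * M * green x.
  apply/ler_addgt0Pr => e e0.
  have [N hN] := decay x _ (divr_gt0 e0 (ltr_wpDl b0 ltr01)).
  apply: le_trans (_ : v x <= _); first by rewrite /v lerDl mulr_ge0.
  apply: le_trans (potential_decomposition vg N x) _; apply: lerD.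
    have -> : \sum_(n < N) iter n avg g x = b * K * \sum_(y <- box N0) green_part N (x - y).
      rewrite exchange_big /= mulr_sumr; apply: eq_bigr => n _.
      rewrite /g iter_avgZ iter_avg_sum; congr (_ * _).
      by apply: eq_bigr => y _; apply: iter_avg_dirac.
    rewrite -[leRHS]mulrA ler_wpM2l ?mulr_ge0 //; apply: le_trans (hM x).
    by apply: ler_sum => y _; apply: green_ge.
  apply: (@le_trans _ _ (iter N avg (fun y => (b + 1) * phi A (d - 2) y) x)).
    apply: ler_iter_avg => y; rewrite /v mulrDl mul1r addrC lerD2r ler_wpM2l //.
    by apply: phi_decr.
  rewrite iter_avgZ; apply: le_trans (ler_wpM2l _ hN) _; first exact: addr_ge0.
  by rewrite mulrC divfK // gt_eqF // ltr_wpDl.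
pose k := (b * K * M + 1)^-1.
have kp : 0 < b * K * M + 1 by rewrite ltr_wpDl // !mulr_ge0.
have k0 : 0 < k by rewrite invr_gt0.
have lowk x : k * phi A (d - 2) x <= green x.
  rewrite ler_pdivrMl //; apply: le_trans (low x) _.
  by rewrite mulrDl mul1r lerDl green_ge0.
(* Since L c >= K, the term L phi_(d-2) of the barrier [s] below absorbs the error K phi_(d+3) of
   phi_(d-1); L >= 1 keeps [s] nonnegative. *)
have [L LE] : exists L : R, L = K / c + 1 by exists (K / c + 1).
have L1 : 1 <= L by rewrite LE lerDr divr_ge0.
have L0 : 0 <= L by apply: le_trans L1.
have tail0 : 0 <= c^-1 * L / k by rewrite !mulr_ge0 ?invr_ge0 // ltW.
have m'0 : 0 <= m^-1 by rewrite invr_ge0 ltW.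
have c''0 : 0 <= c^-1 by rewrite invr_ge0.
exists A, k, (m^-1 + c^-1 + c^-1 * L / k); split=> // [|x|l y ul|l y ul].
- by rewrite addr_gt0 ?addr_gt0 ?divr_gt0 ?mulr_gt0 ?invr_gt0 // (lt_le_trans ltr01).
- apply: green_le => n; apply: le_trans (gpart n x) _.
  by rewrite ler_wpM2r // -addrA lerDl addr_ge0.
- apply: le_trans (_ : c^-1 * phi A 1 y <= _).
    by apply: (green_conv_le bdd (s := fun y => c^-1 * phi A 1 y)) => // z; have /andP[] := phi1 z.
  have /andP[_ h] := phi1 y; apply: le_trans h _.
  by rewrite addrAC lerDr addr_ge0.
- pose s x := c^-1 * (L * phi A (d - 2) x - phi A (d - 1) x).
  apply: le_trans (_ : s y <= _).
    apply: (green_conv_le bdd) => // x.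
      rewrite /s mulr_ge0 // subr_ge0.
      apply: (@le_trans _ _ (phi A (d - 2) x)); first by apply: phi_decr.
      by rewrite ler_peMl.
    rewrite /s avgZ avgB avgZ -[phi A (d + 1) x](mulKf (lt0r_neq0 c0)) -mulrDr ler_wpM2l //.
    have [h1 _ _ h2 _] := B x.
    have h3 : phi A (d + 3) x <= phi A (d + 2) x by apply: phi_decr.
    have h4 : K * phi A (d + 3) x <= L * (c * phi A (d + 2) x).
      rewrite mulrA LE mulrDl divfK ?gt_eqF // mul1r mulrDl.
      apply: (@le_trans _ _ (K * phi A (d + 2) x)); first by rewrite ler_wpM2l.
      by rewrite lerDl mulr_ge0.
    have := ler_wpM2l L0 h1; move: h2 h4; rewrite mulrDr; clear; lra.
  apply: (@le_trans _ _ (c^-1 * L / k * green y)).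
    rewrite /s -mulrA; apply: (@le_trans _ _ (c^-1 * (L * phi A (d - 2) y))).
      by rewrite ler_wpM2l // gerBl.
    rewrite -!mulrA ler_wpM2l // ler_wpM2l // mulrC ler_pdivlMr // mulrC.
    exact: lowk.
  by rewrite ler_wpM2r ?lerDr ?addr_ge0 // green_ge0.
Qed.

End GreenBounds.
Arguments green_estimates {R} d A k K.

(** * Gradient estimate for harmonic functions *)

Section Gradient.
Context {R : realType} {d : nat}.
Implicit Types (x y : lattice d) (u : lattice d -> R) (i : 'I_d).

(* Reflection across the hyperplane at height 1/2, halfway between 0 and
   [unit_step (i, false)]. *)
Definition half_reflection i x : lattice d :=
  \row_j (if j == i then 1 - x ord0 j else x ord0 j).

Lemma half_reflectionK i : involutive (half_reflection i).
Proof.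
by move=> x; apply/rowP => j; rewrite !mxE; case: (j == i); rewrite ?subKr.
Qed.

Lemma avg_half_reflection u i x :
  avg (u \o half_reflection i) x = avg u (half_reflection i x).
Proof.
rewrite /avg; congr (_ * _).
rewrite (sum_steps (fun e => u (half_reflection i (x + e)))).
rewrite (sum_steps (fun e => u (half_reflection i x + e))).
apply: eq_bigr => j _.
have h b : half_reflection i (x + unit_step (j, b)) =
    half_reflection i x + unit_step (j, if j == i then ~~ b else b).
  apply/rowP => k; rewrite [LHS]mxE [RHS]mxE unit_stepE [in RHS]mxE [(x + _) _ _]mxE unit_stepE /=.
  case: (eqVneq k i) => [->|ki]; case: (eqVneq j i) => [ji|ji] //=;
    rewrite ?ji ?[i == k]eq_sym ?(negPf ki) ?mulr0 ?addr0 //.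
  by case: b; rewrite /= ?expr0 ?expr1; ring.
by rewrite !h; case: (j == i); rewrite //= addrC.
Qed.

Definition transverse_norm2 i x : R := \sum_(j | j != i) (x ord0 j)%:~R ^+ 2.

Lemma norm2_transverse i x :
  norm2 x = (x ord0 i)%:~R ^+ 2 + transverse_norm2 i x.
Proof. by rewrite /norm2 (bigD1 i). Qed.

Lemma avg_norm2 x : (0 < d)%N -> avg (@norm2 R d) x = norm2 x + 1.
Proof.
move=> d0; rewrite /avg (sum_steps (fun e => norm2 (x + e))).
rewrite (eq_bigr (fun=> 2 * (norm2 x + 1))) => [|i _].
  rewrite sumr_const card_ord -(mulr_natr (2 * _)) natrM; field.
  by rewrite pnatr_eq0 -lt0n.
by rewrite !norm2_step /= expr0 expr1; ring.
Qed.

Lemma avg_coord_poly i x (a b : R) : (0 < d)%N ->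
  avg (fun y => a * (y ord0 i)%:~R ^+ 2 + b * (y ord0 i)%:~R) x =
  a * ((x ord0 i)%:~R ^+ 2 + d%:R^-1) + b * (x ord0 i)%:~R.
Proof.
move=> d0; set t : R := (x ord0 i)%:~R.
rewrite /avg (sum_steps (fun e => a * ((x + e) ord0 i)%:~R ^+ 2 + b * ((x + e) ord0 i)%:~R)).
rewrite (eq_bigr (fun j => 2 * (a * (t ^+ 2 + (j == i)%:R) + b * t))) => [|j _].
  rewrite -mulr_sumr big_split /= sumr_const card_ord -mulr_sumr big_split /= sumr_const card_ord.
  rewrite (bigD1 i) //= eqxx big1 ?addr0 => [|j /negPf -> //].
  rewrite -(mulr_natr (t ^+ 2)) -(mulr_natr (b * t)) natrM /=; field.
  by rewrite pnatr_eq0 -lt0n.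
rewrite !mxE eqxx /= [i == j]eq_sym expr0 expr1 mul1r mulN1r.
by case: (j == i); rewrite ?subr0 ?addr0 ?intrD ?intrB /= -/t ?mulr1z; ring.
Qed.

(* A positive superharmonic function on the half box, at least 1 on its outer
   boundary, odd up to a nonnegative error across the hyperplane, and of order
   1 / n near it. *)
Definition half_box_barrier i (n : nat) x : R :=
  let t := (x ord0 i)%:~R in
  (d%:R * (2 * n%:R * (2 * t - 1) - t * (t - 1)) + transverse_norm2 i x) / n%:R ^+ 2.

Lemma avg_half_box_barrier i n x : (0 < d)%N -> (0 < n)%N ->
  avg (half_box_barrier i n) x = half_box_barrier i n x - (d%:R * n%:R ^+ 2)^-1.
Proof.
move=> d0 n0; have dn0 : d%:R != 0 :> R by rewrite pnatr_eq0 -lt0n.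
have nn0 : n%:R != 0 :> R by rewrite pnatr_eq0 -lt0n.
pose f y : R := - (d%:R + 1) * (y ord0 i)%:~R ^+ 2 + (d%:R * (4 * n%:R + 1)) * (y ord0 i)%:~R.
have wE y : half_box_barrier i n y =
    (n%:R ^+ 2)^-1 * ((f y + norm2 y) - d%:R * (2 * n%:R)).
  by rewrite /half_box_barrier (norm2_transverse i) /f mulrC; congr (_ * _); ring.
rewrite (avg_ext _ wE) avgZ avgB avgD avg_cst // avg_norm2 // avg_coord_poly // wE /f.
by field; rewrite dn0 nn0.
Qed.

Lemma seq_argmax (T : eqType) (f : T -> R) (l : seq T) z : z \in l ->
  exists2 x, x \in l & forall y : T, y \in l -> f y <= f x.
Proof.
elim: l z => // a [|b l] IH z _.
  by exists a; rewrite ?mem_head // => y; rewrite inE => /eqP ->.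
have [x xl hx] := IH b (mem_head _ _).
have [fax|fax] := leP (f a) (f x).
  by exists x; rewrite 1?in_cons ?xl ?orbT // => y; rewrite in_cons => /predU1P[->|/hx].
exists a; rewrite ?mem_head // => y; rewrite in_cons => /predU1P[->//|/hx h].
exact: le_trans h (ltW fax).
Qed.

(** Reflection argument by a maximum principle: the difference of [u] and its mirror image is
    harmonic, odd across the hyperplane and at most 2 M on the outer boundary, hence at most 2 M w.
    At the unit step, w equals 2 d / n. *)
Lemma harmonic_gradient_le u i n (M : R) : (0 < d)%N -> (0 < n)%N -> 0 < M ->
  (forall x, (sup_norm x <= n)%N -> u x = avg u x) ->
  (forall x, (sup_norm x <= n.+1)%N -> `|u x| <= M) ->
  u (unit_step (i, false)) - u 0 <= 4 * d%:R * M / n%:R.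
Proof.
move=> d0 n0 M0 uh uM.
pose r := half_reflection i; pose w := half_box_barrier i n.
pose e x := u x - u (r x) - 2 * M * w x.
have dR : 0 < d%:R :> R by rewrite ltr0n.
have nR : 0 < n%:R :> R by rewrite ltr0n.
have n1R : 1 <= n%:R :> R by rewrite ler1n.
have nR2 : 0 < n%:R ^+ 2 :> R by rewrite exprn_gt0.
pose U := [seq x <- box n.+1 | 1 <= (x : lattice d) ord0 i].
have memU x : (x \in U) = (1 <= x ord0 i) && (sup_norm x <= n.+1)%N.
  by rewrite mem_filter mem_box.
have e1U : unit_step (i, false) \in U.
  rewrite memU unit_stepE eqxx expr0 mulr1 lexx /=.
  exact: leq_trans (sup_norm_unit_step _) _.
have sup_r x m : 1 <= x ord0 i -> (sup_norm x <= m)%N -> (sup_norm (r x) <= m)%N.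
  move=> xi /sup_norm_leP hx; apply/sup_norm_leP => j; rewrite mxE.
  case: eqP => [->|_]; last exact: hx.
  by have := hx i; move: (x ord0 i) xi; clear; lia.
have tE x j m : (sup_norm x <= m)%N -> (x ord0 j)%:~R <= m%:R :> R.
  move=> /sup_norm_leP/(_ j) h; rewrite -[m%:R]/((Posz m)%:~R) ler_int.
  by move: h; clear; lia.
suff claim x : x \in U -> e x <= 0.
  have := claim _ e1U; rewrite /e subr_le0.
  have -> : r (unit_step (i, false)) = 0.
    apply/rowP => j; rewrite !mxE eqxx /= expr0 mul1r.
    by case: (j == i); rewrite /= ?subrr.
  move=> h; apply: le_trans h _.
  have -> : w (unit_step (i, false)) = d%:R * (2 * n%:R) / n%:R ^+ 2.
    rewrite /w /half_box_barrier /transverse_norm2 big1 => [|j ji]; last first.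
      by rewrite unit_stepE /= eq_sym (negPf ji) mulr0 mulr0z expr0n.
    by rewrite unit_stepE eqxx expr0 mulr1 mulr1z; congr (_ / _); ring.
  by rewrite le_eqVlt; apply/orP; left; apply/eqP; field; rewrite gt_eqF.
have [x0 x0U hx0] := seq_argmax e e1U.
suff e0 : e x0 <= 0 by move=> /hx0 h; apply: le_trans h e0.
rewrite leNgt; apply/negP => epos.
have /andP[x1 xn1] : (1 <= x0 ord0 i) && (sup_norm x0 <= n.+1)%N by rewrite -memU.
have t1 : 1 <= (x0 ord0 i)%:~R :> R by rewrite ler1z.
have tn : (x0 ord0 i)%:~R <= n%:R + 1 :> R by rewrite natr1; apply: tE.
have S0 : 0 <= transverse_norm2 i x0 by apply: sumr_ge0 => j _; apply: sqr_ge0.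
have d1 : 1 <= d%:R :> R by rewrite ler1n.
have [xn|xn] := leqP (sup_norm x0) n; last first.
  have w1 : 1 <= w x0.
    rewrite /w /half_box_barrier ler_pdivlMr // mul1r.
    set t : R := (x0 ord0 i)%:~R in t1 tn *.
    have q0 : n%:R * (t - 1) <= 2 * n%:R * (2 * t - 1) - t * (t - 1).
      by move: t1 tn n1R; clear; nra.
    (* On the outer boundary some coordinate exceeds [n] in absolute value. If it is [i], the
       quadratic in t suffices; otherwise the transverse norm does. *)
    have [j hj] : exists j, (n < `|x0 ord0 j|)%N.
      apply: contrapT => /forallNP h; move: xn; apply/negP; rewrite -leqNgt.
      by apply/sup_norm_leP => j; rewrite leqNgt; apply/negP; apply: h.
    have [ji|ji] := eqVneq j i.
      have tE' : t = n%:R + 1.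
        apply/le_anti; rewrite tn /=; rewrite natr1 -[n.+1%:R]/((Posz n.+1)%:~R) /t ler_int.
        by move: hj x1; rewrite ji; move: (x0 ord0 i); clear; lia.
      move: S0 d1 n1R; rewrite tE'; clear; move: (transverse_norm2 _ _) (n%:R) (d%:R) => S N D *.
      by have : N ^+ 2 <= 2 * N * (2 * (N + 1) - 1) - (N + 1) * (N + 1 - 1); nra.
    have hS : n%:R ^+ 2 <= transverse_norm2 i x0.
      apply: (@le_trans _ _ ((x0 ord0 j)%:~R ^+ 2)).
        rewrite -[leRHS]real_normK ?num_real // -intr_norm -natr_absz.
        by rewrite lerXn2r ?nnegrE // ler_nat ltnW.
      by rewrite /transverse_norm2 (bigD1 j) //= lerDl sumr_ge0 // => k _; apply: sqr_ge0.
    apply: le_trans hS _; rewrite lerDr mulr_ge0 //.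
    by apply: le_trans q0; rewrite mulr_ge0 ?subr_ge0 // ltW.
  move: epos; apply/negP; rewrite -leNgt /e subr_le0.
  apply: (@le_trans _ _ (2 * M)); last by rewrite ler_peMr // mulr_ge0 // ltW.
  apply: le_trans (ler_norm _) _; apply: le_trans (ler_normB _ _) _.
  by rewrite mulrDl mul1r lerD // uM // sup_r.
have nbr s : e (x0 + unit_step s) <= e x0.
  have sn : (sup_norm (x0 + unit_step s)%R <= n.+1)%N.
    apply: leq_trans (sup_normD _ _) _; rewrite -addn1 leq_add //.
    exact: sup_norm_unit_step.
  have [xs|xs] := boolP (1 <= (x0 + unit_step s) ord0 i).
    by apply: hx0; rewrite memU xs.
  (* A neighbour that leaves through the hyperplane is the mirror image of [x0]. There [e] is at
     most [- e x0], because w and its mirror image have a nonnegative sum. *)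
  have [xi1 sE] : x0 ord0 i = 1 /\ s = (i, true).
    move: xs; rewrite mxE unit_stepE; case: s {sn} => j b /=.
    case: (eqVneq j i) => [->|_] /=; last by rewrite mulr0 addr0 x1.
    by case: b => /=; [|rewrite expr0 mulr1]; move: (x0 ord0 i) x1; clear => a h1 h2; split=> //; lia.
  have rE : x0 + unit_step s = r x0.
    apply/rowP => j; rewrite !mxE sE eqxx /= expr1 mulN1r.
    by case: (eqVneq j i) => [ji|_]; rewrite /= ?ji ?xi1 ?subrr ?subr0.
  rewrite rE; apply: (@le_trans _ _ (- e x0)); last by move: epos; clear; lra.
  rewrite -subr_ge0 -opprD oppr_ge0 /e /r half_reflectionK -/r.
  have wr : 0 <= w x0 + w (r x0).
    rewrite /w /half_box_barrier -mulrDl divr_ge0 ?(ltW nR2) //.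
    have -> : transverse_norm2 i (r x0) = transverse_norm2 i x0.
      by apply: eq_bigr => j ji; rewrite mxE (negPf ji).
    rewrite mxE eqxx xi1 subrr mulr1z mulr0z.
    by move: S0; clear; lra.
  have : 0 <= 2 * M * (w x0 + w (r x0)) by rewrite !mulr_ge0 // ltW.
  by clear; lra.
(* The barrier makes the average of [e] larger than [e x0] by 2 M / (d n^2), which contradicts
   maximality. *)
have := avg_le_max d0 nbr; apply/negP; rewrite -ltNge.
rewrite /e avgB avgB avgZ avg_half_box_barrier // -uh //.
rewrite (_ : avg (fun y => u (r y)) x0 = u (r x0)); last first.
  by rewrite (avg_half_reflection u i x0) -uh // sup_r.
rewrite ltrD2l ltrN2 -/w ltr_pM2l ?mulr_gt0 //.
by rewrite ltrBlDr ltrDl invr_gt0 mulr_gt0.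
Qed.

Lemma harmonic_gradient u i n (M : R) : (0 < d)%N -> (0 < n)%N -> 0 < M ->
  (forall x, (sup_norm x <= n)%N -> u x = avg u x) ->
  (forall x, (sup_norm x <= n.+1)%N -> `|u x| <= M) ->
  `|u (unit_step (i, false)) - u 0| <= 4 * d%:R * M / n%:R.
Proof.
move=> d0 n0 M0 uh uM; rewrite ler_norml harmonic_gradient_le // andbT.
rewrite lerNl opprB addrC -[u 0]opprK.
apply: (@harmonic_gradient_le (fun x => - u x)) => // x hx.
  by rewrite (@avg_ext _ _ _ (fun y => -1 * u y)) ?avgZ ?mulN1r -?uh // => y; rewrite mulN1r.
by rewrite normrN uM.
Qed.

End Gradient.

(** * Iterated differences and increments along coordinate paths *)

Section Differences.
Context {R : realType} {d : nat}.
Implicit Types (x y v w : lattice d) (u : lattice d -> R) (i j : 'I_d).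

Definition basis_vec i : lattice d := unit_step (i, false).

Definition diff i u x : R := u (x + basis_vec i) - u x.

Definition second_diff i u x : R := u (x + basis_vec i) + u (x - basis_vec i) - 2 * u x.

Lemma second_diffE i u x : second_diff i u x = diff i (diff i u) (x - basis_vec i).
Proof. by rewrite /second_diff /diff subrK; ring. Qed.

Lemma second_diff_step i j u x : second_diff i u (x + basis_vec j) - second_diff i u x =
  diff j (diff i (diff i u)) (x - basis_vec i).
Proof. by rewrite !second_diffE (addrAC x) [RHS]/diff. Qed.

Lemma avg_second_diff u x : (0 < d)%N ->
  \sum_i second_diff i u x = (2 * d)%:R * (avg u x - u x).
Proof.
move=> d0; rewrite mulrBr mulrA divff ?mul1r; last by rewrite pnatr_eq0; lia.
rewrite (sum_steps (fun e => u (x + e))) /second_diff sumrB sumr_const card_ord.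
congr (_ - _); last by rewrite -[LHS]mulr_natl natrM; ring.
by apply: eq_bigr => i _; rewrite /basis_vec unit_stepN.
Qed.

Definition harmonic_near y n u := forall x, (sup_norm (x - y)%R <= n)%N -> u x = avg u x.

Definition bounded_near y n u (M : R) :=
  forall x, (sup_norm (x - y)%R <= n)%N -> `|u x| <= M.

Lemma sup_norm_basis_vec i : (sup_norm (basis_vec i) <= 1)%N.
Proof. exact: sup_norm_unit_step. Qed.

Lemma diff_near y (r m : nat) i u (M : R) : (0 < d)%N -> (0 < r)%N -> 0 < M ->
  harmonic_near y (m + r) u -> bounded_near y (m + r).+1 u M ->
  harmonic_near y (m + r).-1 (diff i u) /\ bounded_near y m (diff i u) (4 * d%:R * M / r%:R).
Proof.
move=> d0 r0 M0 uh uM; split=> x xy.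
  rewrite /diff avgB (@avg_ext _ _ _ (fun z => u (basis_vec i + z))) => [|z].
    rewrite avg_shift [basis_vec i + x]addrC -!uh //; first by apply: leq_trans xy _; apply: leq_pred.
    rewrite addrAC; apply: leq_trans (sup_normD _ _) _.
    by apply: leq_trans (leq_add xy (sup_norm_basis_vec i)) _; move: r0; clear; lia.
  by rewrite addrC.
have := @harmonic_gradient R d (fun z => u (x + z)) i r M d0 r0 M0.
rewrite addr0; apply=> z hz.
  rewrite avg_shift -uh // addrAC; apply: leq_trans (sup_normD _ _) _; exact: leq_add.
by apply: uM; rewrite addrAC -addnS; apply: leq_trans (sup_normD _ _) _; apply: leq_add.
Qed.

(** The radii 12 r, 8 r, 4 r leave room at each difference for the window [r] of the gradient
    estimate and its boundary layer. *)
Lemma third_diff_near y (r : nat) i j u (M : R) : (0 < d)%N -> (0 < r)%N -> 0 < M ->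
  harmonic_near y (14 * r) u -> bounded_near y (15 * r) u M ->
  bounded_near y (4 * r) (diff j (diff i (diff i u))) ((4 * d%:R / r%:R) ^+ 3 * M).
Proof.
move=> d0 r0 M0 uh uM.
have sub a b f : (a <= b)%N -> harmonic_near y b f -> harmonic_near y a f.
  by move=> ab h x xa; apply: h; apply: leq_trans ab.
have subB a b f N : (a <= b)%N -> bounded_near y b f N -> bounded_near y a f N.
  by move=> ab h x xa; apply: h; apply: leq_trans ab.
have q0 : 0 < 4 * d%:R / r%:R :> R by rewrite divr_gt0 ?mulr_gt0 ?ltr0n.
have mE N : 4 * d%:R * N / r%:R = 4 * d%:R / r%:R * N :> R by rewrite mulrAC.
have [||h1 b1] := @diff_near y r (12 * r) i u M d0 r0 M0.
- by apply: sub uh; lia.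
- by apply: subB uM; lia.
rewrite mE in b1.
have [||h2 b2] := @diff_near y r (8 * r) i (diff i u) _ d0 r0 (mulr_gt0 q0 M0).
- by apply: sub h1; lia.
- by apply: subB b1; lia.
rewrite mE in b2.
have [||_ b3] := @diff_near y r (4 * r) j (diff i (diff i u)) _ d0 r0 (mulr_gt0 q0 (mulr_gt0 q0 M0)).
- by apply: sub h2; lia.
- by apply: subB b2; lia.
by rewrite mE in b3; move: b3; rewrite !exprS expr0 mulr1 !mulrA.
Qed.

Lemma segment_le (g : int -> R) (n : nat) (B : R) :
  (forall m : int, (`|m| <= n)%N -> `|g (m + 1) - g m| <= B) ->
  forall k : int, (`|k| <= n)%N -> `|g k - g 0| <= `|k|%:R * B.
Proof.
move=> hg; have [hp hn] : (forall k : nat, (k <= n)%N -> `|g k%:Z - g 0| <= k%:R * B) /\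
    (forall k : nat, (k <= n)%N -> `|g (- k%:Z) - g 0| <= k%:R * B).
  split; elim=> [|k IH] kn; rewrite ?oppr0 ?subrr ?normr0 ?mul0r //.
    have -> : g k.+1%:Z - g 0 = (g (k%:Z + 1) - g k%:Z) + (g k%:Z - g 0).
      by rewrite addrA subrK -addn1 PoszD.
    apply: le_trans (ler_normD _ _) _; rewrite -natr1 mulrDl mul1r addrC lerD ?IH ?hg //; lia.
  have -> : g (- k.+1%:Z) - g 0 = - (g (- k.+1%:Z + 1) - g (- k.+1%:Z)) + (g (- k%:Z) - g 0).
    by rewrite (_ : - k.+1%:Z + 1 = - k%:Z); [ring | lia].
  apply: le_trans (ler_normD _ _) _; rewrite normrN -natr1 mulrDl mul1r addrC.
  by rewrite lerD ?IH ?hg //; lia.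
by case=> k kn; [apply: hp | rewrite NegzE; apply: hn].
Qed.

(** The symmetric increment is the sum of the second differences at k with weights n - |k|, and
    these weights add up to n^2. *)
Lemma symmetric_increment_le (g : int -> R) (n : nat) (a M : R) :
  (forall k : int, (`|k| < n)%N -> `|g (k + 1) + g (k - 1) - 2 * g k - a| <= M) ->
  `|g n%:Z + g (- n%:Z) - 2 * g 0 - n%:R ^+ 2 * a| <= n%:R ^+ 2 * M.
Proof.
move=> hg.
pose t (m : nat) : R := g m%:Z + g (- m%:Z) - 2 * g 0 - m%:R ^+ 2 * a.
rewrite -/(t n); have t0 : t 0%N = 0 by rewrite /t oppr0 expr0n /=; ring.
have step m : (m.+1 <= n)%N -> `|t m.+1 - t m| <= (2 * m%:R + 1) * M.
  elim: m => [|m IH] mn.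
    rewrite t0 subr0 mulr0 add0r mul1r /t expr1n.
    by have := hg 0 mn; rewrite add0r sub0r mul1r; congr (_ <= _); congr (`|_|); ring.
  have -> : t m.+2 - t m.+1 = (t m.+1 - t m)
     + (g (m.+1%:Z + 1) + g (m.+1%:Z - 1) - 2 * g m.+1%:Z - a)
     + (g (- m.+1%:Z + 1) + g (- m.+1%:Z - 1) - 2 * g (- m.+1%:Z) - a).
    rewrite (_ : m.+1%:Z + 1 = m.+2%:Z); last lia.
    rewrite (_ : m.+1%:Z - 1 = m%:Z); last lia.
    rewrite (_ : - m.+1%:Z + 1 = - m%:Z); last lia.
    rewrite (_ : - m.+1%:Z - 1 = - m.+2%:Z); last lia.
    by rewrite /t -(natr1 m.+1) -(natr1 m); ring.
  apply: le_trans (ler_normD _ _) _; apply: le_trans (lerD (ler_normD _ _) (lexx _)) _.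
  have -> : (2 * m.+1%:R + 1) * M = (2 * m%:R + 1) * M + M + M by rewrite -natr1; ring.
  by rewrite !lerD ?IH ?hg //; lia.
suff h m : (m <= n)%N -> `|t m| <= m%:R ^+ 2 * M by exact: h.
elim: m => [|m IH] mn; first by rewrite t0 normr0 expr0n mul0r.
have -> : t m.+1 = (t m.+1 - t m) + t m by rewrite subrK.
have -> : m.+1%:R ^+ 2 * M = (2 * m%:R + 1) * M + m%:R ^+ 2 * M by rewrite -natr1; ring.
by apply: le_trans (ler_normD _ _) _; rewrite lerD ?step ?IH // ltnW.
Qed.

(** These points lead from 0 to [v] by changing one coordinate at a time. The i-th point does not
    see the coordinate i, so that flipping this coordinate fixes it ([truncate_flip]). *)
Definition truncate (k : nat) v : lattice d :=
  \row_j (if (j < k)%N then v ord0 j else 0).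

Lemma truncate0 v : truncate 0 v = 0.
Proof. by apply/rowP => j; rewrite !mxE. Qed.

Lemma truncate_full v : truncate d v = v.
Proof. by apply/rowP => j; rewrite !mxE ltn_ord. Qed.

Lemma truncateS i v : truncate i.+1 v = truncate i v + v ord0 i *: basis_vec i.
Proof.
apply/rowP => j; rewrite !mxE expr0 mul1r eqxx /= ltnS leq_eqVlt.
rewrite -[(j == i :> nat)]/(j == i).
by case: (eqVneq j i) => [->|ji] /=; rewrite ?ltnn ?mulr1 ?add0r ?mulr0 ?addr0.
Qed.

Lemma sup_norm_truncateD i v (m : int) (n : nat) : (sup_norm v <= n)%N -> (`|m| <= n)%N ->
  (sup_norm (truncate i v + m *: basis_vec i)%R <= n)%N.
Proof.
move=> /sup_norm_leP hv hm; apply/sup_norm_leP => j.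
rewrite !mxE expr0 mul1r eqxx /=.
have [->|ji] := eqVneq j i; first by rewrite ltnn mulr1 add0r.
by rewrite mulr0 addr0; case: ifP.
Qed.

Lemma telescope_truncate (f : lattice d -> R) v :
  f v - f 0 = \sum_(i < d) (f (truncate i.+1 v) - f (truncate i v)).
Proof.
rewrite -(big_mkord xpredT (fun k => f (truncate k.+1 v) - f (truncate k v))).
by rewrite telescope_sumr // truncate0 truncate_full.
Qed.

Lemma path_le (f : lattice d -> R) y (n : nat) (B : R) :
  (forall j w, (sup_norm (w - y)%R <= n)%N -> `|f (w + basis_vec j) - f w| <= B) ->
  forall v, (sup_norm v <= n)%N -> `|f (y + v) - f y| <= d%:R * (sup_norm v)%:R * B.
Proof.
move=> hf v vn.
have := telescope_truncate (fun x => f (y + x)) v; rewrite addr0 => ->.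
apply: le_trans (ler_norm_sum _ _ _) _.
have -> : d%:R * (sup_norm v)%:R * B = \sum_(i < d) (sup_norm v)%:R * B.
  by rewrite sumr_const card_ord -[RHS]mulr_natl mulrA.
apply: ler_sum => i _; rewrite truncateS.
pose g (m : int) := f (y + (truncate i v + m *: basis_vec i)).
have := @segment_le g (sup_norm v) B; rewrite /g scale0r addr0 => h.
have vi : (`|v ord0 i| <= sup_norm v)%N by have /sup_norm_leP := leqnn (sup_norm v); apply.
apply: le_trans (h _ _ vi) _ => [m hm|].
  rewrite scalerDl scale1r !addrA; apply: hf.
  rewrite -addrA [y + _]addrC addrK; apply: leq_trans vn.
  exact: sup_norm_truncateD.
rewrite ler_wpM2r ?ler_nat //; apply: le_trans (normr_ge0 _) (hf i y _).
by rewrite subrr sup_norm0.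
Qed.

End Differences.

(** * Third differences of the Green function, and cubic symmetry *)

Section GreenDecay.
Context {R : realType} {d : nat}.
Implicit Types (x y v w : lattice d) (i j : 'I_d) (A : R).

Lemma sup_norm_phi1 A x : 1 <= A -> (sup_norm x)%:R * phi A 1 x <= 1.
Proof.
move=> A1; rewrite /phi expr1.
have p : 0 < norm2 x + A by apply: ltr_wpDl; [exact: norm2_ge0 | exact: lt_le_trans A1].
rewrite ler_pdivrMr ?sqrtr_gt0 // mul1r -[leLHS]ger0_norm // -sqrtr_sqr ler_wsqrtr //.
apply: le_trans (norm2_ge_sqr_sup_norm x) _; rewrite lerDl.
exact: le_trans A1.
Qed.

Lemma norm2_phi2 A x : 1 <= A -> norm2 x * phi A 2 x <= 1.
Proof.
move=> A1; have A0 : 0 < A by apply: lt_le_trans A1.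
rewrite phi2 // ler_pdivrMr ?mul1r ?lerDl ?ltW //.
by apply: ltr_wpDl => //; apply: norm2_ge0.
Qed.

Lemma phi_comparable A (m k : nat) x y : (0 < d)%N -> 1 <= A -> (0 < m)%N ->
  (sup_norm y <= m * sup_norm x)%N -> phi A k x <= (m * d)%:R ^+ k * phi A k y.
Proof.
move=> d0 A1 m0 yx; have A0 : 0 < A by apply: lt_le_trans A1.
apply: phi_scale => //.
apply: (@le_trans _ _ (d%:R * (sup_norm y)%:R ^+ 2 + A)); first by rewrite lerD2r norm2_le_sup_norm.
rewrite mulrDr; apply: lerD; last first.
  by rewrite ler_peMl ?(ltW A0) // exprn_ege1 // ler1n muln_gt0 m0.
apply: (@le_trans _ _ (d%:R * (m * sup_norm x)%:R ^+ 2)).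
  by rewrite ler_wpM2l // lerXn2r ?nnegrE // ler_nat.
rewrite !natrM !exprMn mulrA [d%:R * _]mulrC; apply: ler_pM; rewrite ?mulr_ge0 ?exprn_ge0 ?norm2_ge_sqr_sup_norm //.
by rewrite ler_wpM2l ?exprn_ge0 // ler_eXnr // ler1n.
Qed.

Lemma sum_phi_tail A k K (l : seq (lattice d)) : (4 < d)%N -> green_estimates d A k K -> uniq l ->
  \sum_(x <- l) phi A (d + 1) x <= K / k.
Proof.
move=> hd GE ul; have k0 := green_lower_gt0 GE.
have dE : (d + 1 = (d - 2) + 3)%N by move: hd; clear; lia.
rewrite ler_pdivlMr // mulrC mulr_sumr; apply: le_trans (green_conv_phi3 GE 0 ul).
apply: ler_sum => x _; rewrite sub0r phiN dE phiD mulrA.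
by rewrite ler_wpM2r ?phi_ge0 // (green_lower GE).
Qed.

(** The box of radius 15 r about [y] stays at distance at least r from the origin, the only point
    where C is not harmonic. On it C is at most of order phi_(d-2)(y), and each difference gains 1 /
    r, which is at most of order phi_1(y). *)
Lemma green_third_diff A k K : (4 < d)%N -> green_estimates d A k K ->
  exists2 B : R, 0 <= B & forall y r i j, (0 < r)%N -> (16 * r <= sup_norm y < 16 * r.+1)%N ->
    bounded_near y (4 * r) (diff j (diff i (diff i green))) (B * phi A (d + 1) y).
Proof.
move=> hd GE; have d0 : (0 < d)%N by apply: leq_trans hd.
have dE : (d + 1 = (d - 2) + 3)%N by move: hd; clear; lia.
have A15 := radius_ge15 GE; have K0 := green_upper_gt0 GE.
have A1 : 1 <= A by apply: le_trans A15; rewrite ler1n.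
have A0 : 0 < A by apply: lt_le_trans A1.
(* From sup_norm y <= 32 r follows |y|^2 + A <= c r^2, and c <= c^2 since c >= 1. *)
pose c : R := 32 ^+ 2 * d%:R + A.
have c1 : 1 <= c by apply: le_trans A1 _; rewrite lerDr mulr_ge0 ?exprn_ge0 ?ler0n.
have c0 : 0 <= c by apply: le_trans c1.
exists ((4 * d%:R * c) ^+ 3 * (K * (32 * d)%:R ^+ (d - 2))).
  by rewrite !mulr_ge0 ?exprn_ge0 ?mulr_ge0 // ltW.
move=> y r i j r0 /andP[r1 r2].
have r32 : (sup_norm y <= 32 * r)%N by move: r0 r2; clear; lia.
have far x : (sup_norm (x - y)%R <= 15 * r)%N -> (r <= sup_norm x)%N.
  move=> h; have := sup_normD x (y - x); rewrite addrC subrK.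
  rewrite -(sup_normN (y - x)) opprB; move: h r1; move: (sup_norm (x - y)) => *; lia.
have rR : 0 < r%:R :> R by rewrite ltr0n.
have rphi : r%:R^-1 <= c * phi A 1 y.
  rewrite /phi expr1 ler_pdivlMr ?sqrtr_gt0; last first.
    by apply: ltr_wpDl => //; apply: norm2_ge0.
  rewrite ler_pdivrMl // -[leRHS]ger0_norm ?mulr_ge0 ?(ltW rR) // -sqrtr_sqr ler_wsqrtr //.
  apply: (@le_trans _ _ (c * r%:R ^+ 2)); last first.
    rewrite exprMn mulrC ler_wpM2l ?exprn_ge0 ?(ltW rR) //.
    by rewrite expr2 ler_peMl.
  rewrite /c mulrDl; apply: lerD; last by rewrite ler_peMr ?(ltW A0) // exprn_ege1 // ler1n.
  apply: le_trans (norm2_le_sup_norm y) _.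
  apply: (@le_trans _ _ (d%:R * (32 * r)%:R ^+ 2)).
    by rewrite ler_wpM2l // lerXn2r ?nnegrE // ler_nat.
  by rewrite natrM le_eqVlt; apply/orP; left; apply/eqP; ring.
pose M := K * (32 * d)%:R ^+ (d - 2) * phi A (d - 2) y.
have M0 : 0 < M by rewrite !mulr_gt0 ?phi_gt0 ?exprn_gt0 // ltr0n muln_gt0.
have harm : harmonic_near y (14 * r) (@green R d).
  move=> x hx; rewrite {1}(green_harmonic (green_part_bounded GE)) /dirac_at.
  have : (r <= sup_norm x)%N by apply: far; apply: leq_trans hx _; rewrite leq_mul2r orbT.
  by rewrite -{1}(prednK r0); case: eqP => [->|_ _]; rewrite ?sup_norm0 // add0r.
have bnd : bounded_near y (15 * r) (@green R d) M.
  move=> x /far hx; rewrite ger0_norm ?(green_ge0 (green_part_bounded GE)) //.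
  apply: le_trans (green_upper GE x) _; rewrite /M -mulrA ler_wpM2l ?(ltW K0) //.
  apply: phi_comparable => //; apply: leq_trans r32 _.
  by rewrite leq_mul2l hx orbT.
have T := @third_diff_near R d y r i j _ _ d0 r0 M0 harm bnd.
move=> x hx; apply: le_trans (T x hx) _.
rewrite dE phiD /M !exprMn.
have -> : phi A 3 y = phi A 1 y ^+ 3 by rewrite -phi_expn.
have -> : 4 ^+ 3 * d%:R ^+ 3 * c ^+ 3 * (K * (32 * d)%:R ^+ (d - 2)) * (phi A (d - 2) y * phi A 1 y ^+ 3) =
   4 ^+ 3 * d%:R ^+ 3 * (c * phi A 1 y) ^+ 3 * (K * (32 * d)%:R ^+ (d - 2) * phi A (d - 2) y) by ring.
rewrite ler_wpM2r ?(ltW M0) // ler_wpM2l ?mulr_ge0 ?exprn_ge0 //.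
by rewrite lerXn2r ?nnegrE ?invr_ge0 ?mulr_ge0 ?phi_ge0 .
Qed.

Definition flip_coord i x : lattice d := \row_j (if j == i then - x ord0 j else x ord0 j).

Definition swap_coord i j x : lattice d := \row_k x ord0 (tperm i j k).

(** Sign changes and transpositions of the coordinates generate the symmetry group of the cube. *)
Definition cubic_symmetric (f : lattice d -> R) :=
  (forall i x, f (flip_coord i x) = f x) /\ (forall i j x, f (swap_coord i j x) = f x).

Lemma flip_coordK i : involutive (flip_coord i).
Proof. by move=> x; apply/rowP => j; rewrite !mxE; case: eqP; rewrite ?opprK. Qed.

Lemma swap_coordK i j : involutive (swap_coord i j).
Proof. by move=> x; apply/rowP => k; rewrite !mxE tpermK. Qed.

Lemma sup_norm_flip_coord i x : sup_norm (flip_coord i x) = sup_norm x.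
Proof. by apply: eq_bigr => j _; rewrite mxE; case: eqP; rewrite ?abszN. Qed.

Lemma sup_norm_swap_coord i j x : sup_norm (swap_coord i j x) = sup_norm x.
Proof.
rewrite [RHS](reindex_inj (@perm_inj _ (tperm i j))) /=.
by apply: eq_bigr => k _; rewrite mxE.
Qed.

Lemma reindex_box (g : lattice d -> lattice d) (n : nat) (Q : pred nat) (f : lattice d -> R) :
  involutive g -> (forall x, sup_norm (g x) = sup_norm x) ->
  \sum_(x <- box n | Q (sup_norm x)) f (g x) = \sum_(x <- box n | Q (sup_norm x)) f x.
Proof.
move=> gK gs; have gi := inv_inj gK.
have pe : perm_eq (map g (box n)) (box n).
  apply: uniq_perm; rewrite ?(map_inj_uniq gi) ?box_uniq // => x.
  apply/mapP/idP => [[z hz ->]|hx]; first by rewrite mem_box gs -mem_box.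
  by exists (g x); rewrite ?gK // mem_box gs -mem_box.
rewrite -[RHS](perm_big _ pe) /= big_map.
by apply: eq_bigl => x; rewrite gs.
Qed.

End GreenDecay.

(** * Second order cancellation *)

Section Perturbation.
Context {R : realType} {d : nat}.
Implicit Types (x y v w : lattice d) (i j : 'I_d) (A k K e : R) (l : seq (lattice d)).

(** The exponent 3 (d - 2) of C^3 reaches d + 4 exactly when d >= 5. *)
Lemma green_cube_le A k K x (m : nat) : (4 < d)%N -> green_estimates d A k K ->
  (m <= (d + 1) + 3)%N -> green x ^+ 3 <= K ^+ 3 * phi A m x.
Proof.
move=> hd GE hm; have A15 := radius_ge15 GE.
have A1 : 1 <= A by apply: le_trans A15; rewrite ler1n.
have m3 : (m <= (d - 2) * 3)%N by move: hd hm; clear; lia.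
apply: (@le_trans _ _ ((K * phi A (d - 2) x) ^+ 3)).
  by rewrite lerXn2r ?nnegrE ?(green_upper GE) ?mulr_ge0 ?phi_ge0 ?(green_ge0 (green_part_bounded GE))
    ?(ltW (green_upper_gt0 GE)).
rewrite exprMn -phi_expn ler_wpM2l ?exprn_ge0 ?(ltW (green_upper_gt0 GE)) //.
exact: phi_decr.
Qed.

Lemma green_cube_moment A k K x : (4 < d)%N -> green_estimates d A k K ->
  green x ^+ 3 * (sup_norm x)%:R ^+ 3 <= K ^+ 3 * phi A (d + 1) x.
Proof.
move=> hd GE; have A15 := radius_ge15 GE.
have A1 : 1 <= A by apply: le_trans A15; rewrite ler1n.
have K0 := ltW (green_upper_gt0 GE).
apply: le_trans (ler_wpM2r _ (green_cube_le x hd GE (leqnn _))) _; first exact: exprn_ge0.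
rewrite -mulrA ler_wpM2l ?exprn_ge0 // phiD -mulrA ler_piMr ?phi_ge0 //.
rewrite (phi_expn A 1 3) -exprMn mulrC exprn_ile1 ?mulr_ge0 ?phi_ge0 //.
exact: sup_norm_phi1.
Qed.

Lemma green_cube_norm2 A k K x : (4 < d)%N -> green_estimates d A k K ->
  green x ^+ 3 * norm2 x <= K ^+ 3 * phi A (d + 1) x.
Proof.
move=> hd GE; have A15 := radius_ge15 GE.
have A1 : 1 <= A by apply: le_trans A15; rewrite ler1n.
have K0 := ltW (green_upper_gt0 GE).
have h : ((d + 1) + 2 <= (d + 1) + 3)%N by rewrite leq_add2l.
apply: le_trans (ler_wpM2r (norm2_ge0 x) (green_cube_le x hd GE h)) _.
rewrite -mulrA ler_wpM2l ?exprn_ge0 // phiD -mulrA ler_piMr ?phi_ge0 //.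
by rewrite mulrC norm2_phi2.
Qed.

Lemma green_conv_phi3_sub A k K l y : green_estimates d A k K -> uniq l ->
  \sum_(x <- l) green (y - x) * phi A 3 x <= K.
Proof.
move=> GE ul; pose l' := [seq y - x | x <- l].
have ul' : uniq l' by rewrite map_inj_uniq // => a b /addrI /oppr_inj.
apply: le_trans (green_conv_phi3 GE y ul'); rewrite big_map.
by apply: ler_sum => x _; rewrite subKr.
Qed.

(** C(x)^3 is split as phi_(d+1) phi_3. Next to C(y - x) the first factor is frozen at y and phi_3
    is convolved with C; next to C(y) it is phi_3 that is frozen and phi_(d+1) that is summed, and
    phi_3 phi_(d-2) = phi_(d+1) at y. Freezing costs a constant because |y| <= 16 |x| in the sup
    norm. *)
Lemma sum_far_le A k K : (4 < d)%N -> green_estimates d A k K ->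
  exists2 B : R, 0 <= B & forall (P : lattice d -> R) e l y (r : nat), 0 <= e -> uniq l ->
    (forall x, x != 0 -> `|P x| <= e * green x ^+ 3) -> (sup_norm y < 16 * r.+1)%N ->
    \sum_(x <- l | (r < sup_norm x)%N) `|P x| * (green (y - x) + green y) <=
      e * (B * phi A (d + 1) y).
Proof.
move=> hd GE; have A15 := radius_ge15 GE.
have d0 : (0 < d)%N by apply: leq_trans hd.
have dE : (d + 1 = (d - 2) + 3)%N by move: hd; clear; lia.
have A1 : 1 <= A by apply: le_trans A15; rewrite ler1n.
have K0 := ltW (green_upper_gt0 GE); have k0 := ltW (green_lower_gt0 GE).
have C0 x : 0 <= green x :> R by apply: green_ge0 (green_part_bounded GE) x.
pose c : R := (16 * d)%:R; have c0 : 0 <= c by rewrite ler0n.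
have B10 : 0 <= K ^+ 3 * c ^+ (d + 1) * K by rewrite !mulr_ge0 ?exprn_ge0.
have B20 : 0 <= K ^+ 3 * (c ^+ 3 * K) * (K / k) by rewrite !mulr_ge0 ?exprn_ge0 ?invr_ge0.
exists (K ^+ 3 * c ^+ (d + 1) * K + K ^+ 3 * (c ^+ 3 * K) * (K / k)); first exact: addr_ge0.
move=> P e l y r e0 ul hP yr; rewrite -big_filter; set l' := [seq x <- l | _].
have ul' : uniq l' by apply: filter_uniq.
have hl' x : x \in l' -> x != 0 /\ (sup_norm y <= 16 * sup_norm x)%N.
  rewrite mem_filter => /andP[rx _]; split.
    by rewrite -sup_norm_eq0 -lt0n; apply: leq_trans rx.
  by apply: leq_trans (ltnW yr) _; rewrite leq_mul2l rx.
apply: (@le_trans _ _ (\sum_(x <- l') e * (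
    K ^+ 3 * (c ^+ (d + 1) * phi A (d + 1) y) * (green (y - x) * phi A 3 x)
  + K ^+ 3 * (c ^+ 3 * phi A 3 y) * (K * phi A (d - 2) y) * phi A (d + 1) x))).
  rewrite !big_seq; apply: ler_sum => x /hl'[x0 xy].
  apply: le_trans (ler_wpM2r _ (hP x x0)) _; first exact: addr_ge0.
  rewrite -[leLHS]mulrA ler_wpM2l // [leLHS]mulrDr.
  have P0 m w : 0 <= phi A m w by apply: phi_ge0.
  have cubeE : green x ^+ 3 <= K ^+ 3 * (phi A (d + 1) x * phi A 3 x).
    by rewrite -phiD; apply: (green_cube_le x hd GE).
  have cmp m : phi A m x <= c ^+ m * phi A m y by apply: phi_comparable.
  apply: lerD.
    apply: le_trans (ler_wpM2r (C0 _) cubeE) _.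
    apply: (@le_trans _ _ (K ^+ 3 * phi A (d + 1) x * (green (y - x) * phi A 3 x))).
      by rewrite le_eqVlt; apply/orP; left; apply/eqP; ring.
    by rewrite ler_wpM2r ?mulr_ge0 // ler_wpM2l ?exprn_ge0 ?cmp.
  apply: (@le_trans _ _ (K ^+ 3 * (phi A (d + 1) x * (c ^+ 3 * phi A 3 y)) * green y)).
    by rewrite ler_wpM2r // (le_trans cubeE) // ler_wpM2l ?exprn_ge0 // ler_wpM2l //.
  apply: (@le_trans _ _ (K ^+ 3 * (phi A (d + 1) x * (c ^+ 3 * phi A 3 y)) * (K * phi A (d - 2) y))).
    by rewrite ler_wpM2l ?mulr_ge0 ?exprn_ge0 // (green_upper GE).
  by rewrite le_eqVlt; apply/orP; left; apply/eqP; ring.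
rewrite -mulr_sumr ler_wpM2l // big_split /= -!mulr_sumr mulrDl; apply: lerD.
  apply: le_trans (ler_wpM2l _ (green_conv_phi3_sub y GE ul')) _.
    by rewrite !mulr_ge0 ?exprn_ge0 ?phi_ge0.
  by rewrite le_eqVlt; apply/orP; left; apply/eqP; ring.
have S := sum_phi_tail hd GE ul'.
apply: le_trans (ler_wpM2l _ S) _; first by rewrite !mulr_ge0 ?exprn_ge0 ?phi_ge0.
have -> : phi A (d + 1) y = phi A (d - 2) y * phi A 3 y by rewrite dE phiD.
by rewrite le_eqVlt; apply/orP; left; apply/eqP; ring.
Qed.

Lemma truncate_flip i x : truncate i (flip_coord i x) = truncate i x.
Proof.
apply/rowP => j; rewrite !mxE; case: ifP => // ji.
by case: eqP => // ij; move: ji; rewrite ij ltnn.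
Qed.

Lemma sum_near_le A k K : (4 < d)%N -> green_estimates d A k K ->
  exists2 B : R, 0 <= B & forall (P : lattice d -> R) e (N : nat) y (r : nat), 0 <= e ->
    cubic_symmetric P ->
    (forall x, x != 0 -> `|P x| <= e * green x ^+ 3) ->
    (0 < r)%N -> (16 * r <= sup_norm y < 16 * r.+1)%N ->
    `|\sum_(x <- box N | (sup_norm x <= r)%N) P x * (green (y - x) - green y)|
      <= e * (B * phi A (d + 1) y).
Proof.
move=> hd GE; have [B0 B00 T3] := green_third_diff hd GE.
have d0 : (0 < d)%N by apply: leq_trans hd.
have K0 := ltW (green_upper_gt0 GE); have k0 := ltW (green_lower_gt0 GE).
exists (d%:R * (d%:R * B0 * (K ^+ 3 * (K / k)))).
  by rewrite !mulr_ge0 ?exprn_ge0 ?invr_ge0.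
move=> P e N y r e0 [Pflip Pswap] hP r0 hr.
have [B BE] : exists B, B = B0 * phi A (d + 1) y by exists (B0 * phi A (d + 1) y).
have B_ge0 : 0 <= B by rewrite BE mulr_ge0 ?phi_ge0.
have y0 : y != 0.
  rewrite -sup_norm_eq0 -lt0n; case/andP: hr => h _; apply: leq_trans h.
  by rewrite muln_gt0.
pose f v : R := green (y - v).
pose S (h : lattice d -> R) := \sum_(x <- box N | (sup_norm x <= r)%N) h x.
have Sflip i h : S (fun x => h (flip_coord i x)) = S h.
  by apply: (@reindex_box R d (flip_coord i) N (fun m => m <= r)%N);
    [apply: flip_coordK | apply: sup_norm_flip_coord].
have Sswap i j h : S (fun x => h (swap_coord i j x)) = S h.
  by apply: (@reindex_box R d (swap_coord i j) N (fun m => m <= r)%N);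
    [apply: swap_coordK | apply: sup_norm_swap_coord].
pose q i := S (fun x => P x * (x ord0 i)%:~R ^+ 2).
have qE i j : q i = q j.
  rewrite /q -(Sswap i j); apply: eq_bigr => x _.
  by rewrite Pswap mxE tpermL.
pose D i := second_diff i (@green R d) y.
(* Away from the origin C is harmonic, and the sum of its second differences is a multiple of its
   Laplacian. *)
have sumD : \sum_i D i = 0.
  rewrite /D avg_second_diff // [X in _ - X](green_harmonic (green_part_bounded GE)).
  by rewrite /dirac_at (negPf y0) add0r subrr mulr0.
pose br i x := f (truncate i x + x ord0 i *: basis_vec i)
  + f (truncate i x - x ord0 i *: basis_vec i) - 2 * f (truncate i x).
(* Averaging over the flip of coordinate [i] turns the increment along the i-th segment into half a
   symmetric one, without first-order term. *)
have symm i : S (fun x => P x * (f (truncate i.+1 x) - f (truncate i x))) =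
    2^-1 * S (fun x => P x * br i x).
  set h := (X in S X = _).
  rewrite -[LHS](mulKf (_ : 2 != 0 :> R)) // mulrDl mul1r -{2}(Sflip i) -big_split /=.
  congr (_ * _); apply: eq_bigr => x _; rewrite /h Pflip !truncateS truncate_flip.
  rewrite (_ : flip_coord i x ord0 i = - x ord0 i) ?scaleNr; last by rewrite mxE eqxx.
  by rewrite /br; ring.
(* The second differences along the segment differ from the one at [y] by at most d |x| B, a
   third-difference bound summed over a coordinate path; [symmetric_increment_le] contributes the
   remaining |x|^2. *)
have brB i x : (sup_norm x <= r)%N ->
    `|br i x - (x ord0 i)%:~R ^+ 2 * D i| <= (sup_norm x)%:R ^+ 3 * (d%:R * B).
  move=> xr; pose g (m : int) := f (truncate i x + m *: basis_vec i).
  have vi : (`|x ord0 i| <= sup_norm x)%N by have /sup_norm_leP := leqnn (sup_norm x); apply.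
  have gE : br i x - (x ord0 i)%:~R ^+ 2 * D i =
      g `|x ord0 i|%N%:Z + g (- `|x ord0 i|%N%:Z) - 2 * g 0 - `|x ord0 i|%N%:R ^+ 2 * D i.
    rewrite /g scale0r addr0 /br -scaleNr natr_absz intr_norm real_normK ?num_real //.
    by case: (x ord0 i) => m //=; rewrite NegzE opprK [f _ + f (_ + m.+1%:Z *: _)]addrC.
  rewrite gE; apply: le_trans (@symmetric_increment_le R g _ (D i) (d%:R * (sup_norm x)%:R * B) _) _.
    move=> m hm; have mx : (`|m| <= sup_norm x)%N by apply: ltnW; apply: leq_trans vi.
    have -> : g (m + 1) + g (m - 1) - 2 * g m =
        second_diff i (@green R d) (y + - (truncate i x + m *: basis_vec i)).
      rewrite /second_diff /g /f !scalerDl scaleN1r scale1r !opprD opprK !addrA.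
      by rewrite [X in X - _]addrC.
    have nv : (sup_norm (- (truncate i x + m *: basis_vec i))%R <= sup_norm x)%N.
      by rewrite sup_normN; apply: sup_norm_truncateD.
    apply: le_trans (@path_le R d _ y r B _ _ _) _; last 1 first.
    - by rewrite ler_wpM2r // ler_wpM2l // ler_nat.
    - move=> j w wr; rewrite second_diff_step; rewrite BE; apply: (T3 y r i j r0 hr).
      rewrite addrAC; apply: leq_trans (sup_normD _ _) _; rewrite sup_normN.
      apply: leq_trans (leq_add wr (sup_norm_basis_vec i)) _.
      by move: r0; clear; lia.
    - exact: leq_trans nv xr.
  have -> : (sup_norm x)%:R ^+ 3 * (d%:R * B) = (sup_norm x)%:R ^+ 2 * (d%:R * (sup_norm x)%:R * B) by ring.
  apply: ler_wpM2r; first by rewrite !mulr_ge0.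
  by rewrite lerXn2r ?nnegrE // ler_nat.
have -> : \sum_(x <- box N | (sup_norm x <= r)%N) P x * (green (y - x) - green y) =
    2^-1 * \sum_(i < d) S (fun x => P x * (br i x - (x ord0 i)%:~R ^+ 2 * D i)).
  transitivity (\sum_(i < d) S (fun x => P x * (f (truncate i.+1 x) - f (truncate i x)))).
    rewrite /S exchange_big /=; apply: eq_bigr => x _.
    by rewrite -mulr_sumr -telescope_truncate /f subr0.
  rewrite (eq_bigr _ (fun i _ => symm i)) -mulr_sumr; congr (_ * _).
  transitivity (\sum_(i < d) (S (fun x => P x * br i x) - q i * D i)).
    (* The moments [q i] do not depend on [i], so the second-order terms add up to a multiple of
       [sumD]. *)
    rewrite sumrB (eq_bigr (fun i => q (Ordinal d0) * D i) (F1 := fun i => q i * D i)) => [|i _].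
      by rewrite -mulr_sumr sumD mulr0 subr0.
    by rewrite (qE i (Ordinal d0)).
  apply: eq_bigr => i _; rewrite /q /S mulr_suml -sumrB.
  by apply: eq_bigr => x _; move: (br i x) (D i) => *; ring.
have sumx : S (fun x => `|P x| * ((sup_norm x)%:R ^+ 3 * (d%:R * B))) <=
    e * (d%:R * B0 * (K ^+ 3 * (K / k)) * phi A (d + 1) y).
  apply: (@le_trans _ _ (\sum_(x <- box N | (sup_norm x <= r)%N)
     e * (d%:R * B) * K ^+ 3 * phi A (d + 1) x)).
    apply: ler_sum => x _; have [->|x0] := eqVneq x 0.
      by rewrite sup_norm0 expr0n /= mul0r mulr0 !mulr_ge0 ?exprn_ge0 ?phi_ge0.
    rewrite [leLHS]mulrA; apply: (@le_trans _ _ (e * (K ^+ 3 * phi A (d + 1) x) * (d%:R * B))).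
      rewrite ler_wpM2r ?mulr_ge0 //.
      apply: le_trans (ler_wpM2r _ (hP x x0)) _; first exact: exprn_ge0.
      by rewrite -mulrA ler_wpM2l // (green_cube_moment x hd GE).
    by rewrite le_eqVlt; apply/orP; left; apply/eqP; ring.
  rewrite -mulr_sumr -big_filter.
  have S1 := sum_phi_tail hd GE (filter_uniq (fun x => sup_norm x <= r)%N (box_uniq N)).
  apply: le_trans (ler_wpM2l _ S1) _; first by rewrite !mulr_ge0 ?exprn_ge0.
  by rewrite BE le_eqVlt; apply/orP; left; apply/eqP; ring.
rewrite normrM ger0_norm ?invr_ge0 //.
apply: le_trans (ler_piMl _ _) _; [exact: normr_ge0 | by rewrite invf_le1 // ler1n |].
apply: le_trans (ler_norm_sum _ _ _) _.
apply: (@le_trans _ _ (\sum_(i < d) e * (d%:R * B0 * (K ^+ 3 * (K / k)) * phi A (d + 1) y))).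
  apply: ler_sum => i _; apply: le_trans sumx.
  apply: le_trans (ler_norm_sum _ _ _) _; apply: ler_sum => x xr.
  by rewrite normrM ler_wpM2l // brB.
rewrite sumr_const card_ord -[leLHS]mulr_natl le_eqVlt; apply/orP; left; apply/eqP; ring.
Qed.

End Perturbation.

Section PerturbationBound.
Context {R : realType} {d : nat}.
Implicit Types (x y : lattice d) (A k K e : R) (P : lattice d -> R).

Lemma perturbation_variance_le A k K P e (N : nat) : (4 < d)%N -> green_estimates d A k K -> 0 <= e ->
  (forall x, x != 0 -> `|P x| <= e * green x ^+ 3) ->
  `|\sum_(x <- box N) P x * norm2 x| <= e * (K ^+ 3 * (K / k)).
Proof.
move=> hd GE e0 hP; have K0 := ltW (green_upper_gt0 GE).
have S := sum_phi_tail hd GE (box_uniq N).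
rewrite mulrA; apply: le_trans (ler_wpM2l _ S); last by rewrite mulr_ge0 ?exprn_ge0.
apply: le_trans (ler_norm_sum _ _ _) _; rewrite mulr_sumr; apply: ler_sum => x _.
rewrite normrM (ger0_norm (norm2_ge0 x)); have [->|x0] := eqVneq x 0.
  rewrite (_ : norm2 (0 : lattice d) = 0 :> R).
    by rewrite mulr0 !mulr_ge0 ?exprn_ge0 ?phi_ge0.
  by rewrite /norm2 big1 // => i _; rewrite mxE mulr0z expr0n.
apply: le_trans (ler_wpM2r (norm2_ge0 x) (hP x x0)) _.
rewrite -[leLHS]mulrA -[leRHS]mulrA ler_wpM2l //.
exact: (green_cube_norm2 x hd GE).
Qed.

(* Subtracting the second moment of [P] cancels the |x|^(-d) tail of
   [P * green], which leaves a summable function. *)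
Lemma perturbation_bound A k K : (4 < d)%N -> green_estimates d A k K ->
  exists2 B : R, 0 <= B & forall P e (N : nat) y, 0 <= e -> cubic_symmetric P ->
    (forall x, x != 0 -> `|P x| <= e * green x ^+ 3) ->
    `|\sum_(x <- box N) P x * (green (y - x) - green y) +
      (\sum_(x <- box N) P x * norm2 x) * dirac_at 0 y| <= e * (B * phi A (d + 1) y).
Proof.
move=> hd GE; have [Bf Bf0 far] := sum_far_le hd GE.
have [Bn Bn0 near] := sum_near_le hd GE.
have K0 := ltW (green_upper_gt0 GE); have k0 := ltW (green_lower_gt0 GE).
have A0 : 0 < A by apply: lt_le_trans (radius_ge15 GE); rewrite ltr0n.
pose F : R := phi A (d + 1) (0 : lattice d); have F0 : 0 < F by apply: phi_gt0.
have t0 : 0 <= K ^+ 3 * (K / k) / F.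
  by rewrite !mulr_ge0 ?exprn_ge0 ?invr_ge0 // ltW.
exists (Bn + Bf + K ^+ 3 * (K / k) / F); first by rewrite !addr_ge0.
move=> P e N y e0 hsym hP; pose r := (sup_norm y %/ 16)%N.
have r1 : (16 * r <= sup_norm y)%N by rewrite mulnC leq_trunc_div.
have r2 : (sup_norm y < 16 * r.+1)%N by rewrite mulnC ltn_ceil.
have p0 := phi_ge0 A (d + 1) y.
rewrite !mulrDl !mulrDr; apply: le_trans (ler_normD _ _) _; apply: lerD.
  rewrite (bigID (fun x => (sup_norm x <= r)%N)) /=.
  apply: le_trans (ler_normD _ _) _; apply: lerD.
    (* For sup_norm y < 16 the near region is the origin alone, where the summand vanishes. *)
    have [r0|r0] := posnP r; last by apply: near; rewrite ?r1.
    rewrite big1 ?normr0 ?mulr_ge0 // => x; rewrite r0 leqn0 sup_norm_eq0 => /eqP ->.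
    by rewrite subr0 subrr mulr0.
  apply: le_trans (far P e (box N) y r e0 (box_uniq N) hP r2).
  apply: le_trans (ler_norm_sum _ _ _) _.
  rewrite (eq_bigl (fun x => (r < sup_norm x)%N)) => [|x]; last by rewrite -ltnNge.
  apply: ler_sum => x _; rewrite normrM ler_wpM2l //.
  apply: le_trans (ler_normB _ _) _.
  by rewrite !ger0_norm // (green_ge0 (green_part_bounded GE)).
rewrite /dirac_at; case: eqP => [->|_]; last by rewrite mulr0 normr0 mulr_ge0 // mulr_ge0.
rewrite mulr1 -/F divfK ?gt_eqF //.
exact: (perturbation_variance_le N hd GE e0 hP).
Qed.

End PerturbationBound.

(** * Lace expansion *)

Section Walks.
Context {R : realType} {d : nat} (beta : R).
Implicit Types (x y v e : lattice d) (o eta : seq (lattice d)) (f h : lattice d -> R).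
Implicit Types (F G : seq (lattice d) -> lattice d -> R).

(* The current position is the origin, and a past is the list of the earlier
   positions relative to it. *)
Definition shift_past e o : seq (lattice d) := [seq u - e | u <- 0 :: o].

Definition step_weight e o : R := (1 - beta) ^+ count_mem e o.

(* Sum over the walks of n steps that interact with themselves and with the
   past [o]; [F] receives the final past and the displacement. *)
Fixpoint walk_sum n o F : R :=
  if n is n'.+1 then
    (2 * d)%:R^-1 * \sum_(s : 'I_d * bool)
      step_weight (unit_step s) (0 :: o) *
      walk_sum n' (shift_past (unit_step s) o) (fun o' x => F o' (unit_step s + x))
  else F o 0.

Definition saw n o f : R := walk_sum n o (fun=> f).

(* Laces: coefficients of the expansion of a walk avoiding [o] and [eta] in
   terms of walks avoiding [o] only. A walk that meets [eta] is cut at its first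
   visit, after which [eta] is forgotten and the piece just completed takes its
   place. *)
Fixpoint lace m o eta h : R :=
  if m is m'.+1 then
    (2 * d)%:R^-1 * \sum_(s : 'I_d * bool)
      let e := unit_step s in
      step_weight e (0 :: o) *
      ((1 - step_weight e eta) *
         ((m' == 0)%:R * h e - lace m' [::] (shift_past e o) (fun x => h (e + x)))
       + step_weight e eta *
         lace m' (shift_past e o) [seq u - e | u <- eta] (fun x => h (e + x)))
  else 0.

Lemma eq_walk_sum n o F G : (forall o x, F o x = G o x) ->
  walk_sum n o F = walk_sum n o G.
Proof.
elim: n o F G => [|n IH] o F G FG /=; first exact: FG.
by congr (_ * _); apply: eq_bigr => s _; congr (_ * _); apply: IH.
Qed.

Lemma eq_saw n o f h : f =1 h -> saw n o f = saw n o h.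
Proof. by move=> fh; apply: eq_walk_sum. Qed.

Lemma eq_lace m o eta f h : f =1 h -> lace m o eta f = lace m o eta h.
Proof.
elim: m o eta f h => [//|m IH] o eta f h fh /=.
congr (_ * _); apply: eq_bigr => s _; rewrite fh.
by congr (_ * (_ * (_ - _) + _ * _)); apply: IH.
Qed.

Lemma walk_sum_sum (I : Type) (r : seq I) (F : I -> seq (lattice d) -> lattice d -> R) n o :
  walk_sum n o (fun o' x => \sum_(i <- r) F i o' x) = \sum_(i <- r) walk_sum n o (F i).
Proof.
elim: n o F => [//|n IH] o F /=.
rewrite -mulr_sumr exchange_big /=; congr (_ * _); apply: eq_bigr => s _.
by rewrite -mulr_sumr -IH.
Qed.

Lemma walk_sumD n o F G :
  walk_sum n o (fun o' x => F o' x + G o' x) = walk_sum n o F + walk_sum n o G.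
Proof.
elim: n o F G => [//|n IH] o F G /=.
rewrite -mulrDr -big_split /=; congr (_ * _); apply: eq_bigr => s _.
by rewrite -mulrDr -IH.
Qed.

Lemma walk_sumZ n o (c : R) F :
  walk_sum n o (fun o' x => c * F o' x) = c * walk_sum n o F.
Proof.
elim: n o F => [//|n IH] o F /=.
rewrite mulrCA; congr (_ * _); rewrite mulr_sumr; apply: eq_bigr => s _.
by rewrite IH mulrCA.
Qed.

Lemma saw_sum (I : Type) (r : seq I) (F : I -> lattice d -> R) n o :
  saw n o (fun x => \sum_(i <- r) F i x) = \sum_(i <- r) saw n o (F i).
Proof. exact: walk_sum_sum. Qed.

Lemma sawD n o f h : saw n o (fun x => f x + h x) = saw n o f + saw n o h.
Proof. exact: walk_sumD. Qed.

Lemma sawZ n o (c : R) f : saw n o (fun x => c * f x) = c * saw n o f.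
Proof. exact: walk_sumZ. Qed.

Lemma laceZ m o eta (c : R) h : lace m o eta (fun x => c * h x) = c * lace m o eta h.
Proof.
elim: m o eta h => [|m IH] o eta h /=; first by rewrite mulr0.
rewrite mulrCA; congr (_ * _); rewrite mulr_sumr; apply: eq_bigr => s _.
by rewrite !IH; ring.
Qed.

Lemma lace_sum (I : Type) (r : seq I) (F : I -> lattice d -> R) m o eta :
  lace m o eta (fun x => \sum_(i <- r) F i x) = \sum_(i <- r) lace m o eta (F i).
Proof.
elim: m o eta F => [|m IH] o eta F /=; first by rewrite big1.
rewrite -mulr_sumr exchange_big /=; congr (_ * _); apply: eq_bigr => s _.
rewrite -mulr_sumr !IH; congr (_ * _).
by rewrite mulr_sumr -sumrB !mulr_sumr -big_split.
Qed.

Lemma saw_local n o f h : (forall x, (sup_norm x <= n)%N -> f x = h x) ->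
  saw n o f = saw n o h.
Proof.
rewrite /saw; elim: n o f h => [|n IH] o f h fh /=; first by rewrite fh ?sup_norm0.
congr (_ * _); apply: eq_bigr => s _; congr (_ * _); apply: IH => x xn; apply: fh.
apply: leq_trans (sup_normD _ _) _; rewrite -add1n leq_add //.
exact: sup_norm_unit_step.
Qed.

Lemma lace_local m o eta f h : (forall x, (sup_norm x <= m)%N -> f x = h x) ->
  lace m o eta f = lace m o eta h.
Proof.
elim: m o eta f h => [//|m IH] o eta f h fh /=.
congr (_ * _); apply: eq_bigr => s _.
rewrite fh; last by apply: leq_trans (sup_norm_unit_step _) _.
congr (_ * (_ * (_ - _) + _ * _)); apply: IH => x xn; apply: fh;
  apply: leq_trans (sup_normD _ _) _; rewrite -add1n leq_add //;
  exact: sup_norm_unit_step.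
Qed.

Lemma dirac_decomposition f n x : (sup_norm x <= n)%N ->
  f x = \sum_(y <- box n) f y * dirac_at y x.
Proof.
rewrite -mem_box => xn; rewrite (bigD1_seq x) ?box_uniq //= {1}/dirac_at eqxx mulr1.
by rewrite big1 ?addr0 // => y /negPf yx; rewrite /dirac_at eq_sym yx mulr0.
Qed.

Lemma saw_dirac n N o f : (n <= N)%N ->
  saw n o f = \sum_(x <- box N) saw n o (dirac_at x) * f x.
Proof.
move=> nN; rewrite (@saw_local _ _ _ (fun x => \sum_(y <- box N) f y * dirac_at y x)).
  by rewrite saw_sum; apply: eq_bigr => y _; rewrite sawZ mulrC.
by move=> x xn; apply: dirac_decomposition; apply: leq_trans nN.
Qed.

(** With [q] the weight of the first step against [eta], A - q B is written as (1 - q) A + q (A -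
    B). The second part is the induction hypothesis for o' and eta'. In the first, A is the free
    walk minus a difference to which the hypothesis applies with empty first past and o' as the
    obstacle. *)
Lemma lace_expansion n o eta f :
  saw n o f - saw n (o ++ eta) f =
  \sum_(m < n) lace m.+1 o eta (fun x => saw (n - m.+1) [::] (fun y => f (x + y))).
Proof.
elim: n o eta f => [|n IH] o eta f; first by rewrite big_ord0 /saw /= subrr.
rewrite /saw /= -mulrBr -sumrB -mulr_sumr exchange_big /=.
congr (_ * _); apply: eq_bigr => s _.
set e := unit_step s; set o' := shift_past e o.
set eta' := [seq u - e | u <- eta]; pose fe x := f (e + x).
have -> : shift_past e (o ++ eta) = o' ++ eta' by rewrite /shift_past /= map_cat.
have -> : step_weight e (0 :: o ++ eta) = step_weight e (0 :: o) * step_weight e eta.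
  by rewrite /step_weight -exprD -count_cat.
rewrite -mulrA -mulrBr -mulr_sumr; congr (_ * _).
rewrite -!/(saw _ _ _) -/fe; set q := step_weight e eta.
have IH0 := IH [::] o' fe; have IH1 := IH o' eta' fe.
rewrite big_split /= -!mulr_sumr sumrB.
have shiftE o1 eta1 : \sum_(m < n.+1) lace m o1 eta1
     (fun x => walk_sum (n.+1 - m.+1) [::] (fun=> (fun y => f (e + x + y)))) =
   \sum_(m < n) lace m.+1 o1 eta1 (fun x => saw (n - m.+1) [::] (fun y => fe (x + y))).
  rewrite big_ord_recl add0r; apply: eq_bigr => m _.
  by apply: eq_lace => x; rewrite subSS; apply: eq_walk_sum => _ y; rewrite /fe addrA.
rewrite !shiftE -IH0 -IH1 big_ord_recl eqxx mul1r big1 ?addr0 => [|m _]; last by rewrite mul0r.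
rewrite subSS subn0 -/(saw n [::] fe).
by rewrite cat0s; ring.
Qed.

(** The index counts the steps after the first one, so these pieces have m + 1 steps. The first step
    leaves its starting point as the only obstacle. *)
Definition lace_coef m h : R :=
  - ((2 * d)%:R^-1 * \sum_(s : 'I_d * bool)
       lace m [::] [:: - unit_step s] (fun x => h (unit_step s + x))).

Lemma saw_recursion n f :
  saw n.+1 [::] f = avg (fun x => saw n [::] (fun y => f (x + y))) 0
    + \sum_(m < n) lace_coef m.+1 (fun x => saw (n - m.+1) [::] (fun y => f (x + y))).
Proof.
have -> : saw n.+1 [::] f = (2 * d)%:R^-1 * \sum_(s : 'I_d * bool)
    step_weight (unit_step s) [:: 0] *
    saw n (shift_past (unit_step s) [::]) (fun x => f (unit_step s + x)) by [].
rewrite /avg /lace_coef sumrN -mulr_sumr exchange_big -mulrBr -sumrB.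
congr (_ * _); apply: eq_bigr => s _; set e := unit_step s.
rewrite add0r {1}/step_weight [count_mem _ _]/= eq_sym (negPf (unit_step_neq0 s)) addn0 expr0 mul1r.
have := lace_expansion n [::] (shift_past e [::]) (fun x => f (e + x)).
rewrite cat0s /shift_past [map _ _]/= sub0r => h.
rewrite -[LHS]/(saw n [:: - e] (fun x => f (e + x))).
rewrite -[LHS](subKr (saw n [::] (fun x => f (e + x)))) h; congr (_ - _).
by apply: eq_bigr => m _; apply: eq_lace => x; apply: eq_walk_sum => _ y; rewrite addrA.
Qed.

Lemma lace_coef0 h : lace_coef 0 h = 0.
Proof. by rewrite /lace_coef big1 // mulr0 oppr0. Qed.

Lemma lace_coef_local m f h : (forall x, (sup_norm x <= m.+1)%N -> f x = h x) ->
  lace_coef m f = lace_coef m h.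
Proof.
move=> fh; congr (- (_ * _)); apply: eq_bigr => s _; apply: lace_local => x xm.
apply: fh; apply: leq_trans (sup_normD _ _) _; rewrite -add1n leq_add //.
exact: sup_norm_unit_step.
Qed.

Lemma lace_coef_dirac m N h : (m < N)%N ->
  lace_coef m h = \sum_(x <- box N) lace_coef m (dirac_at x) * h x.
Proof.
move=> mN; rewrite (@lace_coef_local _ _ (fun x => \sum_(y <- box N) h y * dirac_at y x)).
  rewrite /lace_coef (eq_bigr (fun s => \sum_(y <- box N)
    h y * lace m [::] [:: - unit_step s] (fun x => dirac_at y (unit_step s + x)))) => [|s _].
    rewrite exchange_big /= mulr_sumr -sumrN; apply: eq_bigr => y _.
    by rewrite -mulr_sumr; ring.
  by rewrite lace_sum; apply: eq_bigr => y _; rewrite laceZ.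
by move=> x xn; apply: dirac_decomposition; apply: leq_trans mN.
Qed.

(** That the map permutes the unit steps is stated through sums over them, the form in which the
    averages call for it. *)
Definition cubic_map (g : lattice d -> lattice d) :=
  [/\ forall x y, g (x - y) = g x - g y, injective g &
      forall f, \sum_(s : 'I_d * bool) f (g (unit_step s)) = \sum_s f (unit_step s)].

Lemma lace_cubic_map g m o eta h : cubic_map g ->
  lace m (map g o) (map g eta) h = lace m o eta (h \o g).
Proof.
move=> [gB gi gs]; have g0 : g 0 = 0 by rewrite -{1}(subrr 0) gB subrr.
have gN x : g (- x) = - g x by rewrite -sub0r gB g0 sub0r.
have gD x y : g (x + y) = g x + g y by rewrite -{1}[y]opprK gB gN opprK.
elim: m o eta h => [//|m IH] o eta h /=; congr (_ * _).
pose f e := step_weight e (0 :: map g o) *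
  ((1 - step_weight e (map g eta)) *
     ((m == 0)%:R * h e - lace m [::] (shift_past e (map g o)) (fun x => h (e + x))) +
   step_weight e (map g eta) *
     lace m (shift_past e (map g o)) [seq u - e | u <- map g eta] (fun x => h (e + x))).
rewrite -[LHS]/(\sum_s f (unit_step s)) -gs; apply: eq_bigr => s _; rewrite /f.
set e := unit_step s.
have sw l : step_weight (g e) (map g l) = step_weight e l.
  rewrite /step_weight count_map; congr (_ ^+ _).
  by apply: eq_count => x /=; rewrite (inj_eq gi).
have sh l : [seq u - g e | u <- map g l] = map g [seq u - e | u <- l].
  by rewrite -!map_comp; apply: eq_map => x /=; rewrite gB.
have -> : shift_past (g e) (map g o) = map g (shift_past e o).
  by rewrite /shift_past -sh /= g0.
rewrite -{1}g0 -map_cons !sw sh -[X in lace m X (map g (shift_past e o))]/(map g [::]) !IH.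
congr (_ * (_ * (_ - _) + _ * _)); by apply: eq_lace => x /=; rewrite gD.
Qed.

Lemma lace_coef_cubic_map g m h : cubic_map g -> lace_coef m (h \o g) = lace_coef m h.
Proof.
move=> gc; have [gB gi gs] := gc.
have g0 : g 0 = 0 by rewrite -{1}(subrr 0) gB subrr.
have gN x : g (- x) = - g x by rewrite -sub0r gB g0 sub0r.
have gD x y : g (x + y) = g x + g y by rewrite -{1}[y]opprK gB gN opprK.
congr (- (_ * _)).
rewrite -[RHS](gs (fun e => lace m [::] [:: - e] (fun x => h (e + x)))).
apply: eq_bigr => s _.
rewrite -gN -[[:: g _]]/(map g [:: _]) -[X in lace m X (map _ _)]/(map g [::]) lace_cubic_map //.
by apply: eq_lace => x /=; rewrite gD.
Qed.

Lemma cubic_map_flip i : cubic_map (@flip_coord d i).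
Proof.
split=> [x y||f]; [|exact: inv_inj (flip_coordK i)|].
  by apply/rowP => j; rewrite !mxE; case: (j == i); rewrite ?opprD.
rewrite (sum_steps (fun e => f (flip_coord i e))) (sum_steps f).
apply: eq_bigr => j _; have [->|ji] := eqVneq j i.
  have h b : flip_coord i (unit_step (i, b)) = unit_step (i, ~~ b).
    apply/rowP => k; rewrite !mxE eqxx /=; case: (k == i); rewrite ?mulr0 ?mulr1 //.
    by case: b; rewrite !(expr0, expr1) ?opprK.
  by rewrite !h addrC.
have h b : flip_coord i (unit_step (j, b)) = unit_step (j, b).
  apply/rowP => k; rewrite !mxE eqxx /=; case: eqP => // ->.
  by rewrite eq_sym (negPf ji) mulr0 oppr0.
by rewrite !h.
Qed.

Lemma cubic_map_swap i j : cubic_map (@swap_coord d i j).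
Proof.
split=> [x y||f]; [|exact: inv_inj (swap_coordK i j)|].
  by apply/rowP => k; rewrite !mxE.
rewrite (sum_steps (fun e => f (swap_coord i j e))) (sum_steps f).
rewrite [RHS](reindex_inj (@perm_inj _ (tperm i j))) /=; apply: eq_bigr => k _.
have h b : swap_coord i j (unit_step (k, b)) = unit_step (tperm i j k, b).
  apply/rowP => l; rewrite !mxE eqxx /=; congr (_ * (nat_of_bool _)%:R).
  by rewrite -(inj_eq (@perm_inj _ (tperm i j))) tpermK.
by rewrite !h.
Qed.

Lemma lace_coef_cubic_symmetric m : cubic_symmetric (fun x => lace_coef m (dirac_at x)).
Proof.
have key g : involutive g -> cubic_map g ->
    forall x, lace_coef m (dirac_at (g x)) = lace_coef m (dirac_at x).
  move=> gK gc x; rewrite -(lace_coef_cubic_map _ _ gc); apply: lace_coef_local => y _ /=.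
  by rewrite /dirac_at (inj_eq (inv_inj gK)).
split=> i => [x|j x]; apply: key.
- exact: flip_coordK.
- exact: cubic_map_flip.
- exact: swap_coordK.
- exact: cubic_map_swap.
Qed.

End Walks.

(** * Rearrangement of truncated Cauchy products *)

Section TriangularSums.
Context {R : numDomainType}.

Lemma triangular_exchange (G : nat -> nat -> R) M :
  \sum_(m < M.+1) \sum_(t < m) G m t = \sum_(t < M) \sum_(k < M - t) G (t.+1 + k)%N t.
Proof.
elim: M => [|M IH]; first by rewrite big_ord_recr /= !big_ord0 addr0.
rewrite big_ord_recr /= IH !big_ord_recr /= subSnn big_ord1 addn0 addrA; congr (_ + _).
rewrite -big_split /=; apply: eq_bigr => t _.
have tM : (t <= M)%N by apply: ltnW.
by rewrite (subSn tM) big_ord_recr /= addSn subnKC.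
Qed.

Lemma triangular_le_product (G : nat -> nat -> R) M : (forall s r, 0 <= G s r) ->
  \sum_(t < M) \sum_(s < t.+1) G s (t.+1 - s)%N <= \sum_(s < M) \sum_(r < M.+1) G s r.
Proof.
move=> G0; have -> : \sum_(t < M) \sum_(s < t.+1) G s (t.+1 - s)%N =
    \sum_(m < M.+1) \sum_(s < m) G s (m - s)%N.
  by rewrite [RHS]big_ord_recl /= big_ord0 add0r.
rewrite (triangular_exchange (fun m s => G s (m - s)%N)); apply: ler_sum => s _.
rewrite [leRHS]big_ord_recl -[leLHS]add0r lerD //.
rewrite (eq_bigr (fun k : 'I__ => G s k.+1)) => [|k _]; last by rewrite addSnnS addKn.
rewrite /bump /= -(big_mkord xpredT (fun k => G s k.+1)) -(big_mkord xpredT (fun k => G s (1 + k)%N)).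
by rewrite [leRHS](big_cat_nat _ (leq_subr s M)) //= lerDl sumr_ge0.
Qed.

End TriangularSums.

(** * Monotonicity in the past and first-contact bounds *)

Section LaceBounds.
Context {R : realType} {d : nat} (beta : R).
Hypothesis beta01 : 0 <= beta <= 1.
Implicit Types (x y u v e : lattice d) (o eta : seq (lattice d)) (f g h : lattice d -> R).
Implicit Types (F G : seq (lattice d) -> lattice d -> R).

Let b0 : 0 <= beta. Proof. by case/andP: beta01. Qed.
Let b1 : beta <= 1. Proof. by case/andP: beta01. Qed.

Lemma step_weight_ge0 e o : 0 <= step_weight beta e o.
Proof. by rewrite exprn_ge0 // subr_ge0. Qed.

Lemma step_weight_le1 e o : step_weight beta e o <= 1.
Proof. by rewrite exprn_ile1 ?subr_ge0 // gerBl. Qed.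

Lemma step_weightN_le e o : 1 - step_weight beta e o <= beta * (count_mem e o)%:R.
Proof.
rewrite /step_weight; elim: (count_mem e o) => [|n IH]; first by rewrite expr0 subrr mulr0.
rewrite exprS mulrBl mul1r opprB addrCA addrC -natr1 mulrDr mulr1 lerD //.
by rewrite ler_piMr // exprn_ile1 ?subr_ge0 // gerBl.
Qed.

Lemma ler_walk_sum n o F G : (forall o' x, F o' x <= G o' x) ->
  walk_sum beta n o F <= walk_sum beta n o G.
Proof.
elim: n o F G => [|n IH] o F G FG /=; first exact: FG.
rewrite ler_wpM2l ?invr_ge0 // ler_sum // => s _.
by rewrite ler_wpM2l ?step_weight_ge0 // IH.
Qed.

Lemma walk_sum_ge0 n o F : (forall o' x, 0 <= F o' x) -> 0 <= walk_sum beta n o F.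
Proof.
elim: n o F => [|n IH] o F F0 /=; first exact: F0.
by rewrite mulr_ge0 ?invr_ge0 // sumr_ge0 // => s _; rewrite mulr_ge0 ?step_weight_ge0 ?IH.
Qed.

Lemma saw_ge0 n o f : (forall x, 0 <= f x) -> 0 <= saw beta n o f.
Proof. by move=> f0; apply: walk_sum_ge0. Qed.

Lemma saw_past_le n o1 o2 f : (forall x, 0 <= f x) ->
  (forall x, (count_mem x o1 <= count_mem x o2)%N) -> saw beta n o2 f <= saw beta n o1 f.
Proof.
move=> f0; rewrite /saw; elim: n o1 o2 f f0 => [//|n IH] o1 o2 f f0 h /=.
rewrite ler_wpM2l ?invr_ge0 // ler_sum // => s _; set e := unit_step s.
have h' x : (count_mem x (0%R :: o1) <= count_mem x (0%R :: o2))%N by rewrite /= leq_add2l.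
apply: ler_pM; rewrite ?step_weight_ge0 ?walk_sum_ge0 //.
  by rewrite ler_wiXn2l ?subr_ge0 // gerBl.
apply: IH => // x.
have cE o : count_mem x (shift_past e o) = count_mem (x + e) (0%R :: o).
  rewrite /shift_past count_map; apply: eq_count => y /=.
  by rewrite subr_eq.
by rewrite !cE.
Qed.

Lemma saw_le_free n o f : (forall x, 0 <= f x) -> saw beta n o f <= saw beta n [::] f.
Proof. by move=> f0; apply: saw_past_le. Qed.

Lemma walk_sumS n o F : walk_sum beta n.+1 o F = (2 * d)%:R^-1 * \sum_(s : 'I_d * bool)
  step_weight beta (unit_step s) (0 :: o) *
  walk_sum beta n (shift_past (unit_step s) o) (fun o' x => F o' (unit_step s + x)).
Proof. by []. Qed.

Lemma sawS n o f : saw beta n.+1 o f = (2 * d)%:R^-1 * \sum_(s : 'I_d * bool)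
  step_weight beta (unit_step s) (0 :: o) *
  saw beta n (shift_past (unit_step s) o) (fun x => f (unit_step s + x)).
Proof. by []. Qed.

(** The recursion is followed up to the contact with [eta] at step t + 1. The weights for avoiding
    [eta] before it are bounded by 1, the contact costs at most [beta] times the multiplicity, and
    the past accumulated so far becomes the obstacle of the rest. *)
Lemma lace_unroll m o eta h :
  `|lace beta m o eta h| <= \sum_(t < m) walk_sum beta t.+1 o (fun o' x =>
     beta * (count_mem x eta)%:R *
       ((m == t.+1)%:R * `|h x| + `|lace beta (m - t.+1) [::] o' (fun y => h (x + y))|)).
Proof.
elim: m o eta h => [|m IH] o eta h; first by rewrite big_ord0 normr0.
under [leRHS]eq_bigr do rewrite walk_sumS.
rewrite [lace _ _ _ _ _]/= normrM ger0_norm ?invr_ge0 // -mulr_sumr ler_wpM2l ?invr_ge0 //.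
rewrite exchange_big; apply: le_trans (ler_norm_sum _ _ _) _; apply: ler_sum => s _.
set e := unit_step s; set w := step_weight _ _ (_ :: o); set q := step_weight _ _ eta.
rewrite normrM ger0_norm ?step_weight_ge0 // -mulr_sumr ler_wpM2l ?step_weight_ge0 //.
rewrite big_ord_recl [X in _ <= X + _]/=; apply: le_trans (ler_normD _ _) _; apply: lerD.
  rewrite eqSS subSS subn0 addr0 normrM ger0_norm ?subr_ge0 ?step_weight_le1 //.
  apply: ler_pM; rewrite ?subr_ge0 ?step_weight_le1 ?step_weightN_le //.
  apply: le_trans (ler_normB _ _) _; rewrite normrM ger0_norm //.
rewrite normrM ger0_norm ?step_weight_ge0 //.
apply: le_trans (ler_piMl _ (step_weight_le1 _ _)) _; first exact: normr_ge0.
apply: le_trans (IH _ _ _) _; apply: ler_sum => t _.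
rewrite le_eqVlt; apply/orP; left; apply/eqP.
apply: (@eq_walk_sum R d beta t.+1) => o' x.
rewrite -[RHS]/(beta * (count_mem (e + x) eta)%:R * ((m.+1 == t.+2)%:R * `|h (e + x)|
  + `|lace beta (m.+1 - t.+2) [::] o' (fun y => h (e + x + y))|)) eqSS subSS.
have -> : count_mem (e + x) eta = count_mem x [seq u - e | u <- eta].
  by rewrite count_map; apply: eq_count => y /=; rewrite subr_eq addrC.
by congr (_ * (_ + `|_|)); apply: eq_lace => y; rewrite addrA.
Qed.

(* Cutting a walk at a marked earlier vertex. *)
Lemma walk_sum_marked_le t o f g : (forall x, 0 <= f x) -> (forall x, 0 <= g x) ->
  walk_sum beta t o (fun o' x => f x * \sum_(u <- o') g u) <=
  \sum_(u <- o) saw beta t o (fun x => f x * g (u - x)) +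
  \sum_(s < t) saw beta s o (fun x => saw beta (t - s) [::] (fun y => f (x + y) * g (- y))).
Proof.
elim: t o f => [|t IH] o f f0 g0.
  rewrite big_ord0 addr0 /saw /= mulr_sumr.
  by rewrite (eq_bigr (fun u => f 0 * g (u - 0))) // => u _; rewrite subr0.
rewrite big_ord_recl addrCA.
have -> : saw beta 0 o (fun x => saw beta (t.+1 - ord0) [::] (fun y => f (x + y) * g (- y))) =
    saw beta t.+1 [::] (fun y => f y * g (- y)).
  transitivity (saw beta t.+1 [::] (fun y => f (0 + y) * g (- y))); first by [].
  by apply: eq_saw => y; rewrite add0r.
apply: (@le_trans _ _ (saw beta t.+1 o (fun y => f y * g (- y)) +
   (\sum_(u <- o) saw beta t.+1 o (fun x => f x * g (u - x)) +
    \sum_(s < t) saw beta s.+1 o (fun x => saw beta (t - s) [::] (fun y => f (x + y) * g (- y))))));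
  last by rewrite lerD2r saw_le_free // => x; rewrite mulr_ge0.
rewrite walk_sumS sawS.
under [X in _ <= _ + (X + _)]eq_bigr do rewrite sawS.
under [X in _ <= _ + (_ + X)]eq_bigr do rewrite sawS.
rewrite -!mulr_sumr -!mulrDr ler_wpM2l ?invr_ge0 //.
rewrite [X in _ <= _ + (X + _)]exchange_big [X in _ <= _ + (_ + X)]exchange_big.
rewrite -!big_split /=; apply: ler_sum => s _; set e := unit_step s.
rewrite -!mulr_sumr -!mulrDr ler_wpM2l ?step_weight_ge0 //.
apply: le_trans (IH _ _ _ g0) _; first by move=> x; apply: f0.
rewrite addrA; apply: lerD.
  rewrite /shift_past big_map big_cons; apply: lerD.
    by rewrite le_eqVlt; apply/orP; left; apply/eqP; apply: eq_saw => x; rewrite sub0r opprD.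
  apply: ler_sum => u _.
  by rewrite le_eqVlt; apply/orP; left; apply/eqP; apply: eq_saw => x; rewrite opprD addrA.
apply: ler_sum => r _; rewrite le_eqVlt; apply/orP; left; apply/eqP.
by apply: eq_saw => x; apply: eq_saw => y; rewrite addrA.
Qed.

End LaceBounds.

(** * Diagrammatic bounds *)

Section LaceConvergence.
Context {R : realType} {d : nat} (beta z M0 : R) (Gam : lattice d -> R).
Hypothesis beta01 : 0 <= beta <= 1.
Hypothesis z0 : 0 <= z.
Hypothesis Gam0 : forall x, 0 <= Gam x.
Hypothesis GamN : forall x, Gam (- x) = Gam x.
Hypothesis saw_le_Gam : forall N x,
  \sum_(n < N) z ^+ n * saw beta n [::] (dirac_at x) <= Gam x.
Hypothesis square_diagram : forall (l : seq (lattice d)) u v, uniq l ->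
  \sum_(x <- l) Gam x * Gam (u - x) * Gam (v - x) ^+ 2 <= M0 * (Gam v * Gam (v - u)).
Hypothesis small : 2 * beta * M0 <= 1.
Implicit Types (x y u v : lattice d) (o eta : seq (lattice d)) (f g : lattice d -> R).

Let b0 : 0 <= beta. Proof. by case/andP: beta01. Qed.

Let zn n : 0 <= z ^+ n. Proof. exact: exprn_ge0. Qed.

Let dirac0 x y : 0 <= dirac_at x y :> R. Proof. by rewrite /dirac_at. Qed.

(** Supersolution of the recursion in [lace_unroll] for one obstacle point [u]. The Dirac term is a
    lace that ends at its first contact; [beta ^+ 2 * (Gam v * Gam (v - u) ^+ 2)] is the next
    diagram, and its factor 2 leaves room for all the later ones. *)
Definition lace_majorant u v : R :=
  beta * Gam u * dirac_at u v + 2 * beta ^+ 2 * (Gam v * Gam (v - u) ^+ 2).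

Lemma lace_majorant_ge0 u v : 0 <= lace_majorant u v.
Proof. by rewrite addr_ge0 ?mulr_ge0 ?exprn_ge0. Qed.

Lemma count_mem_dirac x o : (count_mem x o)%:R = \sum_(u <- o) dirac_at u x :> R.
Proof.
rewrite -sum1_count natr_sum big_mkcond /=; apply: eq_bigr => u _.
by rewrite /dirac_at eq_sym; case: eqP.
Qed.

Lemma dirac_mulr f u x : dirac_at u x * f x = dirac_at u x * f u :> R.
Proof. by rewrite /dirac_at; case: eqP => [->|_] //; rewrite !mul0r. Qed.

Lemma saw_series_le N n f : (forall x, 0 <= f x) -> (n <= N)%N ->
  \sum_(s < n) z ^+ s * saw beta s [::] f <= \sum_(x <- box N) Gam x * f x.
Proof.
move=> f0 nN.
rewrite (eq_bigr (fun s : 'I_n => \sum_(x <- box N) z ^+ s * saw beta s [::] (dirac_at x) * f x)).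
  rewrite exchange_big /=; apply: ler_sum => x _.
  by rewrite -mulr_suml ler_wpM2r // saw_le_Gam.
move=> s _; rewrite (@saw_dirac _ _ _ s N) ?mulr_sumr.
  by apply: eq_bigr => x _; rewrite mulrA.
by apply: leq_trans nN; apply: ltnW.
Qed.

(** One turn of the recursion. The Dirac part of the majorant yields half of the right-hand side;
    the other part yields the square diagram, which [small] reduces to the second half. *)
Lemma majorant_step_le l u v : uniq l ->
  \sum_(x <- l) Gam x * (Gam (u - x) * lace_majorant (x - u) (v - u)) <=
    2 * beta * (Gam v * Gam (v - u) ^+ 2).
Proof.
move=> ul; rewrite (eq_bigr (fun x => beta * (Gam v * Gam (v - u) ^+ 2) * dirac_at v x
    + 2 * beta ^+ 2 * Gam (v - u) * (Gam x * Gam (u - x) * Gam (v - x) ^+ 2))); last first.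
  move=> x _; rewrite /lace_majorant mulrDr mulrDr; congr (_ + _); last first.
    by rewrite opprB addrA subrK; ring.
  have -> : dirac_at (x - u) (v - u) = dirac_at v x :> R.
    by rewrite /dirac_at (inj_eq (addIr _)) eq_sym.
  rewrite -[u - x]opprB GamN; case: (eqVneq x v) => [->|xv]; first ring.
  by rewrite /dirac_at (negPf xv) !mulr0.
rewrite big_split /= -!mulr_sumr; have G2 : 0 <= Gam v * Gam (v - u) ^+ 2.
  by rewrite mulr_ge0 ?exprn_ge0.
have h1 : \sum_(x <- l) dirac_at v x <= 1 :> R.
  have -> : \sum_(x <- l) dirac_at v x = (count_mem v l)%:R :> R.
    by rewrite count_mem_dirac; apply: eq_bigr => x _; rewrite /dirac_at eq_sym.
  by rewrite count_uniq_mem //; case: (v \in l).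
have h2 := square_diagram u v ul.
have -> : 2 * beta * (Gam v * Gam (v - u) ^+ 2) =
  beta * (Gam v * Gam (v - u) ^+ 2) + beta * (Gam v * Gam (v - u) ^+ 2) by ring.
apply: lerD.
  by rewrite -[leRHS]mulr1 ler_wpM2l // mulr_ge0.
apply: le_trans (ler_wpM2l _ h2) _; first by rewrite !mulr_ge0 ?exprn_ge0.
have -> : 2 * beta ^+ 2 * Gam (v - u) * (M0 * (Gam v * Gam (v - u))) =
   (beta * (Gam v * Gam (v - u) ^+ 2)) * (2 * beta * M0) by ring.
by rewrite ler_piMr // mulr_ge0.
Qed.

(** Strong induction on the number of terms: after the first contact fewer terms remain, and the
    hypothesis is applied to them with the path just walked as obstacle. *)
Lemma lace_series_le M eta v :
  \sum_(m < M) z ^+ m * `|lace beta m [::] eta (dirac_at v)| <=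
    \sum_(u <- eta) lace_majorant u v.
Proof.
elim/ltn_ind: M eta v => -[|M] IH eta v.
  by rewrite big_ord0 sumr_ge0 // => u _; apply: lace_majorant_ge0.
pose T t x o : R := dirac_at v x +
  \sum_(k < M - t) z ^+ k * `|lace beta k [::] o (dirac_at (v - x))|.
apply: (@le_trans _ _ (\sum_(t < M) z ^+ t.+1 * walk_sum beta t.+1 [::] (fun o x =>
    beta * (count_mem x eta)%:R * T t x o))).
  pose W m t := z ^+ m * walk_sum beta t.+1 [::] (fun o x => beta * (count_mem x eta)%:R *
    ((m == t.+1)%:R * dirac_at v x + `|lace beta (m - t.+1) [::] o (dirac_at (v - x))|)).
  apply: (@le_trans _ _ (\sum_(m < M.+1) \sum_(t < m) W m t)).
    apply: ler_sum => m _; rewrite -mulr_sumr ler_wpM2l //.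
    apply: le_trans (lace_unroll beta01 _ _ _ _) _; apply: ler_sum => t _.
    rewrite le_eqVlt; apply/orP; left; apply/eqP; apply: (@eq_walk_sum R d beta t.+1) => o x.
    rewrite /= [`|dirac_at v x|]ger0_norm //; congr (_ * (_ + `|_|)).
    by apply: eq_lace => y; rewrite /dirac_at [in RHS]eq_sym subr_eq eq_sym addrC.
  rewrite (triangular_exchange W) le_eqVlt; apply/orP; left; apply/eqP.
  apply: eq_bigr => t _; rewrite /W.
  under eq_bigr do rewrite -walk_sumZ.
  rewrite -walk_sumZ -(walk_sum_sum beta _ _ _ _).
  apply: (@eq_walk_sum R d beta t.+1) => o x.
  have tM : (0 < M - t)%N by rewrite subn_gt0.
  rewrite (eq_bigr (fun k : 'I_(M - t) => z ^+ t.+1 * (beta * (count_mem x eta)%:R) *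
     ((k == 0 :> nat)%:R * dirac_at v x + z ^+ k * `|lace beta k [::] o (dirac_at (v - x))|))).
    rewrite -mulr_sumr big_split -[LHS]mulrA /T; congr (_ * (_ * (_ + _))).
    rewrite -(prednK tM) big_ord_recl /= mul1r big1 ?addr0 // => k _.
    by rewrite mul0r.
  move=> k _; rewrite addKn -[X in (_ == X)%:R]addn0 eqn_add2l exprD.
  by case: (val k) => [|k']; rewrite ?expr0 ?mul0r /=; ring.
apply: (@le_trans _ _ (\sum_(t < M) z ^+ t.+1 * walk_sum beta t.+1 [::] (fun o x =>
    \sum_(u <- eta) beta * (dirac_at u v * dirac_at u x +
       dirac_at u x * \sum_(w <- o) lace_majorant w (v - u))))).
  apply: ler_sum => t _; rewrite ler_wpM2l // (ler_walk_sum beta01 t.+1) // => o x.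
  rewrite count_mem_dirac -mulrA mulr_suml mulr_sumr; apply: ler_sum => u _.
  rewrite ler_wpM2l // /T mulrDr; apply: lerD.
    by rewrite dirac_mulr mulrC /dirac_at [u == v]eq_sym.
  rewrite (dirac_mulr (fun x => \sum_(k < M - t) _)) ler_wpM2l //; apply: IH.
  by rewrite ltnS leq_subr.
under eq_bigr do rewrite (walk_sum_sum beta) mulr_sumr.
rewrite exchange_big; apply: ler_sum => u _.
pose a t := z ^+ t * saw beta t [::] (dirac_at u).
(* The path to the contact [u] is cut at an earlier vertex x, which serves as obstacle for the lace
   that continues from [u]. *)
pose b s r := z ^+ s * saw beta s [::] (fun x => z ^+ r * saw beta r [::] (dirac_at (u - x))
   * lace_majorant (x - u) (v - u)).
have a_ge0 t : 0 <= a t by rewrite mulr_ge0 // (saw_ge0 beta01) // => x; apply: dirac0.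
have b_ge0 s r : 0 <= b s r.
  rewrite mulr_ge0 // (saw_ge0 beta01) // => x.
  apply: mulr_ge0; last exact: lace_majorant_ge0.
  by apply: mulr_ge0 => //; apply: (saw_ge0 beta01) => y; apply: dirac0.
apply: (@le_trans _ _ (beta * (dirac_at u v * \sum_(t < M) a t.+1 +
    \sum_(t < M) \sum_(s < t.+1) b s (t.+1 - s)%N))).
  rewrite [X in _ <= _ * (X + _)]mulr_sumr -big_split mulr_sumr; apply: ler_sum => t _.
  rewrite walk_sumZ walk_sumD walk_sumZ mulrCA ler_wpM2l // mulrDr; apply: lerD.
    by rewrite mulrCA.
  apply: le_trans (ler_wpM2l (zn _) (walk_sum_marked_le beta01 t.+1 [::] (f := dirac_at u)
    (g := fun w => lace_majorant w (v - u)) _ _)) _ => // [w|]; first exact: lace_majorant_ge0.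
  rewrite big_nil add0r mulr_sumr; apply: ler_sum => s _.
  rewrite le_eqVlt; apply/orP; left; apply/eqP; rewrite /b -!sawZ.
  apply: eq_saw => x; rewrite -{1}(subnKC (ltnW (ltn_ord s))) exprD -!mulrA; congr (_ * (_ * _)).
  rewrite mulrC -sawZ; apply: eq_saw => y.
  have -> : dirac_at u (x + y) = dirac_at (u - x) y :> R.
    by rewrite /dirac_at [in RHS]eq_sym subr_eq eq_sym addrC.
  by rewrite (dirac_mulr (fun y => lace_majorant (- y) (v - u))) opprB mulrC.
have Gu : \sum_(t < M) a t.+1 <= Gam u.
  apply: le_trans (saw_le_Gam M.+1 u).
  by rewrite [leRHS]big_ord_recl lerDr; apply: (a_ge0 0%N).
have -> : lace_majorant u v = beta * (dirac_at u v * Gam u + 2 * beta * (Gam v * Gam (v - u) ^+ 2)).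
  by rewrite /lace_majorant; ring.
rewrite ler_wpM2l // lerD ?ler_wpM2l //.
apply: le_trans (triangular_le_product M b_ge0) _.
apply: le_trans (majorant_step_le u v (box_uniq M)).
apply: le_trans (saw_series_le (n := M) _ (leqnn M)) => [|x]; last first.
  by rewrite mulr_ge0 ?lace_majorant_ge0.
apply: ler_sum => s _; rewrite /b -mulr_sumr ler_wpM2l // -saw_sum.
apply: (ler_walk_sum beta01) => _ x; rewrite -mulr_suml ler_wpM2r ?lace_majorant_ge0 //.
Qed.

End LaceConvergence.

(** * Diagrams of the Green function and truncation errors *)

Section Diagrams.
Context {R : realType} {d : nat}.
Implicit Types (x y u v : lattice d) (l : seq (lattice d)) (A k K : R).

Lemma green_le_of_sup_norm A k K : (4 < d)%N -> green_estimates d A k K ->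
  exists2 M : R, 0 <= M &
    forall x y, (sup_norm y <= 2 * sup_norm x)%N -> green x <= M * green y.
Proof.
move=> hd GE; have A1 : 1 <= A by apply: le_trans (radius_ge15 GE); rewrite ler1n.
have d0 : (0 < d)%N by apply: leq_trans hd.
have K0 := ltW (green_upper_gt0 GE); have k0 := green_lower_gt0 GE.
exists (K * (2 * d)%:R ^+ (d - 2) / k) => [|x y xy].
  by rewrite !mulr_ge0 ?exprn_ge0 ?invr_ge0 // ltW.
apply: le_trans (green_upper GE x) _.
rewrite -[leRHS]mulrA -[leRHS]mulrA ler_wpM2l //.
apply: le_trans (phi_comparable (d - 2) d0 A1 _ xy) _ => //.
by rewrite ler_wpM2l ?exprn_ge0 // ler_pdivlMl // (green_lower GE).
Qed.

(** The one of x and y farther from the origin has at least half the sup norm of x + y, so its C is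
    at most M C(x + y). *)
Lemma green_three_point A k K : (4 < d)%N -> green_estimates d A k K ->
  exists2 M : R, 0 <= M & forall x y,
    green x * green y <= M * green (x + y) * (green x + green y).
Proof.
move=> hd GE; have [M M0 hM] := green_le_of_sup_norm hd GE.
have C0 x : 0 <= green x :> R by apply: green_ge0 (green_part_bounded GE) x.
exists M => // x y; have [xy|/ltnW yx] := leqP (sup_norm x) (sup_norm y).
  have h : green y <= M * green (x + y).
    apply: hM; apply: leq_trans (sup_normD _ _) _.
    by rewrite mul2n -addnn leq_add2r.
  rewrite mulrC; apply: ler_pM => //.
  by rewrite lerDl.
have h : green x <= M * green (x + y).
  apply: hM; apply: leq_trans (sup_normD _ _) _.
  by rewrite mul2n -addnn leq_add2l.
by apply: ler_pM => //; rewrite lerDr.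
Qed.

(** The bubble condition: one of the two factors is at most K phi_3, because 3 <= d - 2. *)
Lemma green_bubble_le A k K l y : (4 < d)%N -> green_estimates d A k K -> uniq l ->
  \sum_(x <- l) green (y - x) ^+ 2 <= K * K.
Proof.
move=> hd GE ul; have A1 : 1 <= A by apply: le_trans (radius_ge15 GE); rewrite ler1n.
have K0 := ltW (green_upper_gt0 GE).
have C0 x : 0 <= green x :> R by apply: green_ge0 (green_part_bounded GE) x.
have d3 : (3 <= d - 2)%N by move: hd; clear; lia.
pose l' := [seq y - x | x <- l].
have ul' : uniq l' by rewrite map_inj_uniq // => a b /addrI /oppr_inj.
apply: le_trans (ler_wpM2l K0 (green_conv_phi3 GE 0 ul')); rewrite mulr_sumr big_map.
apply: ler_sum => x _; rewrite sub0r phiN expr2 mulrCA ler_wpM2l //.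
apply: le_trans (green_upper GE _) _; rewrite ler_wpM2l //; exact: phi_decr.
Qed.

(** The three-point inequality for the pairs (x, v - x) and (u - x, x - v) extracts C(v) C(v - u);
    what is left is bounded by sums of squares, that is by bubbles. *)
Lemma green_square_diagram A k K : (4 < d)%N -> green_estimates d A k K ->
  exists2 M : R, 0 <= M & forall l u v, uniq l ->
    \sum_(x <- l) green x * green (u - x) * green (v - x) ^+ 2 <=
      M * (green v * green (v - u)).
Proof.
move=> hd GE; have [M M0 hM] := green_three_point hd GE.
have C0 x : 0 <= green x :> R by apply: green_ge0 (green_part_bounded GE) x.
exists (M ^+ 2 * (4 * (K * K))) => [|l u v ul].
  by rewrite !mulr_ge0 ?exprn_ge0 // ltW // (green_upper_gt0 GE).
apply: (@le_trans _ _ (\sum_(x <- l) M ^+ 2 * (green v * green (v - u)) *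
   (green (0 - x) ^+ 2 + green (v - x) ^+ 2 + (green (u - x) ^+ 2 + green (v - x) ^+ 2)))).
  apply: ler_sum => x _; rewrite sub0r greenN.
  have h1 := hM x (v - x); rewrite (_ : x + (v - x) = v) in h1; last by rewrite addrC subrK.
  have h2 := hM (u - x) (x - v).
  have e1 : green (x - v) = green (v - x) :> R by rewrite -greenN opprB.
  have e2 : green (u - x + (x - v)) = green (v - u) :> R by rewrite addrA subrK -greenN opprB.
  rewrite e1 e2 in h2.
  have := C0 x; have := C0 (u - x); have := C0 (v - x); have := C0 v; have := C0 (v - u).
  move: M0 h1 h2.
  move: (green x) (green (u - x)) (green (v - x)) (green v) (green (v - u)) => a c b p q.
  move=> M0 h1 h2 q0 p0 b0 c0 a0.
  apply: (@le_trans _ _ ((M * p * (a + b)) * (M * q * (c + b)))).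
    have -> : a * c * b ^+ 2 = (a * b) * (c * b) by ring.
    by apply: ler_pM => //; apply: mulr_ge0.
  have -> : M * p * (a + b) * (M * q * (c + b)) = M ^+ 2 * (p * q) * ((a + b) * (c + b)) by ring.
  rewrite ler_wpM2l ?mulr_ge0 ?exprn_ge0 //.
  have := sqr_ge0 (a - b); have := sqr_ge0 (c - b); have := sqr_ge0 (a - c).
  by clear; rewrite !expr2; nra.
rewrite -mulr_sumr !big_split /=.
have -> : M ^+ 2 * (4 * (K * K)) * (green v * green (v - u)) =
  M ^+ 2 * (green v * green (v - u)) * (K * K + K * K + (K * K + K * K)) by ring.
rewrite ler_wpM2l ?mulr_ge0 ?exprn_ge0 //.
by do 3?[apply: lerD]; apply: (green_bubble_le _ hd GE).
Qed.

Lemma nondecreasing_cauchy (u : nat -> R) (b e : R) : 0 < e ->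
  (forall m n, (m <= n)%N -> u m <= u n) -> (forall n, u n <= b) ->
  exists N, forall m n, (N <= m)%N -> u n - u m <= e.
Proof.
move=> e0 un ub.
have hs : has_sup (range u).
  by split; [exists (u 0%N); exists 0%N | exists b => _ [n _ <-]].
have [_ [N _ <-] hN] := sup_adherent e0 hs.
exists N => m n Nm; rewrite lerBlDr.
have : u n <= sup (range u) by apply: sup_upper_bound => //; exists n.
by move: hN (un _ _ Nm); clear; lra.
Qed.

Lemma sum_ord_split (F : nat -> R) m n : (m <= n)%N ->
  \sum_(i < n) F i = \sum_(i < m) F i + \sum_(i < n - m) F (m + i)%N.
Proof. by move=> /subnKC h; rewrite -[in LHS]h big_split_ord. Qed.

(** A bounded monotone [X] has small increments, which settles the terms with [m] below a fixed M1;
    beyond M1 the increments are at most [B] and the tail of [a] is small. *)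
Lemma convolution_remainder_small (X a : nat -> R) (B T e : R) : 0 < e ->
  (forall m n, (m <= n)%N -> X m <= X n) -> (forall n, 0 <= X n <= B) ->
  (forall m, 0 <= a m) -> (forall n, \sum_(m < n) a m <= T) ->
  exists N0, forall N, (N0 <= N)%N ->
    (X N.+1 - X N) + \sum_(m < N) a m * (X N - X (N - m)%N) <= e.
Proof.
move=> e0 Xm XB a0 aT.
have T0 : 0 <= T by apply: le_trans (aT 0%N); rewrite big_ord0.
have B0 : 0 <= B by have /andP[h1 h2] := XB 0%N; apply: le_trans h2.
have D0 : 0 < 1 + T + B by rewrite -addrA ltr_wpDr ?addr_ge0.
pose t := e / (1 + T + B); have t0 : 0 < t by rewrite divr_gt0.
have [N1 h1] := nondecreasing_cauchy t0 Xm (fun n => proj2 (andP (XB n))).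
have am m n : (m <= n)%N -> \sum_(i < m) a i <= \sum_(i < n) a i.
  move=> mn; rewrite -(subnKC mn) big_split_ord /= lerDl.
  by apply: sumr_ge0.
have [M1 h2] := nondecreasing_cauchy t0 am aT.
exists (N1 + M1)%N => N hN.
have -> : e = t * 1 + (t * T + t * B) by rewrite /t; field; rewrite gt_eqF.
apply: lerD; first by rewrite mulr1 h1 // (leq_trans _ hN) // leq_addr.
have M1N : (M1 <= N)%N by apply: leq_trans hN; rewrite leq_addl.
rewrite (sum_ord_split (fun m => a m * (X N - X (N - m)%N)) M1N); apply: lerD.
  apply: le_trans (ler_wpM2l (ltW t0) (aT M1)); rewrite mulr_sumr; apply: ler_sum => m _.
  rewrite mulrC ler_wpM2r // h1 //.
  by move: hN (ltn_ord m); move: (nat_of_ord m) => i; clear; lia.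
apply: (@le_trans _ _ (\sum_(i < N - M1) a (M1 + i)%N * B)).
  apply: ler_sum => i _; rewrite ler_wpM2l //.
  have /andP[_ hx] := XB N; have /andP[hy _] := XB (N - (M1 + i))%N.
  by move: hx hy; clear; lra.
rewrite -mulr_suml ler_wpM2r //.
by have := h2 M1 N (leqnn _); rewrite (sum_ord_split a M1N) addrC addKr.
Qed.

End Diagrams.

(** * Bootstrap *)

Section WalkSeries.
Context {R : realType} {d : nat} (beta z : R).
Hypothesis beta01 : 0 <= beta <= 1.
Hypothesis z0 : 0 <= z.
Implicit Types (x y w : lattice d) (f g : lattice d -> R).

Let zn n : 0 <= z ^+ n. Proof. exact: exprn_ge0. Qed.

(** A Dirac function gives the truncated Green function at z = 2 d lambda, the constant 1 the
    truncated susceptibility. *)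
Definition walk_series N f : R := \sum_(n < N) z ^+ n * saw beta n [::] f.

Lemma eq_walk_series N f g : f =1 g -> walk_series N f = walk_series N g.
Proof. by move=> fg; apply: eq_bigr => n _; congr (_ * _); apply: eq_saw. Qed.

Lemma walk_seriesZ N (c : R) f : walk_series N (fun x => c * f x) = c * walk_series N f.
Proof. by rewrite mulr_sumr; apply: eq_bigr => n _; rewrite sawZ mulrCA. Qed.

Lemma walk_seriesD N f g : walk_series N (fun x => f x + g x) = walk_series N f + walk_series N g.
Proof. by rewrite -big_split; apply: eq_bigr => n _; rewrite sawD mulrDr. Qed.

Lemma walk_seriesB N f g : walk_series N (fun x => f x - g x) = walk_series N f - walk_series N g.
Proof.
rewrite walk_seriesD; congr (_ + _).
by rewrite (@eq_walk_series _ _ (fun x => -1 * g x)) ?walk_seriesZ ?mulN1r // => x; rewrite mulN1r.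
Qed.

Lemma walk_series_sum (I : Type) (r : seq I) N (F : I -> lattice d -> R) :
  walk_series N (fun x => \sum_(i <- r) F i x) = \sum_(i <- r) walk_series N (F i).
Proof. by rewrite exchange_big; apply: eq_bigr => n _; rewrite saw_sum mulr_sumr. Qed.

Lemma ler_walk_series N f g : (forall x, f x <= g x) -> walk_series N f <= walk_series N g.
Proof.
move=> fg; apply: ler_sum => n _; rewrite ler_wpM2l //.
by apply: (ler_walk_sum beta01) => _ x.
Qed.

Lemma walk_series_ge0 N f : (forall x, 0 <= f x) -> 0 <= walk_series N f.
Proof. by move=> f0; apply: sumr_ge0 => n _; rewrite mulr_ge0 // (saw_ge0 beta01). Qed.

Lemma walk_series_nondecr M N f : (forall x, 0 <= f x) -> (M <= N)%N ->
  walk_series M f <= walk_series N f.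
Proof.
move=> f0 MN; rewrite /walk_series (sum_ord_split (fun n => z ^+ n * saw beta n [::] f) MN).
by rewrite lerDl sumr_ge0 // => n _; rewrite mulr_ge0 // (saw_ge0 beta01).
Qed.

Lemma walk_series_increment_le M N f (c : R) : (forall x, 0 <= f x <= c) -> (M <= N)%N ->
  0 <= walk_series N f - walk_series M f <=
    c * (walk_series N (fun=> 1) - walk_series M (fun=> 1)).
Proof.
move=> fc MN; have f0 x : 0 <= f x by have /andP[] := fc x.
rewrite subr_ge0 walk_series_nondecr //= /walk_series.
rewrite (sum_ord_split (fun n => z ^+ n * saw beta n [::] f) MN).
rewrite (sum_ord_split (fun n => z ^+ n * saw beta n [::] (fun=> 1)) MN).
rewrite addrAC subrr add0r addrAC subrr add0r mulr_sumr; apply: ler_sum => n _.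
rewrite mulrCA ler_wpM2l // -sawZ; apply: (ler_walk_sum beta01) => _ x.
by rewrite mulr1; have /andP[] := fc x.
Qed.

Lemma lace_coef_sum (I : Type) (r : seq I) m (F : I -> lattice d -> R) :
  lace_coef beta m (fun x => \sum_(i <- r) F i x) = \sum_(i <- r) lace_coef beta m (F i).
Proof.
rewrite (@lace_coef_dirac _ _ _ m m.+1) //.
under [RHS]eq_bigr do rewrite (@lace_coef_dirac _ _ _ m m.+1) //.
by rewrite exchange_big; apply: eq_bigr => x _; rewrite mulr_sumr.
Qed.

Lemma lace_coefZ m (c : R) f :
  lace_coef beta m (fun x => c * f x) = c * lace_coef beta m f.
Proof.
rewrite (@lace_coef_dirac _ _ _ m m.+1) // [in RHS](@lace_coef_dirac _ _ _ m m.+1) //.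
by rewrite mulr_sumr; apply: eq_bigr => x _; rewrite mulrCA.
Qed.

Lemma lace_coefB m f g :
  lace_coef beta m (fun x => f x - g x) = lace_coef beta m f - lace_coef beta m g.
Proof.
rewrite !(@lace_coef_dirac _ _ _ m m.+1) // -sumrB.
by apply: eq_bigr => x _; rewrite mulrBr.
Qed.

Lemma eq_lace_coef m f g : f =1 g -> lace_coef beta m f = lace_coef beta m g.
Proof. by move=> fg; apply: lace_coef_local => x _. Qed.

Lemma lace_coef_le m f : `|lace_coef beta m f| <=
  \sum_(x <- box m.+1) `|lace_coef beta m (dirac_at x)| * `|f x|.
Proof.
rewrite (@lace_coef_dirac _ _ _ m m.+1) //; apply: le_trans (ler_norm_sum _ _ _) _.
by apply: ler_sum => x _; rewrite normrM.
Qed.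

Lemma walk_series_recursion N f : walk_series N.+1 f = f 0 +
  z * avg (fun x => walk_series N (fun y => f (x + y))) 0 +
  \sum_(m < N) z ^+ m.+1 * lace_coef beta m (fun x => walk_series (N - m) (fun y => f (x + y))).
Proof.
rewrite /walk_series big_ord_recl expr0 mul1r -addrA; congr (_ + _).
pose G n m := z ^+ n * lace_coef beta m (fun x => saw beta (n.-1 - m) [::] (fun y => f (x + y))).
have step n : saw beta n.+1 [::] f = avg (fun x => saw beta n [::] (fun y => f (x + y))) 0
    + \sum_(m < n.+1) lace_coef beta m (fun x => saw beta (n - m) [::] (fun y => f (x + y))).
  by rewrite saw_recursion [in RHS]big_ord_recl lace_coef0 add0r.
transitivity (z * \sum_(n < N) z ^+ n * avg (fun x => saw beta n [::] (fun y => f (x + y))) 0 +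
   \sum_(n < N.+1) \sum_(m < n) G n m).
  rewrite [X in _ + X]big_ord_recl [X in _ + (X + _)]big_ord0 add0r mulr_sumr -big_split.
  apply: eq_bigr => n _; rewrite -[nat_of_ord (lift _ _)]/n.+1 step mulrDr exprS -mulrA.
  by congr (_ + _); rewrite mulr_sumr; apply: eq_bigr => m _; rewrite /G exprS.
rewrite triangular_exchange; congr (_ + _).
  congr (_ * _); rewrite -[RHS]/(avg (fun x => \sum_(n < N) z ^+ n * saw beta n [::] (fun y => f (x + y))) 0).
  by rewrite avg_sum; apply: eq_bigr => n _; rewrite avgZ.
apply: eq_bigr => m _; rewrite lace_coef_sum mulr_sumr; apply: eq_bigr => k _.
rewrite lace_coefZ mulrA -exprD /G; congr (_ * _).
by apply: eq_lace_coef => x; rewrite addSn /= addKn.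
Qed.

Definition lace_kernel N x : R := \sum_(m < N) z ^+ m.+1 * lace_coef beta m (dirac_at x).

Lemma lace_kernel_sum N g :
  \sum_(m < N) z ^+ m.+1 * lace_coef beta m g = \sum_(x <- box N) lace_kernel N x * g x.
Proof.
under [RHS]eq_bigr do rewrite mulr_suml.
rewrite exchange_big; apply: eq_bigr => m _ /=.
rewrite (@lace_coef_dirac _ _ _ m N) // mulr_sumr.
by apply: eq_bigr => x _; rewrite mulrA.
Qed.

Lemma lace_kernel_cubic_symmetric N : cubic_symmetric (lace_kernel N).
Proof.
by split=> [i x|i j x]; apply: eq_bigr => m _; have [h1 h2] := @lace_coef_cubic_symmetric R d beta m;
  rewrite ?(h1 i x) ?(h2 i j x).
Qed.

Section Identity.
Variable C : lattice d -> R.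
Hypothesis C_harmonic : forall x, C x = dirac_at 0 x + avg C x.

Definition potential N y : R := walk_series N (fun w => C (y - w)).

Lemma potential_laplacian N y :
  potential N y - avg (potential N) y = walk_series N (dirac_at y).
Proof.
have -> : avg (potential N) y = walk_series N (fun w => avg C (y - w)).
  rewrite /avg walk_seriesZ walk_series_sum; congr (_ * _); apply: eq_bigr => s _.
  by apply: eq_walk_series => w; rewrite addrAC.
rewrite -walk_seriesB; apply: eq_walk_series => w.
by rewrite {1}C_harmonic addrK /dirac_at subr_eq0 eq_sym.
Qed.

Lemma potential_recursion N y : potential N.+1 y = C y + z * avg (potential N) y +
  \sum_(m < N) z ^+ m.+1 * lace_coef beta m (fun x => potential (N - m) (y - x)).
Proof.
rewrite /potential walk_series_recursion subr0; congr (_ + _ * _ + _).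
  rewrite /avg -(sum_stepsN (fun e => walk_series N (fun w => C (y + e - w)))).
  congr (_ * _); apply: eq_bigr => s _; apply: eq_walk_series => w.
  by rewrite add0r opprD addrA.
apply: eq_bigr => m _; congr (_ * _); apply: eq_lace_coef => x.
by apply: eq_walk_series => w; rewrite opprD addrA.
Qed.

(** This is sigma of the overview, for the kernel P = [lace_kernel]; H is [lace_potential] and V is
    [potential]. *)
Definition lace_variance N : R := \sum_(x <- box N) lace_kernel N x * norm2 x.

Definition lace_potential N y : R :=
  \sum_(x <- box N) lace_kernel N x * (C (y - x) - C y) + lace_variance N * dirac_at 0 y.

(** Error of continuing every lace by [potential N], although only [N - m] terms are left after a
    lace of index [m]. *)
Definition lace_remainder N y : R := \sum_(m < N) z ^+ m.+1 *
  lace_coef beta m (fun x => potential N (y - x) - potential (N - m) (y - x)).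

(* The second moment of the laces is moved to the left-hand side; the factor
   multiplying [potential N y] is the inverse susceptibility. *)
Lemma walk_series_identity N y :
  (z + lace_variance N) * walk_series N (dirac_at y) =
  C y - (1 - z - \sum_(x <- box N) lace_kernel N x) * potential N y
  - (potential N.+1 y - potential N y)
  + walk_series N (fun w => lace_potential N (y - w)) - lace_remainder N y.
Proof.
have e1 : walk_series N (fun w => lace_potential N (y - w)) =
    \sum_(x <- box N) lace_kernel N x * (potential N (y - x) - potential N y)
    + lace_variance N * walk_series N (dirac_at y).
  rewrite walk_seriesD walk_seriesZ walk_series_sum; congr (_ + _ * _); last first.
    by apply: eq_walk_series => w; rewrite /dirac_at subr_eq0 eq_sym.
  apply: eq_bigr => x _; rewrite walk_seriesZ walk_seriesB; congr (_ * (_ - _)).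
  by apply: eq_walk_series => w; rewrite addrAC.
have e2 : lace_remainder N y = \sum_(x <- box N) lace_kernel N x * potential N (y - x)
    - \sum_(m < N) z ^+ m.+1 * lace_coef beta m (fun x => potential (N - m) (y - x)).
  rewrite -(lace_kernel_sum N (fun x => potential N (y - x))) -sumrB.
  by apply: eq_bigr => m _; rewrite lace_coefB mulrBr.
have e3 : \sum_(x <- box N) lace_kernel N x * (potential N (y - x) - potential N y) =
    \sum_(x <- box N) lace_kernel N x * potential N (y - x)
    - (\sum_(x <- box N) lace_kernel N x) * potential N y.
  by rewrite mulr_suml -sumrB; apply: eq_bigr => x _; rewrite mulrBr.
rewrite e1 e2 e3 potential_recursion.
have := potential_laplacian N y.
move: (walk_series N _) (potential N y) (avg _ _) => G V aV h.
rewrite -h; ring.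
Qed.

End Identity.

Definition lace_norm m : R :=
  z ^+ m.+1 * \sum_(x <- @box d m.+1) `|lace_coef beta m (dirac_at x)|.

Lemma lace_remainder_le (C : lattice d -> R) (c : R) N y : (forall x, 0 <= C x <= c) ->
  `|lace_remainder C N y| <= c * \sum_(m < N) lace_norm m *
    (walk_series N (fun=> 1) - walk_series (N - m) (fun=> 1)).
Proof.
move=> Cc; apply: le_trans (ler_norm_sum _ _ _) _; rewrite mulr_sumr.
apply: ler_sum => m _; rewrite normrM ger0_norm // /lace_norm -!mulrA mulrCA ler_wpM2l //.
apply: le_trans (lace_coef_le _ _) _; rewrite mulr_suml mulr_sumr; apply: ler_sum => x _.
rewrite mulrCA ler_wpM2l //.
have /andP[h1 h2] := @walk_series_increment_le (N - m) N (fun w => C (y - x - w)) c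
  (fun w => Cc (y - x - w)) (leq_subr _ _).
by rewrite ger0_norm.
Qed.

(** The recursion for the constant function 1. It makes kappa times the susceptibility equal to 1 up
    to truncation, which determines the sign of kappa. *)
Lemma susceptibility_identity N (X := fun n => walk_series n (fun=> 1 : R)) : (0 < d)%N ->
  `|(1 - z - \sum_(x <- box N) lace_kernel N x) * X N - 1| <=
    (X N.+1 - X N) + \sum_(m < N) lace_norm m * (X N - X (N - m)%N).
Proof.
move=> d0; have Xm n : X n <= X n.+1 by apply: walk_series_nondecr.
have e1 : X N.+1 = 1 + z * X N + \sum_(m < N) z ^+ m.+1 * @lace_coef R d beta m (fun=> X (N - m)%N).
  by rewrite {1}/X walk_series_recursion avg_cst.
have e2 : \sum_(m < N) z ^+ m.+1 * @lace_coef R d beta m (fun=> X (N - m)%N) =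
  (\sum_(x <- box N) lace_kernel N x) * X N
   - \sum_(m < N) z ^+ m.+1 * @lace_coef R d beta m (fun=> X N - X (N - m)%N).
  rewrite mulr_suml -(lace_kernel_sum N (fun=> X N)) -sumrB.
  by apply: eq_bigr => m _; rewrite lace_coefB; ring.
have -> : (1 - z - \sum_(x <- box N) lace_kernel N x) * X N - 1 =
   - (X N.+1 - X N) - \sum_(m < N) z ^+ m.+1 * @lace_coef R d beta m (fun=> X N - X (N - m)%N).
  by rewrite e1 e2; ring.
apply: le_trans (ler_normB _ _) _; rewrite normrN ger0_norm ?subr_ge0 // lerD2l.
apply: le_trans (ler_norm_sum _ _ _) _; apply: ler_sum => m _.
rewrite normrM ger0_norm // /lace_norm -mulrA ler_wpM2l //.
apply: le_trans (lace_coef_le _ _) _; rewrite mulr_suml; apply: ler_sum => x _.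
rewrite [`|X N - _|]ger0_norm // subr_ge0.
by apply: walk_series_nondecr => //; exact: leq_subr.
Qed.

End WalkSeries.
Arguments lace_norm {R} d beta z m.

Section Bootstrap.
Context {R : realType} {d : nat}.
Implicit Types (x y v : lattice d) (A k K M B : R) (beta z : R).

Lemma sum_box_le (f : lattice d -> R) (m n : nat) : (forall x, 0 <= f x) -> (m <= n)%N ->
  \sum_(x <- box m) f x <= \sum_(x <- box n) f x.
Proof.
move=> f0 mn; rewrite [leRHS](bigID (fun x => (sup_norm x <= m)%N)) /=.
have -> : \sum_(x <- box m) f x = \sum_(x <- box n | (sup_norm x <= m)%N) f x.
  rewrite -[RHS]big_filter; apply: perm_big; apply: uniq_perm.
  - exact: box_uniq.
  - exact: filter_uniq (box_uniq n).
  move=> x; rewrite mem_filter !mem_box; case: leqP => // xm.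
  by rewrite (leq_trans xm mn).
by rewrite lerDl sumr_ge0.
Qed.

Section FixedParameters.
Variables (A k K M beta z : R).
Hypothesis hd : (4 < d)%N.
Hypothesis GE : green_estimates d A k K.
Hypothesis square_diagram : forall l u v, uniq l ->
  \sum_(x <- l) green x * green (u - x) * green (v - x) ^+ 2 <=
    M * (@green R d v * green (v - u)).
Hypothesis beta01 : 0 <= beta <= 1.
Hypothesis z0 : 0 <= z.
Hypothesis apriori : forall N x, walk_series beta z N (dirac_at x) <= 3 * @green R d x.
Hypothesis small : 2 * beta * (9 * M) <= 1.

Let b0 : 0 <= beta. Proof. by case/andP: beta01. Qed.
Let C0 x : 0 <= green x :> R. Proof. exact: green_ge0 (green_part_bounded GE) x. Qed.
Let d0 : (0 < d)%N. Proof. exact: leq_trans hd. Qed.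

Lemma lace_majorant_series_le N eta v :
  \sum_(m < N) z ^+ m * `|lace beta m [::] eta (dirac_at v)| <=
    \sum_(u <- eta) lace_majorant beta (fun x => 3 * @green R d x) u v.
Proof.
(* Replacing C by 3 C multiplies the square diagram by 3^4 and its bound by 3^2, hence 9 M. *)
apply: (lace_series_le (M0 := 9 * M) beta01 z0) => //.
- by move=> x; rewrite mulr_ge0.
- by move=> x; rewrite greenN.
- move=> l u w ul; have := square_diagram u w ul.
  move/(ler_wpM2l (ler0n R 81)); rewrite mulr_sumr => h.
  apply: le_trans (_ : _ <= 81 * (M * (green w * green (w - u)))) _.
    apply: le_trans h; rewrite le_eqVlt; apply/orP; left; apply/eqP.
    by apply: eq_bigr => x _; ring.
  by rewrite le_eqVlt; apply/orP; left; apply/eqP; ring.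
Qed.

Lemma avg_green_le x : avg green x <= green x :> R.
Proof. by rewrite [leRHS](green_harmonic (green_part_bounded GE)) lerDr /dirac_at. Qed.

(** The majorant is averaged over the first step, and C dominates its averages. The constants are
    those of the majorant for 3 C: 54 = 2 * 3^3. *)
Lemma lace_coef_series_le N x :
  \sum_(m < N) z ^+ m.+1 * `|lace_coef beta m (dirac_at x)| <=
    z * (3 * beta * @green R d 0 * dirac_at 0 x + 54 * beta ^+ 2 * green x ^+ 3).
Proof.
apply: (@le_trans _ _ (z * ((2 * d)%:R^-1 * \sum_(s : 'I_d * bool)
    lace_majorant beta (fun x => 3 * @green R d x) (- unit_step s) (x - unit_step s)))).
  under eq_bigr do rewrite exprS -mulrA.
  rewrite -mulr_sumr ler_wpM2l //.
  apply: (@le_trans _ _ (\sum_(m < N) (2 * d)%:R^-1 * \sum_(s : 'I_d * bool)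
     z ^+ m * `|lace beta m [::] [:: - unit_step s] (dirac_at (x - unit_step s))|)).
    apply: ler_sum => m _; rewrite -mulr_sumr mulrCA ler_wpM2l ?exprn_ge0 //.
    rewrite /lace_coef normrN normrM ger0_norm ?invr_ge0 // ler_wpM2l ?invr_ge0 //.
    apply: le_trans (ler_norm_sum _ _ _) _; apply: ler_sum => s _.
    rewrite le_eqVlt; apply/orP; left; apply/eqP; congr (`|_|).
    by apply: eq_lace => y; rewrite /dirac_at [in RHS]eq_sym subr_eq eq_sym addrC.
  rewrite -mulr_sumr ler_wpM2l ?invr_ge0 // exchange_big; apply: ler_sum => s _.
  by apply: le_trans (lace_majorant_series_le _ _ _) _; rewrite big_seq1.
rewrite ler_wpM2l // /lace_majorant big_split mulrDr; apply: lerD.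
  apply: (@le_trans _ _ (3 * beta * dirac_at 0 x * avg green (0 : lattice d))).
    rewrite /avg mulrCA ler_wpM2l ?invr_ge0 // mulr_sumr; apply: ler_sum => s _.
    rewrite add0r greenN.
    have -> : dirac_at (- unit_step s) (x - unit_step s) = dirac_at 0 x :> R.
      by rewrite /dirac_at -{2}[- unit_step s]add0r (inj_eq (addIr _)).
    by rewrite le_eqVlt; apply/orP; left; apply/eqP; ring.
  apply: (@le_trans _ _ (3 * beta * dirac_at 0 x * @green R d 0)).
    by rewrite ler_wpM2l ?avg_green_le // !mulr_ge0 // /dirac_at.
  by rewrite le_eqVlt; apply/orP; left; apply/eqP; ring.
apply: (@le_trans _ _ (54 * beta ^+ 2 * green x ^+ 2 * avg green x)).
  rewrite /avg -(sum_stepsN (fun e => green (x + e))) [leRHS]mulrCA ler_wpM2l ?invr_ge0 //.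
  rewrite mulr_sumr; apply: ler_sum => s _; rewrite opprK subrK.
  by rewrite le_eqVlt; apply/orP; left; apply/eqP; ring.
by rewrite [green x ^+ 3]exprSr mulrA ler_wpM2l ?avg_green_le // !mulr_ge0 ?exprn_ge0.
Qed.

Lemma lace_kernel_le N x : x != 0 ->
  `|lace_kernel beta z N x| <= z * (54 * beta ^+ 2) * green x ^+ 3.
Proof.
move=> x0; apply: le_trans (ler_norm_sum _ _ _) _.
apply: (@le_trans _ _ (\sum_(m < N) z ^+ m.+1 * `|lace_coef beta m (dirac_at x)|)).
  by apply: ler_sum => m _; rewrite normrM ger0_norm ?exprn_ge0.
apply: le_trans (lace_coef_series_le N x) _.
by rewrite /dirac_at (negPf x0) mulr0 add0r mulrA.
Qed.

(** The factor [z] is kept outside, so that the mass can be compared with [z] before [z] is known to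
    be bounded. *)
Definition lace_mass : R := 3 * beta * @green R d 0 + 54 * beta ^+ 2 * (K ^+ 3 * (K / k)).

Lemma lace_coef_mass_le N :
  \sum_(x <- @box d N) \sum_(m < N) z ^+ m.+1 * `|lace_coef beta m (dirac_at x)| <= z * lace_mass.
Proof.
have K0 := ltW (green_upper_gt0 GE).
apply: le_trans (ler_sum _ (fun x _ => lace_coef_series_le N x)) _.
rewrite -mulr_sumr ler_wpM2l // big_split -!mulr_sumr; apply: lerD.
  rewrite -[leRHS]mulr1 ler_wpM2l ?mulr_ge0 //.
  rewrite (bigD1_seq (0 : lattice d)) ?box_uniq ?mem_box ?sup_norm0 //= /dirac_at eqxx.
  by rewrite big1 ?addr0 // => x /negPf ->.
rewrite ler_wpM2l ?mulr_ge0 ?exprn_ge0 //.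
apply: le_trans (ler_wpM2l _ (sum_phi_tail hd GE (box_uniq N))); last by rewrite exprn_ge0.
rewrite mulr_sumr; apply: ler_sum => x _.
by rewrite (green_cube_le x hd GE) // leq_addr.
Qed.

Lemma lace_norm_sum_le N : \sum_(m < N) lace_norm d beta z m <= z * lace_mass.
Proof.
apply: le_trans (lace_coef_mass_le N); rewrite exchange_big; apply: ler_sum => m _.
rewrite /lace_norm mulr_sumr; apply: sum_box_le => // x.
by rewrite mulr_ge0 ?exprn_ge0.
Qed.

Lemma lace_kernel_mass_le N : `|\sum_(x <- @box d N) lace_kernel beta z N x| <= z * lace_mass.
Proof.
apply: le_trans (lace_coef_mass_le N); apply: le_trans (ler_norm_sum _ _ _) _.
apply: ler_sum => x _; apply: le_trans (ler_norm_sum _ _ _) _.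
by apply: ler_sum => m _; rewrite normrM ger0_norm ?exprn_ge0.
Qed.

End FixedParameters.

End Bootstrap.

Section BootstrapStep.
Context {R : realType} {d : nat}.
Implicit Types (x y v : lattice d) (A k K M B : R) (beta z : R).

Lemma bootstrap_step : (4 < d)%N -> exists2 beta0 : R, 0 < beta0 &
  forall beta z, 0 <= beta <= 1 -> beta < beta0 -> 1 <= z ->
  (forall N x, walk_series beta z N (dirac_at x) <= 3 * @green R d x) ->
  (exists b, forall N, walk_series beta z N (fun _ : lattice d => 1) <= b) ->
  forall N x, walk_series beta z N (dirac_at x) <= 2 * @green R d x.
Proof.
move=> hd; have d0 : (0 < d)%N by apply: leq_trans hd.
have [A [k [K GE]]] := @green_bounds R d hd.
have [M M0 diag] := green_square_diagram hd GE.
have [B B0 pert] := perturbation_bound hd GE.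
have K0 := green_upper_gt0 GE; have k0 := green_lower_gt0 GE.
have A1 : 1 <= A by apply: le_trans (radius_ge15 GE); rewrite ler1n.
have C0 x : 0 <= green x :> R by apply: green_ge0 (green_part_bounded GE) x.
have CK x : 0 <= @green R d x <= K.
  apply/andP; split; first exact: C0.
  rewrite (le_trans (green_upper GE x)) // ler_piMr ?(ltW K0) //; exact: phi_le1.
pose D := K ^+ 3 * (K / k).
have D0 : 0 <= D by rewrite mulr_ge0 ?exprn_ge0 ?divr_ge0 ?(ltW K0) // ltW.
pose G0 := @green R d 0.
have G00 : 0 <= G0 by apply: C0.
(* Each constant stands for one smallness condition: convergence of the laces ([c1]), lace mass at
   most z / 2 ([c2]), |sigma| <= 1/4 ([c3]), contribution of H at most C / 2 ([c4]). *)
pose c1 := 2 * (9 * M); pose c2 := 2 * (3 * G0 + 54 * D).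
pose c3 := 4 * (108 * D); pose c4 := 2 * (108 * (3 * B * K)).
have c10 : 0 <= c1 by rewrite !mulr_ge0.
have c20 : 0 <= c2 by apply: mulr_ge0 => //; apply: addr_ge0; apply: mulr_ge0.
have c30 : 0 <= c3 by do 2![apply: mulr_ge0 => //].
have c40 : 0 <= c4 by rewrite !mulr_ge0 // ltW.
have S0 : 0 < 1 + (c1 + c2 + c3 + c4) by rewrite ltr_wpDr ?addr_ge0.
exists (1 + (c1 + c2 + c3 + c4))^-1; first by rewrite invr_gt0.
move=> beta z beta01 bsmall z1 apriori [X XB] N1 y.
have /andP[b0 b1] := beta01.
have z0 : 0 <= z by apply: le_trans z1.
have bc c : 0 <= c -> c <= c1 + c2 + c3 + c4 -> beta * c <= 1.
  move=> cp cs; rewrite -(mulVf (lt0r_neq0 S0)); apply: ler_pM => //; first exact: ltW.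
  by rewrite (le_trans cs) // lerDr.
have h1 : beta * c1 <= 1 by apply: bc => //; rewrite -!addrA lerDl !addr_ge0.
have h2 : beta * c2 <= 1.
  by apply: bc => //; rewrite -addrA [c1 + c2]addrC -addrA lerDl !addr_ge0.
have h3 : beta * c3 <= 1.
  by apply: bc => //; rewrite addrAC lerDr !addr_ge0.
have h4 : beta * c4 <= 1 by apply: bc => //; rewrite lerDr !addr_ge0.
have bb : beta ^+ 2 <= beta by rewrite expr2 ler_piMl.
have small : 2 * beta * (9 * M) <= 1 by rewrite mulrAC mulrC.
pose T : R := @lace_mass R d k K beta.
have T2 : T <= 2^-1.
  apply: (@le_trans _ _ (beta * (3 * G0 + 54 * D))).
    rewrite /T /lace_mass -/G0 -/D mulrDr; apply: lerD.
      by rewrite mulrAC mulrC.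
    by rewrite mulrAC mulrC ler_wpM2r // mulr_ge0.
  by move: h2; rewrite /c2; move: (3 * G0 + _) => t; rewrite mulrCA; clear; lra.
have lkm N := lace_kernel_mass_le hd GE diag beta01 z0 apriori small N.
have lns N := lace_norm_sum_le hd GE diag beta01 z0 apriori small N.
have lkl N := @lace_kernel_le R d A k K M beta z GE diag beta01 z0 apriori small N.
pose Xs n := walk_series beta z n (fun _ : lattice d => 1).
have Xm m n : (m <= n)%N -> Xs m <= Xs n by move=> mn; apply: walk_series_nondecr.
have Xb n : 0 <= Xs n <= X by rewrite XB andbT; apply: walk_series_ge0.
have X1 n : (0 < n)%N -> 1 <= Xs n.
  move=> n0; apply: le_trans (Xm _ _ n0).
  by rewrite /Xs /walk_series big_ord1 expr0 mul1r.
have ln0 m : 0 <= lace_norm d beta z m by rewrite mulr_ge0 ?exprn_ge0 ?sumr_ge0.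
pose er n := (Xs n.+1 - Xs n) + \sum_(m < n) lace_norm d beta z m * (Xs n - Xs (n - m)%N).
have err e : 0 < e -> exists N0, forall N, (N0 <= N)%N -> er N <= e.
  by move=> e0; apply: (convolution_remainder_small e0 Xm Xb ln0 lns).
pose kap N := 1 - z - \sum_(x <- @box d N) lace_kernel beta z N x.
have kap0 N : (0 < N)%N -> er N <= 1 -> 0 <= kap N.
  move=> N0 e1; have := susceptibility_identity beta01 z0 N d0; rewrite /= -/(kap N).
  rewrite -!/(Xs _) => /le_trans/(_ e1); rewrite ler_norml => /andP[h _].
  have XN := X1 N N0; have : 0 <= kap N * Xs N by move: h; clear; lra.
  by rewrite pmulr_lge0 //; apply: lt_le_trans XN.
have [Na hNa] := err 1 ltr01.
(* kappa >= 0 bounds z by 1 plus the absolute value of the lace mass, hence by 1 + z / 2. *)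
have z2 : z <= 2.
  have := kap0 Na.+1 isT (hNa _ (leqnSn _)); rewrite /kap.
  have := lkm Na.+1; rewrite ler_norml => /andP[h _].
  have zT : z * T <= z * 2^-1 by rewrite ler_wpM2l.
  by move: h zT; rewrite -/T; move: (\sum_(x <- _) _) => s; clear; lra.
pose e := z * (54 * beta ^+ 2).
have e0 : 0 <= e by rewrite !mulr_ge0 ?exprn_ge0.
have eb : e <= beta * 108.
  apply: (@le_trans _ _ (2 * (54 * beta))); last by clear; lra.
  by apply: ler_pM; rewrite ?mulr_ge0 ?exprn_ge0 // ler_wpM2l.
have eD : e * D <= 4^-1.
  apply: le_trans (ler_wpM2r D0 eb) _; rewrite -mulrA; move: h3; rewrite /c3.
  by move: (108 * D) => t; clear; lra.
have eBK : e * (3 * B * K) <= 2^-1.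
  have BK : 0 <= 3 * B * K by rewrite !mulr_ge0 // ltW.
  apply: le_trans (ler_wpM2r BK eb) _; rewrite -[leLHS]mulrA; move: h4; rewrite /c4.
  by move: (108 * _) => t; clear; lra.
(* Raising [N1] to [N] only increases the left-hand side, so [N] is free to make the remainders
   small. The terms kappa V and V_(N+1) - V_N of the identity have the favourable sign and are
   dropped. *)
have main N e' : (N1 <= N)%N -> (0 < N)%N -> er N <= 1 -> er N <= e' ->
    3 / 4 * walk_series beta z N1 (dirac_at y) <= 3 / 2 * green y + K * e'.
  move=> hN N0 er1 ere.
  have kp := kap0 N N0 er1.
  have dir0 x w : 0 <= dirac_at x w :> R by rewrite /dirac_at.
  have GN0 : 0 <= walk_series beta z N (dirac_at y) by apply: walk_series_ge0.
  have G1N : walk_series beta z N1 (dirac_at y) <= walk_series beta z N (dirac_at y).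
    by apply: walk_series_nondecr.
  have id := walk_series_identity beta z (green_harmonic (green_part_bounded GE)) N y.
  rewrite -/(kap N) in id.
  have var : `|@lace_variance R d beta z N| <= e * D.
    exact: (perturbation_variance_le N hd GE e0 (lkl N)).
  have V0 : 0 <= potential beta z green N y by apply: walk_series_ge0.
  have V1 : potential beta z green N y <= potential beta z green N.+1 y.
    by apply: walk_series_nondecr.
  have Hb : walk_series beta z N (fun w => lace_potential beta z green N (y - w)) <= 2^-1 * green y.
    apply: (@le_trans _ _ (walk_series beta z N (fun w => e * B * phi A (d + 1) (y - w)))).
      apply: ler_walk_series => // w; apply: le_trans (ler_norm _) _.
      rewrite -mulrA; apply: pert => //; first exact: lace_kernel_cubic_symmetric.
      exact: lkl.
    rewrite walk_seriesZ.
    have s1 : walk_series beta z N (fun w => phi A (d + 1) (y - w)) <= 3 * (K * green y).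
      apply: (@le_trans _ _ (\sum_(x <- box N) (3 * green x) * phi A (d + 1) (y - x))).
        by apply: saw_series_le => // x; apply: phi_ge0.
      under eq_bigr do rewrite -mulrA.
      by rewrite -mulr_sumr ler_wpM2l // (green_conv_tail GE) // box_uniq.
    apply: le_trans (ler_wpM2l (mulr_ge0 e0 B0) s1) _.
    have -> : e * B * (3 * (K * green y)) = e * (3 * B * K) * green y by ring.
    by rewrite ler_wpM2r.
  have Rb : - (K * e') <= lace_remainder beta z green N y.
    have := lace_remainder_le beta01 z0 N y CK; rewrite ler_norml => /andP[h _].
    apply: le_trans h; rewrite lerN2 ler_wpM2l ?(ltW K0) //.
    by apply: le_trans ere; rewrite /er lerDr subr_ge0 Xm.
  have zs : 3 / 4 <= z + @lace_variance R d beta z N.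
    by move: (le_trans var eD) z1; rewrite ler_norml => /andP[h _]; move: h; clear; lra.
  have kV : 0 <= kap N * potential beta z green N y by apply: mulr_ge0.
  apply: (@le_trans _ _ (3 / 4 * walk_series beta z N (dirac_at y))).
    by rewrite ler_wpM2l // divr_ge0.
  apply: le_trans (ler_wpM2r GN0 zs) _; rewrite id.
  by move: kV V1 Hb Rb; clear; lra.
suff : 3 / 4 * walk_series beta z N1 (dirac_at y) <= 3 / 2 * green y.
  by clear; lra.
apply/ler_addgt0Pr => t t0; have tK : 0 < t / K by rewrite divr_gt0.
have [Nb hNb] := err _ tK.
have := main (maxn (maxn Na Nb) N1.+1) (t / K) _ _ (hNa _ _) (hNb _ _).
rewrite [K * _]mulrC divfK ?gt_eqF //; apply.
- by apply: leq_trans (leq_maxr _ _).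
- by apply: leq_trans (leq_maxr _ _).
- by apply: leq_trans (leq_maxl _ _); apply: leq_maxl.
- by apply: leq_trans (leq_maxl _ _); apply: leq_maxr.
Qed.

End BootstrapStep.

(** * Elementary inequalities for powers *)

Section PowerEstimates.
Context {R : realType}.
Implicit Types (a b t r : R) (n : nat).

Lemma bernoulli n t : 0 <= t -> 1 + n%:R * t <= (1 + t) ^+ n.
Proof.
move=> t0; elim: n => [|n IH]; first by rewrite mul0r addr0 expr0.
rewrite exprS -natr1; apply: le_trans (ler_wpM2l _ IH); last by rewrite addr_ge0.
have : 0 <= n%:R * t * t by rewrite !mulr_ge0.
by move: (n%:R) => m; clear; lra.
Qed.

Lemma bernoulli_sub n t : 0 <= t <= 1 -> 1 - n%:R * t <= (1 - t) ^+ n.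
Proof.
move=> /andP[t0 t1]; elim: n => [|n IH]; first by rewrite mul0r subr0 expr0.
rewrite exprS -natr1; apply: le_trans (ler_wpM2l _ IH); last by rewrite subr_ge0.
have : 0 <= n%:R * t * t by rewrite !mulr_ge0.
by move: (n%:R) => m; clear; lra.
Qed.

Lemma expn_convex a b t n : 0 <= a -> a <= b -> 0 <= t <= 1 ->
  ((1 - t) * a + t * b) ^+ n <= (1 - t) * a ^+ n + t * b ^+ n.
Proof.
move=> a0 ab /andP[t0 t1]; have b0 : 0 <= b by apply: le_trans ab.
elim: n => [|n IH]; first by rewrite !expr0 !mulr1 subrK.
rewrite exprS; have c0 : 0 <= (1 - t) * a + t * b by rewrite addr_ge0 ?mulr_ge0 ?subr_ge0.
apply: le_trans (ler_wpM2l c0 IH) _; rewrite -subr_ge0.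
have -> : (1 - t) * a ^+ n.+1 + t * b ^+ n.+1 - ((1 - t) * a + t * b) * ((1 - t) * a ^+ n + t * b ^+ n)
   = t * (1 - t) * ((b - a) * (b ^+ n - a ^+ n)) by rewrite !exprS; ring.
by rewrite !mulr_ge0 ?subr_ge0 // lerXn2r.
Qed.

Lemma geometric_beats_power r j : 0 < r < 1 ->
  exists2 L : R, 0 <= L & forall m, r ^+ m <= L * (m.+1%:R ^+ j)^-1.
Proof.
move=> /andP[r0 r1].
have del : 0 < r^-1 - 1 by rewrite subr_gt0 invf_gt1.
(* This gives t <= 1 and 3^j t <= r^-1 - 1, so (1 + t)^j <= r^-1 by [pw]. Bernoulli then yields (t
   (m + 1))^j <= (1 + t)^(j (m + 1)) <= r^-(m + 1). *)
have [t tE] : exists t, t = (r^-1 - 1) / (r^-1 - 1 + 3 ^+ j) by eexists.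
have D0 : 0 < r^-1 - 1 + 3 ^+ j by rewrite addr_gt0 ?exprn_gt0.
have t0 : 0 < t by rewrite tE divr_gt0.
have t1 : t <= 1 by rewrite tE ler_pdivrMr // mul1r lerDl exprn_ge0.
have pw i : (1 + t) ^+ i <= 1 + 3 ^+ i * t.
  elim: i => [|i IH]; first by rewrite expr0 expr0 mul1r lerDl ltW.
  rewrite exprS; apply: le_trans (ler_wpM2l _ IH) _; first by rewrite addr_ge0 ?ltW.
  have i1 : 1 <= 3 ^+ i :> R by rewrite exprn_ege1 // ler1n.
  rewrite exprS; move: (3 ^+ i) i1 => c c1.
  have : c * t * t <= c * t by rewrite ler_piMr // mulr_ge0 ?ltW // (lt_le_trans ltr01).
  have : t <= c * t by rewrite ler_peMl // ltW.
  by clear; lra.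
have tj : (1 + t) ^+ j <= r^-1.
  apply: le_trans (pw j) _; rewrite -lerBrDl tE mulrCA ler_piMr ?(ltW del) //.
  by rewrite ler_pdivrMr // mul1r lerDr ltW.
exists ((t ^+ j)^-1 * r^-1); first by rewrite mulr_ge0 ?invr_ge0 ?exprn_ge0 ?ltW.
move=> m; have mj : 0 < m.+1%:R ^+ j :> R by rewrite exprn_gt0 // ltr0n.
rewrite ler_pdivlMr // ler_pdivlMl ?exprn_gt0 //.
rewrite mulrCA [r ^+ m * _]mulrC -exprMn.
rewrite -ler_pdivlMr ?exprn_gt0 // -exprVn -exprS.
apply: (@le_trans _ _ (((1 + t) ^+ m.+1) ^+ j)).
  rewrite lerXn2r ?nnegrE ?mulr_ge0 ?exprn_ge0 ?addr_ge0 ?(ltW t0) //.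
  by apply: le_trans (bernoulli _ (ltW t0)); rewrite mulrC lerDr.
rewrite -exprM mulnC exprM lerXn2r ?nnegrE ?exprn_ge0 ?addr_ge0 ?invr_ge0 ?(ltW t0) //.
exact: ltW.
Qed.

End PowerEstimates.

(** * Continuation up to the critical value *)

Section Continuation.
Context {R : realType} {d : nat} (beta : R).
Hypothesis beta01 : 0 <= beta <= 1.
Implicit Types (x y : lattice d) (f : lattice d -> R) (z A k K : R) (N : nat).

Lemma saw_le_iter_avg n o f : (forall x, 0 <= f x) -> saw beta n o f <= iter n avg f 0.
Proof.
elim: n o f => [//|n IH] o f f0.
rewrite sawS /= /avg ler_wpM2l ?invr_ge0 //; apply: ler_sum => s _.
apply: le_trans (ler_piMl _ (step_weight_le1 beta01 _ _)) _; first by apply: (saw_ge0 beta01).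
apply: le_trans (IH _ _ _) _ => //.
by rewrite iter_avg_shift addr0 add0r.
Qed.

Lemma walk_series_le_green_part z N x : 0 <= z <= 1 ->
  walk_series beta z N (dirac_at x) <= green_part N x.
Proof.
move=> /andP[z0 z1]; apply: ler_sum => n _.
apply: (@le_trans _ _ (saw beta n [::] (dirac_at x))).
  rewrite ler_piMl ?exprn_ile1 //; apply: (saw_ge0 beta01) => y; by rewrite /dirac_at.
apply: le_trans (saw_le_iter_avg _ _ _) _ => [y|]; first by rewrite /dirac_at.
by rewrite iter_avg_dirac sub0r srwN.
Qed.

Lemma ler_walk_series_param z1 z2 N f : 0 <= z1 -> z1 <= z2 -> (forall x, 0 <= f x) ->
  walk_series beta z1 N f <= walk_series beta z2 N f.
Proof.
move=> z0 z12 f0; apply: ler_sum => n _; rewrite ler_wpM2r ?(saw_ge0 beta01) //.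
by rewrite lerXn2r ?nnegrE // (le_trans z0).
Qed.

Lemma walk_series_convex z1 z2 t N f : 0 <= z1 -> z1 <= z2 -> 0 <= t <= 1 ->
  (forall x, 0 <= f x) ->
  walk_series beta ((1 - t) * z1 + t * z2) N f <=
    (1 - t) * walk_series beta z1 N f + t * walk_series beta z2 N f.
Proof.
move=> z0 z12 t01 f0; rewrite /walk_series !mulr_sumr -big_split; apply: ler_sum => n _ /=.
rewrite !mulrA -mulrDl ler_wpM2r ?(saw_ge0 beta01) //; exact: expn_convex.
Qed.

(** Left continuity of a polynomial, made quantitative: for z' = (1 - t) z and n < N, Bernoulli
    gives z'^n >= (1 - N t) z^n. *)
Lemma walk_series_left_limit z N f (b : R) : 0 < z -> (forall x, 0 <= f x) ->
  (forall z', 0 <= z' < z -> walk_series beta z' N f <= b) -> walk_series beta z N f <= b.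
Proof.
move=> z0 f0 h; apply/ler_addgt0Pr => e e0.
set p := walk_series beta z N f.
have p0 : 0 <= p by apply: walk_series_ge0 => //; apply: ltW.
have np0 : 0 <= N%:R * p by rewrite mulr_ge0.
have D0 : 0 < e + N%:R * p + 1 by rewrite ltr_wpDl // addr_ge0 // ltW.
pose t := e / (e + N%:R * p + 1).
have t0 : 0 < t by rewrite divr_gt0.
have t1 : t <= 1 by rewrite ler_pdivrMr // mul1r -addrA lerDl addr_ge0.
have t01 : 0 <= t <= 1 by rewrite t1 ltW.
have hz : (1 - N%:R * t) * p <= b.
  apply: le_trans (h ((1 - t) * z) _); last first.
    by rewrite mulr_ge0 ?subr_ge0 ?(ltW z0) //= gtr_pMl // gtrBl.
  rewrite /p /walk_series mulr_sumr; apply: ler_sum => n _.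
  rewrite mulrA ler_wpM2r ?(saw_ge0 beta01) // exprMn ler_wpM2r ?exprn_ge0 ?(ltW z0) //.
  apply: le_trans (bernoulli_sub n t01).
  by rewrite lerD2l lerN2 ler_wpM2r ?(ltW t0) // ler_nat ltnW.
have tp : N%:R * t * p <= e.
  rewrite mulrAC mulrCA ler_piMr ?(ltW e0) // ler_pdivrMr // mul1r addrAC lerDr.
  by rewrite addr_ge0 // ltW.
by move: hz tp; clear; lra.
Qed.

Lemma saw_dirac_eq0 n x : (n < sup_norm x)%N -> saw beta n [::] (dirac_at x) = 0.
Proof.
move=> nx; rewrite (@saw_local _ _ _ _ _ _ (fun=> 0 * 1)) ?sawZ ?mul0r // => y yn.
rewrite /dirac_at; case: eqP => // yx; move: yn; rewrite yx leqNgt nx //.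
Qed.

(* Only the terms with n >= |x| contribute, and each of them gains the factor
   (z1 / z2)^n; this beats the polynomial decay of the Green function. *)
Lemma walk_series_ratio_bounded A k K z1 z2 (X : R) : (4 < d)%N -> green_estimates d A k K ->
  0 < z1 < z2 -> (forall N, walk_series beta z2 N (fun _ : lattice d => 1) <= X) ->
  exists2 L : R, 0 <= L & forall N x, walk_series beta z1 N (dirac_at x) <= L * green x.
Proof.
move=> hd GE /andP[z10 z12] hX; have z20 : 0 < z2 by apply: lt_trans z12.
have k0 := green_lower_gt0 GE.
have A1 : 1 <= A by apply: le_trans (radius_ge15 GE); rewrite ler1n.
have A0 : 0 < A by apply: lt_le_trans A1.
have X0 : 0 <= X by apply: le_trans (hX 0%N); rewrite /walk_series big_ord0.
pose r := z1 / z2.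
have r01 : 0 < r < 1 by rewrite divr_gt0 //= ltr_pdivrMr // mul1r.
have r0 : 0 <= r by have /andP[/ltW] := r01.
have [L L0 hL] := geometric_beats_power (d - 2) r01.
pose c := d%:R + A; have c0 : 0 < c by rewrite ltr_wpDl.
have c1 : 1 <= c by apply: le_trans A1 _; rewrite lerDr.
exists (X * (L * c ^+ (d - 2) / k)) => [|N x].
  by rewrite !mulr_ge0 ?exprn_ge0 ?invr_ge0 // ltW.
set m := sup_norm x.
have decay : walk_series beta z1 N (dirac_at x) <= X * r ^+ m.
  apply: (@le_trans _ _ (\sum_(n < N) z2 ^+ n * saw beta n [::] (fun=> 1) * r ^+ m)).
    apply: ler_sum => n _; have [nm|mn] := ltnP n m.
      by rewrite saw_dirac_eq0 // mulr0 !mulr_ge0 ?exprn_ge0 ?(saw_ge0 beta01) ?(ltW z20).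
    have -> : z1 ^+ n = z2 ^+ n * r ^+ n.
      by rewrite -exprMn /r mulrCA divff ?mulr1 // gt_eqF.
    rewrite mulrAC; apply: ler_pM.
    - by rewrite mulr_ge0 ?exprn_ge0 ?(ltW z20) // (saw_ge0 beta01) // => y; rewrite /dirac_at.
    - by rewrite exprn_ge0.
    - rewrite ler_wpM2l ?exprn_ge0 ?(ltW z20) //; apply: (ler_walk_sum beta01) => _ y.
      by rewrite /dirac_at; case: eqP.
    - by have /andP[_ r1] := r01; rewrite ler_wiXn2l // ltW.
  rewrite -mulr_suml ler_wpM2r ?exprn_ge0 //.
  exact: hX.
apply: le_trans decay _; rewrite -mulrA ler_wpM2l //.
apply: le_trans (hL m) _; rewrite -!mulrA ler_wpM2l //.
have gl := green_lower GE x.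
have phl : (m.+1%:R ^+ (d - 2))^-1 <= c ^+ (d - 2) * phi A (d - 2) x.
  rewrite /phi -exprVn -exprMn lerXn2r ?nnegrE ?mulr_ge0 ?invr_ge0 ?sqrtr_ge0 ?(ltW c0) //.
  have q0 : 0 < norm2 x + A by apply: ltr_wpDl => //; apply: norm2_ge0.
  rewrite ler_pdivlMr ?sqrtr_gt0 // ler_pdivrMl ?ltr0n //.
  rewrite -[leRHS]ger0_norm ?mulr_ge0 ?(ltW c0) // -sqrtr_sqr ler_wsqrtr //.
  apply: (@le_trans _ _ (c * m.+1%:R ^+ 2)); last first.
    by rewrite exprMn mulrC ler_wpM2l ?exprn_ge0 // expr2 ler_peMl // ltW.
  rewrite /c mulrDl; apply: lerD; last by rewrite ler_peMr ?(ltW A0) // exprn_ege1 // ler1n.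
  apply: le_trans (norm2_le_sup_norm x) _.
  by rewrite ler_wpM2l // lerXn2r ?nnegrE // ler_nat.
apply: le_trans phl _; rewrite ler_wpM2l ?exprn_ge0 ?(ltW c0) //.
by rewrite ler_pdivlMl.
Qed.

Lemma walk_series_critical_le A k K zc : (4 < d)%N -> green_estimates d A k K -> 0 <= zc ->
  (forall z, 1 <= z ->
    (forall N x, walk_series beta z N (dirac_at x) <= 3 * @green R d x) ->
    (exists b, forall N, walk_series beta z N (fun _ : lattice d => 1) <= b) ->
    forall N x, walk_series beta z N (dirac_at x) <= 2 * @green R d x) ->
  (forall z, 0 <= z < zc -> exists b, forall N, walk_series beta z N (fun _ : lattice d => 1) <= b) ->
  forall N x, walk_series beta zc N (dirac_at x) <= 2 * @green R d x.
Proof.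
move=> hd GE zc0 boot sub.
have bdd := green_part_bounded GE.
have C0 x : 0 <= @green R d x by apply: green_ge0.
have dir0 x y : 0 <= dirac_at x y :> R by rewrite /dirac_at.
have low z : 0 <= z <= 1 -> forall N x, walk_series beta z N (dirac_at x) <= 2 * @green R d x.
  move=> z01 N x; apply: le_trans (walk_series_le_green_part N x z01) _.
  by apply: le_trans (green_ge bdd N x) _; rewrite ler_peMl // ler1n.
have [zc1|zc1] := leP zc 1; first by apply: low; rewrite zc0.
pose good z := forall N x, walk_series beta z N (dirac_at x) <= 2 * @green R d x.
pose S := [set z | 1 <= z < zc /\ good z].
have S1 : S 1 by split; [rewrite lexx | apply: low; rewrite ler01 lexx].
have hS : has_sup S by split; [exists 1 | exists zc => z [/andP[_ /ltW]]].
pose s := sup S.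
have s1 : 1 <= s by apply: sup_upper_bound.
have szc : s <= zc by apply: ge_sup; [exists 1 | move=> z [/andP[_ /ltW]]].
have below z : 0 <= z < s -> good z.
  move=> /andP[z0 zs] N x.
  have [z' [_ gz'] zz'] : exists2 z', S z' & z < z'.
    have := sup_adherent (_ : 0 < s - z) hS; rewrite subr_gt0 => /(_ zs)[z' Sz'].
    by rewrite -/s subKr => h; exists z'.
  by apply: le_trans (gz' N x); apply: ler_walk_series_param => //; apply: ltW.
have gs : good s.
  move=> N x; apply: walk_series_left_limit => // [|z' z's]; last exact: below.
  by apply: lt_le_trans s1.
have [sE|slt] : s = zc \/ s < zc by move: szc; rewrite le_eqVlt => /orP[/eqP|]; [left|right].
  by rewrite -sE.
exfalso.
(* The susceptibility is finite at [z2], so at [z1] the series is bounded by L C, with no control on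
   the size of [L]. *)
pose z1 := (2 * s + zc) / 3; pose z2 := (s + 2 * zc) / 3.
have [sz1 z12 z2c] : [/\ s < z1, z1 < z2 & z2 < zc].
  by rewrite /z1 /z2; move: slt; clear; split; lra.
have s0 : 0 <= s by apply: le_trans s1.
have z10 : 0 < z1 by apply: le_lt_trans sz1.
have [X hX] : exists b, forall N, walk_series beta z2 N (fun _ : lattice d => 1) <= b.
  by apply: sub; rewrite z2c andbT ltW // (lt_trans z10).
have [L L0 hL] := walk_series_ratio_bounded hd GE (introT andP (conj z10 z12)) hX.
(* The weight of [z1] is so small that t L <= 1. Convexity then gives at most 2 C + C = 3 C at a
   point beyond [s], and the bootstrap brings it back to 2 C. *)
pose t := (L + 1)^-1; have L1 : 0 < L + 1 by rewrite ltr_wpDl.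
have t0 : 0 < t by rewrite invr_gt0.
have t1 : t <= 1 by rewrite invf_le1 // lerDr.
have tL : t * L <= 1 by rewrite ler_pdivrMl // mulr1 lerDl.
pose z := (1 - t) * s + t * z1.
have sz : s < z.
  have -> : z = s + t * (z1 - s) by rewrite /z; ring.
  by rewrite ltrDl mulr_gt0 // subr_gt0.
have zz1 : z <= z1.
  have -> : z = z1 - (1 - t) * (z1 - s) by rewrite /z; ring.
  by rewrite gerBl mulr_ge0 ?subr_ge0 // ltW.
have zzc : z < zc by apply: le_lt_trans zz1 (lt_trans z12 z2c).
have z1' : 1 <= z by apply: le_trans s1 (ltW sz).
have gz : good z.
  apply: boot => // [N x|]; last by apply: sub; rewrite zzc andbT (le_trans s0) // ltW.
  apply: le_trans (walk_series_convex N s0 (ltW sz1) (_ : 0 <= t <= 1) (dir0 x)) _.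
    by rewrite t1 ltW.
  have h1 : (1 - t) * walk_series beta s N (dirac_at x) <= 2 * green x.
    apply: le_trans (ler_wpM2l _ (gs N x)) _; first by rewrite subr_ge0.
    by rewrite ler_piMl ?mulr_ge0 // gerBl ltW.
  have h2 : t * walk_series beta z1 N (dirac_at x) <= green x.
    apply: le_trans (ler_wpM2l (ltW t0) (hL N x)) _.
    by rewrite mulrA ler_piMl.
  by move: h1 h2; clear; lra.
have : z <= s by apply: sup_upper_bound => //; split=> //; rewrite z1'.
by rewrite leNgt sz.
Qed.

End Continuation.

(** * Walks as step sequences *)

Section StepSequences.
Context {d : nat}.
Implicit Types (v e : lattice d) (o L : seq (lattice d)) (s : 'I_d * bool) (l : seq ('I_d * bool)).

Fixpoint step_words n : seq (seq ('I_d * bool)) :=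
  if n is n'.+1 then [seq s :: l | s <- enum {: 'I_d * bool}, l <- step_words n']
  else [:: [::]].

Lemma mem_step_words n l : (l \in step_words n) = (size l == n).
Proof.
elim: n l => [|n IH] l /=; first by rewrite inE; case: l.
apply/allpairsP/idP => [[[s l'] /= [_ + ->]]|]; first by rewrite IH.
by case: l => //= s l; rewrite eqSS => ln; exists (s, l); rewrite mem_enum IH.
Qed.

Lemma step_words_uniq n : uniq (step_words n).
Proof.
elim: n => [//|n IH] /=; apply: allpairs_uniq; rewrite ?enum_uniq //.
by move=> [s l] [s' l'] _ _ [-> ->].
Qed.

Lemma big_step_words (R : Type) (idx : R) (op : Monoid.com_law idx) n (F : seq ('I_d * bool) -> R) :
  \big[op/idx]_(l <- step_words n.+1) F l =
  \big[op/idx]_(s : 'I_d * bool) \big[op/idx]_(l <- step_words n) F (s :: l).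
Proof. by rewrite /= big_allpairs_dep big_enum. Qed.

Definition short_words N : seq (seq ('I_d * bool)) := flatten [seq step_words n | n <- iota 0 N].

Lemma mem_short_words N l : (l \in short_words N) = (size l < N)%N.
Proof.
apply/flatten_mapP/idP => [[n]|lN]; first by rewrite mem_iota mem_step_words => ? /eqP ->.
by exists (size l); rewrite ?mem_iota ?mem_step_words.
Qed.

Lemma big_short_words (R : Type) (idx : R) (op : Monoid.com_law idx) N (F : seq ('I_d * bool) -> R) :
  \big[op/idx]_(l <- short_words N) F l =
  \big[op/idx]_(n < N) \big[op/idx]_(l <- step_words n) F l.
Proof.
rewrite /short_words big_flatten big_map.
by have -> : iota 0 N = index_iota 0 N; rewrite ?big_mkord // /index_iota subn0.
Qed.

Lemma short_words_uniq N : uniq (short_words N).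
Proof.
rewrite /short_words; elim: N => [//|N IH].
rewrite -addn1 iotaD map_cat flatten_cat /= cats0 cat_uniq IH step_words_uniq andbT.
apply/hasPn => l; rewrite add0n mem_step_words -/(short_words N) mem_short_words => /eqP ->.
by rewrite ltnn.
Qed.

Definition displacement l : lattice d := \sum_(s <- l) unit_step s.

Fixpoint vertices l : seq (lattice d) :=
  0 :: (if l is s :: l' then [seq unit_step s + v | v <- vertices l'] else [::]).

Lemma size_vertices l : size (vertices l) = (size l).+1.
Proof. by elim: l => [//|s l IH] /=; rewrite size_map IH. Qed.

Lemma last_vertices v0 l : last v0 (vertices l) = displacement l.
Proof.
rewrite /displacement; elim: l v0 => [|s l IH] v0 /=; first by rewrite big_nil.
rewrite big_cons -(IH (- unit_step s)).
by have <- := last_map (fun v => unit_step s + v) (vertices l) (- unit_step s); rewrite subrr.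
Qed.

Lemma vertices_inj : injective vertices.
Proof.
elim=> [|s l IH] [|s' l'] //=; first by case: l'.
  by case: l {IH}.
move=> [] E; have ss : s = s'.
  by move: (congr1 (head 0) E); case: (l) => [|??]; case: (l') => [|??] /=; rewrite !addr0; apply: unit_step_inj.
by rewrite -ss in E *; congr cons; apply: IH; apply: inj_map E; apply: addrI.
Qed.

(** A nonzero integer coordinate has square at least 1, which already exhausts the sum. *)
Lemma unit_stepP v : reflect (exists s, v = unit_step s) (\sum_(i < d) v ord0 i ^+ 2 == 1).
Proof.
apply: (iffP eqP) => [vE|[[i b] ->]]; last first.
  rewrite (bigD1 i) //= big1 => [|j ji]; rewrite !mxE /= ?eqxx ?mulr1 ?addr0 -?exprM.
    by rewrite -signr_odd oddM andbF.
  by rewrite (negPf ji) mulr0 expr0n.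
have [i vi] : exists i, v ord0 i != 0.
  apply/existsP; rewrite -negb_forall; apply/negP => /forallP v0.
  by move: vE; rewrite big1 // => i _; rewrite (eqP (v0 i)) expr0n.
have sq0 j : 0 <= v ord0 j ^+ 2 by apply: sqr_ge0.
have rest0 : 0 <= \sum_(j < d | j != i) v ord0 j ^+ 2 by apply: sumr_ge0.
have vi1 : 1 <= v ord0 i ^+ 2.
  by move: (sq0 i); rewrite le_eqVlt eq_sym sqrf_eq0 (negPf vi) /= -gtz0_ge1.
move: vE; rewrite (bigD1 i) //= => vE.
have /eqP r0 : \sum_(j < d | j != i) v ord0 j ^+ 2 == 0.
  by rewrite eq_le rest0 andbT -(lerD2l (v ord0 i ^+ 2)) addr0 vE.
have /eqP : v ord0 i ^+ 2 = 1 by move: vE; rewrite r0 addr0.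
rewrite sqrf_eq1 => vi2; exists (i, v ord0 i == -1); apply/rowP => j.
rewrite !mxE eqxx /=; have [->|ji] := eqVneq j i.
  by rewrite mulr1; case/orP: vi2 => /eqP ->.
rewrite mulr0; apply/eqP; rewrite -sqrf_eq0.
by move: (psumr_eq0P (fun j _ => sq0 j) r0 ji) => ->.
Qed.

Lemma neighboursP v v' : reflect (exists s, v' = v + unit_step s) (neighbours v v').
Proof.
rewrite /neighbours; have -> : \sum_(i < d) (v ord0 i - v' ord0 i) ^+ 2 =
    \sum_(i < d) (v' - v) ord0 i ^+ 2.
  by apply: eq_bigr => i _; rewrite !mxE -sqrrN opprB.
apply: (iffP (unit_stepP _)) => -[s sE]; exists s; first by rewrite -sE addrC subrK.
by rewrite sE addrC addKr.
Qed.

Lemma path_verticesP v L :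
  reflect (exists l, v :: L = [seq v + u | u <- vertices l]) (path (@neighbours d) v L).
Proof.
elim: L v => [|v' L IH] v.
  by apply: (iffP idP) => // _; exists [::]; rewrite /= addr0.
apply: (iffP andP) => [[/neighboursP[s v'E] /IH[l lE]]|[[|s l] //=]].
  exists (s :: l); rewrite /= addr0 lE -map_comp; congr cons; apply: eq_map => u /=.
  by rewrite addrA v'E.
rewrite -map_comp addr0 => -[E]; have hd : v' = v + unit_step s.
  by move: (congr1 (head 0) E); case: (l) => [|??] /=; rewrite addr0.
split; first by apply/neighboursP; exists s.
by apply/IH; exists l; rewrite E; apply: eq_map => u /=; rewrite hd addrA.
Qed.

(** List form of the number of self-intersections: each pair of equal vertices is counted at its
    earlier member. *)
Fixpoint collisions L : nat := if L is v :: L' then (count_mem v L' + collisions L')%N else 0%N.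

Lemma count_mem_shift v e L : count_mem (e + v) [seq e + u | u <- L] = count_mem v L.
Proof. by rewrite count_map; apply: eq_count => u /=; rewrite (inj_eq (addrI e)). Qed.

Lemma collisions_shift e L : collisions [seq e + u | u <- L] = collisions L.
Proof. by elim: L => //= v L ->; rewrite count_mem_shift. Qed.

Lemma collisions_nth v0 L : collisions L =
  (\sum_(j < size L) \sum_(i < size L | j < i) (nth v0 L i == nth v0 L j))%N.
Proof.
elim: L => [|v L IH] /=; first by rewrite big_ord0.
rewrite big_ord_recl; congr (_ + _)%N.
  rewrite big_mkcond big_ord_recl /= add0n -sum1_count (big_nth v0) big_mkord.
  by rewrite big_mkcond; apply: eq_bigr => i _ /=; case: eqP.
rewrite IH; apply: eq_bigr => j _; rewrite [in RHS]big_mkcond big_ord_recl /= add0n.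
by rewrite -big_mkcond.
Qed.

(** Words of steps parametrise the walks from the origin. Equalities between dependent pairs are
    reduced to lists of vertices through [codom_walk_of]. *)
Definition walk_of l : walk d :=
  Tagged (fun n => {ffun 'I_n.+1 -> lattice d}) [ffun i : 'I_(size l).+1 => nth 0 (vertices l) i].

Lemma codom_walk_of l : codom (tagged (walk_of l)) = vertices l.
Proof.
apply: (@eq_from_nth _ 0); rewrite size_codom card_ord ?size_vertices // => i il.
rewrite codomE (nth_map ord0) ?size_enum_ord // ffunE.
by rewrite nth_enum_ord.
Qed.

Lemma walk_of_inj : injective walk_of.
Proof. by move=> l l' E; apply: vertices_inj; rewrite -!codom_walk_of E. Qed.

Lemma walk_of_codom (w : walk d) l : codom (tagged w) = vertices l -> w = walk_of l.
Proof.
case: w => n g /= E; have nl : n = size l.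
  by apply: succn_inj; rewrite -size_vertices -E size_codom card_ord.
subst n; congr existT; apply/ffunP => i; rewrite ffunE -E.
by rewrite codomE (nth_map i) ?size_enum_ord // nth_ord_enum.
Qed.

Lemma nn_path_codom n (g : trajectory d n) :
  nn_path g <-> path (@neighbours d) (g ord0) (behead (codom g)).
Proof.
have sz : size (codom g) = n.+1 by rewrite size_codom card_ord.
have nthE (i : 'I_n.+1) : nth 0 (codom g) i = g i.
  by rewrite codomE (nth_map i) ?size_enum_ord // nth_ord_enum.
have codE : codom g = g ord0 :: behead (codom g).
  by rewrite -(nthE ord0); case: (codom g) sz.
split=> [nn|/(pathP 0) P i j ji].
  apply/(pathP 0) => i; rewrite size_behead sz /= => ni.
  rewrite -codE nth_behead.
  by rewrite (nthE (widen_ord (leqnSn n) (Ordinal ni))) (nthE (lift ord0 (Ordinal ni))); apply: nn.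
have := P i; rewrite size_behead sz /= -codE nth_behead -ji !nthE; apply.
by have := ltn_ord j; rewrite ji ltnS.
Qed.

Lemma map_shift0 e L : e = 0 -> [seq e + v | v <- L] = L.
Proof. by move=> ->; elim: L => //= v L ->; rewrite add0r. Qed.

Lemma paths_toE x : paths_to x = walk_of @` [set l | displacement l = x].
Proof.
apply/seteqP; split=> [w [nn w0 wx]|_ [l /= lx <-]].
  move/nn_path_codom: nn; rewrite w0 => /path_verticesP[l lE].
  have cw : codom (tagged w) = vertices l.
    rewrite -(map_shift0 (vertices l) (erefl 0)) -lE.
    by rewrite -w0 codomE enum_ordSl.
  exists l; last by rewrite (walk_of_codom cw).
  rewrite /= -(last_vertices 0) -cw codomE -wx enum_ordSr map_rcons last_rcons.
  by [].
split.
- apply/nn_path_codom; rewrite codom_walk_of /= ffunE.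
  apply/path_verticesP; exists l; rewrite map_shift0 //=; last by case: (l).
  by case: (l).
- by rewrite /= ffunE; case: (l).
- rewrite -lx -(last_vertices 0) /= ffunE /= (last_nth 0) size_vertices.
  by case: (l).
Qed.

Lemma self_intersections_walk_of l :
  self_intersections (tagged (walk_of l)) = collisions (vertices l).
Proof.
rewrite (collisions_nth 0) /self_intersections -sum1_card size_vertices.
rewrite pair_big_dep /= (eq_bigl (fun st : 'I_(size l).+1 * 'I_(size l).+1 => (st.1 < st.2)%N &&
    (tagged (walk_of l) st.1 == tagged (walk_of l) st.2))); last by move=> st; rewrite inE.
rewrite big_mkcondr /=; apply: eq_bigr => st _.
by rewrite !ffunE eq_sym; case: eqP.
Qed.

End StepSequences.

Section WalkSums.
Context {R : realType} {d : nat} (beta : R).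
Hypothesis d0 : (0 < d)%N.
Implicit Types (x y v e : lattice d) (o : seq (lattice d)) (s : 'I_d * bool).
Implicit Types (l : seq ('I_d * bool)) (f : lattice d -> R).

(* The initial vertex is left out of the contacts with the past: they are
   accounted for by the preceding step. *)
Definition contacts o l : nat :=
  (collisions (vertices l) + \sum_(v <- behead (vertices l)) count_mem v o)%N.

Lemma contacts_nil l : contacts [::] l = collisions (vertices l).
Proof. by rewrite /contacts big1 ?addn0. Qed.

Lemma contacts_cons o s l :
  contacts o (s :: l) =
  (count_mem (unit_step s) (0%R :: o) + contacts (shift_past (unit_step s) o) l)%N.
Proof.
set e := unit_step s; rewrite /contacts /= big_map collisions_shift -/e.
have shiftE v : count_mem v (shift_past e o) = count_mem (e + v) (0 :: o).
  rewrite /shift_past count_map; apply: eq_count => u /=.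
  by rewrite subr_eq addrC.
have -> : (\sum_(v <- behead (vertices l)) count_mem v (shift_past e o) =
    \sum_(v <- behead (vertices l)) count_mem (e + v)%R (0%R :: o))%N.
  by apply: eq_bigr => v _.
have -> : (\sum_(v <- vertices l) count_mem (e + v)%R o =
    count_mem e o + \sum_(v <- behead (vertices l)) count_mem (e + v)%R o)%N.
  by case: (l) => [|s' l'] /=; rewrite big_cons addr0.
have -> : (count_mem 0%R [seq (e + v)%R | v <- vertices l] =
    nat_of_bool (0%R == e) + \sum_(v <- behead (vertices l)) nat_of_bool (0%R == (e + v)%R))%N.
  rewrite count_map -sum1_count big_mkcond /=.
  have hE v : (if (e + v)%R == 0%R then 1%N else 0%N) = nat_of_bool (0%R == (e + v)%R) by rewrite eq_sym; case: eqP.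
  rewrite (eq_bigr _ (fun v _ => hE v)).
  by case: (l) => [|s' l'] /=; rewrite big_cons addr0.
by rewrite /= [in RHS]big_split /=; ring.
Qed.

Lemma saw_step_words n o f : (2 * d)%:R ^+ n * saw beta n o f =
  \sum_(l <- step_words n) (1 - beta) ^+ contacts o l * f (displacement l).
Proof.
have d2 : (2 * d)%:R != 0 :> R by rewrite pnatr_eq0 muln_eq0 /= -lt0n.
elim: n o f => [|n IH] o f.
  by rewrite big_seq1 /contacts /= big_nil addn0 mul1r expr0 mul1r /displacement big_nil.
rewrite sawS exprSr -mulrA mulVKf // big_step_words mulr_sumr; apply: eq_bigr => s _.
rewrite mulrCA IH mulr_sumr; apply: eq_bigr => l _.
by rewrite contacts_cons exprD mulrA /displacement big_cons.
Qed.

Lemma iter_avg_step_words n f y : (2 * d)%:R ^+ n * iter n avg f y =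
  \sum_(l <- @step_words d n) f (y + displacement l).
Proof.
have d2 : (2 * d)%:R != 0 :> R by rewrite pnatr_eq0 muln_eq0 /= -lt0n.
elim: n y => [|n IH] y.
  by rewrite big_seq1 expr0 mul1r /displacement big_nil addr0.
rewrite iterS /avg exprSr -mulrA mulVKf // big_step_words mulr_sumr; apply: eq_bigr => s _.
by rewrite IH; apply: eq_bigr => l _; rewrite /displacement big_cons addrA.
Qed.

Lemma srw_probE n x : srw_prob n x = srw n x :> R.
Proof.
have d2 : (2 * d)%:R ^+ n != 0 :> R by rewrite expf_neq0 // pnatr_eq0 muln_eq0 /= -lt0n.
apply: (mulfI d2); rewrite -srwN -(sub0r x) -iter_avg_dirac iter_avg_step_words.
rewrite /srw_prob mulr_sumr big_mkcond /=.
have cods (t : {ffun 'I_n -> 'I_d * bool}) : \sum_(i < n) unit_step (t i) = displacement (codom t).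
  by rewrite /displacement codomE big_map big_enum.
have words : perm_eq [seq codom t | t : {ffun 'I_n -> 'I_d * bool} <- enum {: {ffun 'I_n -> 'I_d * bool}}] (@step_words d n).
  apply: uniq_perm; last 1 first.
  - move=> l; rewrite mem_step_words; apply/mapP/eqP => [[t _ ->]|ln].
      by rewrite size_codom card_ord.
    exists [ffun i : 'I_n => tnth (in_tuple l) (cast_ord (esym ln) i)]; rewrite ?mem_enum //.
    subst n; rewrite codomE; apply: esym.
    under eq_map => i do rewrite ffunE cast_ord_id.
    exact: map_tnth_enum.
  - rewrite map_inj_uniq; first exact: enum_uniq.
    by move=> t t' E; apply: (can_inj fgraphK); apply: val_inj; rewrite /= -!codom_ffun.
  - exact: step_words_uniq.
rewrite -(perm_big _ words) big_map big_enum /=; apply: eq_bigr => t _.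
rewrite cods prodr_const card_ord exprVn mulfV // /dirac_at add0r.
by case: eqP.
Qed.

(** The factor (2 d)^n contained in z^n turns the averages over steps into sums over words, whence z
    = 2 d lambda. *)
Lemma walk_series_short_words lam N f :
  walk_series beta ((2 * d)%:R * lam) N f =
  \sum_(l <- short_words N) lam ^+ size l * saw_weight beta (walk_of l) * f (displacement l).
Proof.
rewrite big_short_words; apply: eq_bigr => n _.
rewrite exprMn mulrAC saw_step_words mulr_suml big_seq [RHS]big_seq.
apply: eq_bigr => l; rewrite mem_step_words => /eqP <-.
by rewrite /saw_weight self_intersections_walk_of contacts_nil mulrC mulrA.
Qed.

End WalkSums.

(** * From truncated series to the extended real Green functions *)

Section GreenFunctions.
Context {R : realType} {d : nat} (beta : R).
Hypothesis d0 : (0 < d)%N.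
Hypothesis beta01 : 0 <= beta <= 1.
Implicit Types (x : lattice d) (lam : R).

Lemma saw_weight_ge0 (w : walk d) : 0 <= saw_weight beta w.
Proof. by rewrite exprn_ge0 // subr_ge0; have /andP[] := beta01. Qed.

Lemma G_sawE lam x : G_saw beta lam x =
  \esum_(l in [set l | displacement l = x])
    (lam ^+ size l * saw_weight beta (walk_of l))%:E.
Proof.
rewrite /G_saw paths_toE esum_image //.
by move=> l l' _ _; apply: walk_of_inj.
Qed.

Lemma walk_series_dirac lam N x :
  (walk_series beta ((2 * d)%:R * lam) N (dirac_at x))%:E =
  (\sum_(l \in [set` [seq l <- short_words N | displacement l == x]])
    (lam ^+ size l * saw_weight beta (walk_of l))%:E)%E.
Proof.
rewrite -fsbig_seq; last by rewrite filter_uniq // short_words_uniq.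
rewrite sumEFin big_filter walk_series_short_words //; congr EFin; rewrite [RHS]big_mkcond /=.
by apply: eq_bigr => l _; rewrite /dirac_at; case: eqP; rewrite ?mulr1 ?mulr0.
Qed.

Lemma walk_series_le_G_saw lam N x : 0 <= lam ->
  ((walk_series beta ((2 * d)%:R * lam) N (dirac_at x))%:E <= G_saw beta lam x)%E.
Proof.
move=> lam0; rewrite G_sawE; apply: esum_ge.
exists [set` [seq l <- short_words N | displacement l == x]]; last by rewrite walk_series_dirac.
by split; [exact: finite_seq | move=> l /=; rewrite mem_filter => /andP[/eqP]].
Qed.

Lemma G_saw_le lam x (b : R) : 0 <= lam ->
  (forall N, walk_series beta ((2 * d)%:R * lam) N (dirac_at x) <= b) ->
  (G_saw beta lam x <= b%:E)%E.
Proof.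
move=> lam0 hb; rewrite G_sawE; apply: ge_ereal_sup => _ [A [finA AX] <-].
have /finite_seqP[r rE] := finA; have [N NE] : exists N, N = (\max_(l <- r) size l).+1 by eexists.
apply: (@le_trans _ _ (walk_series beta ((2 * d)%:R * lam) N (dirac_at x))%:E); last first.
  by rewrite lee_fin.
rewrite walk_series_dirac; apply: lee_fsum_nneg_subset => //; first exact: finite_seq.
- move=> l /set_mem Al; apply: mem_set; rewrite /= mem_filter mem_short_words (introT eqP (AX _ Al)) /=.
  by rewrite NE ltnS; apply: leq_bigmax_seq => //; move: Al; rewrite rE.
- by move=> l _; rewrite lee_fin mulr_ge0 ?saw_weight_ge0 ?exprn_ge0.
Qed.

Lemma susceptibility_bounded lam : 0 <= lam ->
  (\esum_(x in [set: lattice d]) G_saw beta lam x < +oo)%E ->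
  exists b, forall N, walk_series beta ((2 * d)%:R * lam) N (fun _ : lattice d => 1) <= b.
Proof.
move=> lam0 hfin; set S := (\esum_(x in _) _)%E in hfin.
have S0 : (0 <= S)%E.
  apply: esum_ge0 => x _; apply: esum_ge0 => w _.
  by rewrite lee_fin mulr_ge0 ?saw_weight_ge0 ?exprn_ge0.
have SE : S = (fine S)%:E by rewrite fineK // ge0_fin_numE.
exists (fine S) => N; rewrite -lee_fin -SE.
have -> : walk_series beta ((2 * d)%:R * lam) N (fun _ : lattice d => 1) =
    \sum_(x <- @box d N) walk_series beta ((2 * d)%:R * lam) N (dirac_at x).
  rewrite /walk_series [RHS]exchange_big; apply: eq_bigr => n _ /=.
  rewrite (saw_dirac _ _ _ (ltnW (ltn_ord n))) -mulr_sumr; congr (_ * _).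
  by apply: eq_bigr => x _; rewrite mulr1.
rewrite -sumEFin; apply: esum_ge; exists [set` @box d N]; first by split; first exact: finite_seq.
rewrite -fsbig_seq ?box_uniq //; apply: lee_sum => x _; exact: walk_series_le_G_saw.
Qed.

Lemma green_part_le_G_rw K x : ((green_part K x)%:E <= @G_rw R d x)%E.
Proof.
rewrite /green_part -sumEFin /G_rw -(big_mkord xpredT (fun n => (srw n x)%:E)).
under eq_bigr => n _ do rewrite -(srw_probE d0).
apply: nneseries_lim_ge => n _ _; rewrite lee_fin srw_probE //; exact: srw_ge0.
Qed.

Lemma green_le_G_rw x : (exists b : R, forall K (y : lattice d), green_part K y <= b) ->
  ((@green R d x)%:E <= G_rw x)%E.
Proof.
move=> bdd; have G0 : (0 <= @G_rw R d x)%E.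
  by apply: le_trans (green_part_le_G_rw 0 x); rewrite /green_part big_ord0.
case E : (G_rw x) (G0) => [r| |] // _; last by rewrite leey.
rewrite lee_fin; apply: green_le => K.
by have := green_part_le_G_rw K x; rewrite E lee_fin.
Qed.

Lemma lambda_c_ge0 : 0 <= lambda_c d beta.
Proof.
rewrite /lambda_c; set S := [set lam | _].
(* Without a supremum, [sup] takes the default value 0. *)
have [hS|/sup_out ->//] := pselect (has_sup S).
have [[lam [lam0 h]] _] := hS; exact: le_trans lam0 (sup_upper_bound hS (conj lam0 h)).
Qed.

Lemma subcritical_bounded z : 0 <= z < (2 * d)%:R * lambda_c d beta ->
  exists b, forall N, walk_series beta z N (fun _ : lattice d => 1) <= b.
Proof.
move=> /andP[z0 zc]; have d2 : 0 < (2 * d)%:R :> R by rewrite ltr0n muln_gt0.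
rewrite mulrC -ltr_pdivrMr // in zc.
move: zc; rewrite /lambda_c; set S := [set lam | _] => zc.
have hS : has_sup S.
  (* If the set had no supremum, the critical value would be the default 0 and no z >= 0 would lie
     below it. *)
  apply: contrapT => /sup_out S0; move: zc; rewrite S0.
  by rewrite ltNge divr_ge0 // ltW.
have [lam [lam0 hlam] zlam] : exists2 lam, S lam & z / (2 * d)%:R < lam.
  have := sup_adherent (_ : 0 < sup S - z / (2 * d)%:R) hS; rewrite subr_gt0 => /(_ zc)[lam Slam].
  by rewrite subKr => h; exists lam.
have [b hb] := susceptibility_bounded lam0 hlam.
exists b => N; apply: le_trans (hb N); apply: ler_walk_series_param => //.
by rewrite mulrC -ler_pdivrMr // ltW.
Qed.

End GreenFunctions.

Theorem mainTheorem1 (R : realType) (d : nat) (hd : (4 < d)%N) :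
  exists beta0 : R, 0 < beta0 /\
    forall beta : R, 0 <= beta <= 1 -> beta < beta0 ->
      forall x : lattice d,
        (G_saw beta (lambda_c d beta) x <= 2%:E * G_rw x)%E.
Proof.
have [beta0 beta00 boot] := @bootstrap_step R d hd.
exists beta0; split=> // beta beta01 bb x.
have d0 : (0 < d)%N by apply: leq_trans hd.
have [A [k [K GE]]] := @green_bounds R d hd.
have bdd := green_part_bounded GE.
have lc0 : 0 <= lambda_c d beta by exact: lambda_c_ge0.
have crit N y : walk_series beta ((2 * d)%:R * lambda_c d beta) N (dirac_at y) <= 2 * @green R d y.
  apply: (walk_series_critical_le beta01 hd GE) => [|z z1 h3 hX|z].
  - by rewrite mulr_ge0.
  - exact: boot.
  - exact: subcritical_bounded.
apply: le_trans (G_saw_le d0 beta01 lc0 (fun N => crit N x)) _.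
by rewrite EFinM lee_wpmul2l ?lee_fin // green_le_G_rw.
Qed.
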